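(* Let $n\ge 3$, let $\Omega\subset\mathbb{R}^n$ be an NTA domain with harmonic measure $\omega$ (with a finite pole in $\Omega$ or, if $\Omega$ is unbounded, with a finite pole or pole at infinity), and let $d\ge 1$. If $Q\in\partial\Omega$ and $\mathrm{Tan}(\omega,Q)\subset\mathcal{P}_d$, then there exists an integer $k$ with $1\le k\le d$ such that $\mathrm{Tan}(\omega,Q)\subset\mathcal{F}_k$.
   Context: $B(x,r)$ is the closed ball with center $x$ and radius $r$. A domain is a connected open set. Polynomial harmonic measures. For a non-zero harmonic polynomial $h:\mathbb{R}^n\to\mathbb{R}$ with $h(0)=0$ let $h^\pm=\max(\pm h,0)$. The harmonic measure $\omega_h$ associated to $h$ is the Radon measure supported on $\{h=0\}$ determined by $\int\varphi\,d\omega_h=\int_{\{h^+>0\}}h^+\Delta\varphi=\int_{\{h^->0\}}h^-\Delta\varphi$ for all $\varphi\in C_c^\infty(\mathbb{R}^n)$. Put $\mathcal{P}_d=\{\omega_h: h$ a non-zero harmonic polynomial of degree $\le d$ with $h(0)=0\}$ and, for $k\ge1$, $\mathcal{F}_k=\{\omega_h: h$ a (non-zero) homogeneous harmonic polynomial of degree $k\}$. Tangent measures. For a Radon measure $\mu$ on $\mathbb{R}^n$, $x\in\mathbb{R}^n$, $r>0$, let $T_{x,r}[\mu](E)=\mu(x+rE)$. For $x\in\mathrm{spt}\,\mu$, a non-zero Radon measure $\nu$ belongs to $\mathrm{Tan}(\mu,x)$ if there are $r_i\downarrow0$ and $c_i>0$ such that $c_iT_{x,r_i}[\mu]\rightharpoonup\nu$,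 i.e. $c_i\int f\,dT_{x,r_i}[\mu]\to\int f\,d\nu$ for all $f\in C_c(\mathbb{R}^n)$. NTA domains. An open set $\Omega$ satisfies the corkscrew condition with constants $M>1$, $R>0$ if for all $Q\in\partial\Omega$ and $0<r<R$ there is $A\in\Omega$ with $M^{-1}r<|A-Q|<r$ and $\mathrm{dist}(A,\partial\Omega)>M^{-1}r$. An $M$-non-tangential ball $B(X,r)$ in $\Omega$ is an open ball contained in $\Omega$ with $M^{-1}r<\mathrm{dist}(B(X,r),\partial\Omega)<Mr$. A Harnack chain from $X_1$ to $X_2$ is a finite sequence of $M$-non-tangential balls, the first containing $X_1$, the last containing $X_2$, consecutive balls intersecting. A domain $\Omega$ satisfies the Harnack chain condition with constants $M,R$ if for all $Q\in\partial\Omega$ and $0<r<R$: whenever $X_1,X_2\in\Omega\cap B(Q,r/4)$ satisfy $\min_{j}\mathrm{dist}(X_j,\partial\Omega)>\varepsilon$ and $|X_1-X_2|<2^k\varepsilon$, there is a Harnack chain from $X_1$ to $X_2$ of length $Mk$ whose balls all have diameter at least $M^{-1}\min_j\mathrm{dist}(X_j,\partial\Omega)$. A domain $\Omega$ is NTA if for some $M>1$, $R>0$ it satisfies the corkscrew and Harnack chain conditions and $\mathbb{R}^n\setminus\overline\Omega$ satisfies the corkscrew condition; if $\partial\Omega$ is unbounded one requires $R=\infty$. Harmonic measure with pole at infinity. On an unbounded NTA domain $\Omega$, a harmonic measure with pole at infinity is a Radon measure $\omega^\infty$ supported on $\partial\Omega$ with $\int\varphi\,d\omega^\infty=\int_\Omega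 u\Delta\varphi$ for all $\varphi\in C_c^\infty(\mathbb{R}^n)$, where $u$ is harmonic and positive in $\Omega$ and $u=0$ on $\partial\Omega$; the pair $(\omega^\infty,u)$ is unique up to multiplication by a positive scalar. *)

(* Defs.v *)
From HB Require Import structures.
From mathcomp Require Import all_boot all_order all_algebra.
From mathcomp Require Import all_classical all_reals all_analysis.
From mathcomp Require Import measurable_realfun.
From mathcomp Require mpoly.

Set Implicit Arguments.
Unset Strict Implicit.
Unset Printing Implicit Defensive.

Import Order.TTheory GRing.Theory Num.Theory.
Import numFieldNormedType.Exports.
(* the notations of mpoly clash with those of analysis *)
Import (canonicals, coercions) mpoly.

Local Open Scope classical_set_scope.
Local Open Scope ring_scope.

(* 'rV[R]_n with its Borel sigma-algebra *)
Notation borelRV R n := (g_sigma_algebraType (@open 'rV[R]_n)).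

Section lebesgue_measure_on_rV.
Context {R : realType}.

Definition consRV n (p : measurableTypeR R * borelRV R n) : borelRV R n.+1 :=
  row_mx (const_mx p.1 : 'rV[R]_1) (p.2 : 'rV[R]_n).

Lemma consRV0 n (p : R * 'rV[R]_n) : (consRV p : 'rV_n.+1) 0 0 = p.1.
Proof. by rewrite /consRV mxE; case: splitP => [j _|j]; rewrite ?mxE. Qed.

Lemma consRVS n (p : R * 'rV[R]_n) (i : 'I_n) :
  (consRV p : 'rV_n.+1) 0 (lift 0 i) = p.2 0 i.
Proof.
rewrite /consRV mxE; case: splitP => [j|j [ij]]; first by rewrite ord1.
by congr (p.2 0 _); exact: val_inj.
Qed.

Lemma invk_gt0 k : 0 < k.+1%:R^-1 :> R.
Proof. by rewrite invr_gt0 ltr0n. Qed.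

Lemma rV_ball n (x y : 'rV[R]_n) e : 0 < e ->
  (forall i, `|x 0 i - y 0 i| < e) <-> ball x e y.
Proof.
move=> e0; rewrite -ball_normE /ball_/=.
have -> : `|x - y| = \big[Num.max/0]_ij `|(x - y) ij.1 ij.2|.
  exact: mx_normrE.
split.
  move=> H; apply/bigmax_ltP; split => // -[i j] _ /=.
  by rewrite ord1 !mxE.
by move=> /bigmax_ltP[_ H] i; have := H (0, i) isT; rewrite /= !mxE.
Qed.

Lemma rat_rV_ball n (x : 'rV[R]_n) e : 0 < e ->
  exists q : 'rV[rat]_n, ball x e (map_mx ratr q).
Proof.
move=> e0.
have H i : exists q : rat, `|x 0 i - ratr q| < e.
  have : x 0 i - e < x 0 i + e by rewrite ltrD2l gtrN.
  move=> /rat_in_itvoo[q].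
  by rewrite in_itv/= => xq; exists q; rewrite distrC ltr_distl.
have [f Hf] := choice H.
by exists (\row_i f i); apply/rV_ball => // i; rewrite !mxE.
Qed.

Lemma measurable_consRV n : @measurable_fun _ _
  (measurableTypeR R * borelRV R n)%type (borelRV R n.+1) setT (@consRV n).
Proof.
apply: (@measurability _ _ _ (borelRV R n.+1) _ _ (@open 'rV[R]_n.+1)) => // _ [U oU <-].
rewrite setTI.
pose D := [set qk : 'rV[rat]_n.+1 * nat |
  ball (map_mx ratr qk.1 : 'rV[R]_n.+1) qk.2.+1%:R^-1 `<=` U].
pose B (qk : 'rV[rat]_n.+1 * nat) : set (R * 'rV[R]_n) :=
  ball (ratr (qk.1 0 0) : R) qk.2.+1%:R^-1 `*`
  ball (\row_i ratr (qk.1 0 (lift 0 i)) : 'rV[R]_n) qk.2.+1%:R^-1.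
have BE qk : @consRV n @^-1` ball (map_mx ratr qk.1 : 'rV[R]_n.+1) qk.2.+1%:R^-1
   = B qk.
  apply/seteqP; split => [p /rV_ball H|p [p1 /rV_ball p2]].
    split; first by have := H (invk_gt0 _) 0; rewrite consRV0 mxE.
    apply/rV_ball => // i.
    by have := H (invk_gt0 _) (lift 0 i); rewrite consRVS !mxE.
  apply/rV_ball => // i; rewrite mxE.
  case: (unliftP 0 i) => [j ->|->]; last by rewrite consRV0.
  by rewrite consRVS; have := p2 (invk_gt0 _) j; rewrite mxE.
suff -> : @consRV n @^-1` U = \bigcup_(qk in D) B qk.
  rewrite bigcup_mkcond; apply: countable_bigcupT_measurable.
    exact: countableP.
  move=> qk; case: ifP => // _; apply: measurableX.
    exact: measurable_ball.
  by apply: sub_sigma_algebra; exact: ball_open.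
apply/seteqP; split => [p Up|p [qk Dqk]]; last first.
  by rewrite -BE => /Dqk.
have /nbhs_ballP[e /= e0 He] : nbhs (consRV p) U by exact: open_nbhs_nbhs.
have [k ke] : exists k : nat, k.+1%:R^-1 < e / 2.
  have e20 : 0 < e / 2 by rewrite divr_gt0.
  have [k _ /(_ k (leqnn k)) /= ke] := near_infty_natSinv_lt (PosNum e20).
  by exists k.
have [q qk] := @rat_rV_ball n.+1 (consRV p) k.+1%:R^-1 (invk_gt0 k).
exists (q, k); last by rewrite -BE; exact: ball_sym.
move=> y /= qy; apply: He.
by apply: (@ball_split R 'rV[R]_n.+1 (map_mx ratr q)); exact: le_ball (ltW ke) _ _.
Qed.

Lemma measurable_hd n :
  @measurable_fun _ _ (borelRV R n.+1) (measurableTypeR R) setT (fun x => x 0 0).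
Proof.
apply: (@measurability _ _ (borelRV R n.+1) (measurableTypeR R) setT
  (fun x : 'rV[R]_n.+1 => x 0 0) (@RGenOpens.G R)).
  exact: RGenOpens.measurableE.
move=> _ [_ [a [b ->]] <-].
rewrite setTI; apply: sub_sigma_algebra; apply: open_comp.
  by move=> x _; exact: coord_continuous.
exact: interval_open.
Qed.

Lemma measurable_tl n : @measurable_fun _ _ (borelRV R n.+1) (borelRV R n) setT
  (fun x => \row_i x 0 (lift 0 i)).
Proof.
apply: (@measurability _ _ _ (borelRV R n) _ _ (@open 'rV[R]_n)) => // _ [U oU <-].
rewrite setTI; apply: sub_sigma_algebra; apply: open_comp => // x _.
move=> A /nbhs_ballP[e /= e0 eA]; apply/nbhs_ballP; exists e => //= y.
move=> /(rV_ball _ _ e0) xy; apply: eA; apply/rV_ball => // i.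
by rewrite !mxE; exact: xy.
Qed.

Section step.
Variables (n : nat) (mu : {sigma_finite_measure set (borelRV R n) -> \bar R}).

Definition lebesgue_step : set (borelRV R n.+1) -> \bar R :=
  pushforward (lebesgue_measure \x mu)%E (@consRV n).

Let mcons := @measurable_consRV n.

Let step0 : lebesgue_step set0 = 0%E.
Proof. by rewrite /lebesgue_step /pushforward preimage_set0 measure0. Qed.

Let step_ge0 A : (0 <= lebesgue_step A)%E.
Proof. exact: measure_ge0. Qed.

Let step_sigma_additive : semi_sigma_additive lebesgue_step.
Proof.
move=> F mF tF mUF; rewrite /lebesgue_step /pushforward preimage_bigcup.
apply: measure_semi_sigma_additive.
- by move=> k; rewrite -[X in measurable X]setTI; exact: mcons.
- apply/trivIsetP => /= i j _ _ ij; rewrite -preimage_setI.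
  by move/trivIsetP : tF => /(_ _ _ _ _ ij) ->//; rewrite preimage_set0.
- by rewrite -preimage_bigcup -[X in measurable X]setTI; exact: mcons.
Qed.

HB.instance Definition _ := isMeasure.Build _ _ _ lebesgue_step
  step0 step_ge0 step_sigma_additive.

Let step_sigma_finite : sigma_finite setT lebesgue_step.
Proof.
have /sigma_finiteP[F [TF ndF Foo]] :=
  sigma_finiteT (lebesgue_measure :
    {sigma_finite_measure set (measurableTypeR R) -> \bar R}).
have /sigma_finiteP[G [TG ndG Goo]] := sigma_finiteT mu.
pose hd (x : borelRV R n.+1) : measurableTypeR R := (x : 'rV[R]_n.+1) 0 0.
pose tl (x : borelRV R n.+1) : borelRV R n :=
  \row_i (x : 'rV[R]_n.+1) 0 (lift 0 i).
exists (fun k => hd @^-1` F k `&` tl @^-1` G k).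
  apply/esym; rewrite -subTset => x _.
  have [i _ Fi] : (\bigcup_i F i) (hd x) by rewrite -TF.
  have [j _ Gj] : (\bigcup_i G i) (tl x) by rewrite -TG.
  exists (maxn i j) => //; split => /=.
  - by apply: (subsetPset _ _ (ndF _ _ (leq_maxl i j))).
  - by apply: (subsetPset _ _ (ndG _ _ (leq_maxr i j))).
move=> k; have [mF Fk] := Foo k; have [mG Gk] := Goo k; split.
  apply: measurableI.
    by rewrite -[X in measurable X]setTI; exact: measurable_hd.
  by rewrite -[X in measurable X]setTI; exact: measurable_tl.
rewrite /lebesgue_step /pushforward.
rewrite (_ : _ @^-1` _ = F k `*` G k).
  by rewrite product_measure1E// lte_mul_pinfty// ge0_fin_numE.
have htl p : tl (consRV p) = p.2.
  by apply/rowP => i; rewrite mxE consRVS.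
by apply/seteqP; split => p /=; rewrite /hd consRV0 htl.
Qed.

HB.instance Definition _ := Measure_isSigmaFinite.Build _ _ _ lebesgue_step
  step_sigma_finite.

End step.

(* Lebesgue measure on R^n, as an iterated product *)
Fixpoint lebesgue_measure_rV n :
    {sigma_finite_measure set (borelRV R n) -> \bar R} :=
  match n return {sigma_finite_measure set (borelRV R n) -> \bar R} with
  | 0 => \d_(0 : borelRV R 0)
  | m.+1 => lebesgue_step (lebesgue_measure_rV m)
  end.

End lebesgue_measure_on_rV.

Section definitions.
Context {R : realType} {n : nat}.
Local Notation point := 'rV[R]_n.
Local Notation measureRV := {measure set (borelRV R n) -> \bar R}.

(* The library norm `| x | on 'rV[R]_n is the sup norm. *)
Definition enorm (x : point) : R := Num.sqrt (\sum_i x 0 i ^+ 2).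

Definition eball (x : point) (r : R) : set point := [set y | enorm (y - x) < r].

Definition closed_eball (x : point) (r : R) : set point :=
  [set y | enorm (y - x) <= r].

(* inf is 0 on the empty set, so both distances are only meaningful between
   nonempty sets. *)
Definition dist (x : point) (A : set point) : R :=
  inf [set enorm (x - y) | y in A].

Definition setdist (A B : set point) : R :=
  inf [set d | exists x y, [/\ A x, B y & d = enorm (x - y)]].

Definition boundary (A : set point) : set point := closure A `\` A°.

Definition domain (A : set point) : Prop := open A /\ connected A.

Definition partial (i : 'I_n) (f : point -> R) : point -> R :=
  fun x => 'D_(delta_mx 0 i) f x.

Definition continuous_on (U : set point) (f : point -> R) : Prop :=
  forall x, U x -> {for x, continuous f}.

(* f is of class C^k on the open set U *)
Fixpoint Ck (k : nat) (U : set point) (f : point -> R) : Prop :=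
  match k with
  | 0 => continuous_on U f
  | k'.+1 => continuous_on U f /\
      forall i, (forall x, U x -> derivable f x (delta_mx 0 i)) /\
                Ck k' U (partial i f)
  end.

Definition laplacian (f : point -> R) (x : point) : R :=
  \sum_i partial i (partial i f) x.

Definition harmonic (U : set point) (u : point -> R) : Prop :=
  Ck 2 U u /\ forall x, U x -> laplacian u x = 0.

Definition compactly_supported (f : point -> R) : Prop :=
  compact (closure [set x | f x != 0]).

Definition Cc (f : point -> R) : Prop :=
  continuous f /\ compactly_supported f.

Definition Cc_infty (f : point -> R) : Prop :=
  (forall k, Ck k setT f) /\ compactly_supported f.

Definition radon (mu : measureRV) : Prop :=
  forall K : set point, compact K -> (mu K < +oo)%E.

(* meaningful for closed A *)
Definition supported_on (mu : measureRV) (A : set point) : Prop :=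
  mu (~` A) = 0%E.

Definition spt (mu : measureRV) : set point :=
  [set x | forall U : set point, open U -> U x -> (0 < mu U)%E].

Definition poly_fun (p : mpoly.mpoly n R) (x : point) : R :=
  mpoly.meval (fun i => x 0 i) p.

Definition is_polynomial_harmonic_measure (h : point -> R) (nu : measureRV) :=
  let hp x := Num.max (h x) 0 in
  let hm x := Num.max (- h x) 0 in
  [/\ radon nu, supported_on nu [set x | h x = 0] &
    forall phi, Cc_infty phi ->
      (\int[nu]_x (phi x)%:E =
         \int[lebesgue_measure_rV n]_(x in [set x | (0 < hp x)%R])
           (hp x * laplacian phi x)%:E /\
       \int[nu]_x (phi x)%:E =
         \int[lebesgue_measure_rV n]_(x in [set x | (0 < hm x)%R])
           (hm x * laplacian phi x)%:E)%E].

(* mpoly.msize p is 1 + deg p, and 0 for p = 0 *)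
Definition Pset (d : nat) : set measureRV :=
  [set nu | exists p : mpoly.mpoly n R,
    [/\ (exists x, poly_fun p x != 0), harmonic setT (poly_fun p),
        (mpoly.msize p <= d.+1)%N, poly_fun p 0 = 0 &
        is_polynomial_harmonic_measure (poly_fun p) nu]].

Definition Fset (k : nat) : set measureRV :=
  [set nu | exists p : mpoly.mpoly n R,
    [/\ (exists x, poly_fun p x != 0), harmonic setT (poly_fun p),
        p \is mpoly.ishomog1 k mpoly.mdeg &
        is_polynomial_harmonic_measure (poly_fun p) nu]].

(* T_{x,r}[mu] *)
Definition rescale (mu : measureRV) (x : point) (r : R)
    (E : set (borelRV R n)) : \bar R :=
  mu [set x + r *: (y : point) | y in E].

Definition Tan (mu : measureRV) (x : point) : set measureRV :=
  [set nu | [/\ spt mu x, radon nu, nu setT != 0%E &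
    exists r c : nat -> R,
      [/\ (forall i, 0 < r i), nonincreasing_seq r, r @ \oo --> (0 : R),
          (forall i, 0 < c i) &
          forall f, Cc f ->
            ((c i)%:E * \int[rescale mu x (r i)]_y (f y)%:E)%E @[i --> \oo]
              --> (\int[nu]_y (f y)%:E)%E]]].

(* rho is the constant written R in the usual definition; it may be +oo. *)
Definition corkscrew (M : R) (rho : \bar R) (Om : set point) : Prop :=
  forall Q r, boundary Om Q -> 0 < r -> (r%:E < rho)%E ->
    exists A, [/\ Om A, M^-1 * r < enorm (A - Q), enorm (A - Q) < r &
                  M^-1 * r < dist A (boundary Om)].

Definition nontangential_ball (M : R) (Om : set point) (X : point) (r : R) :=
  [/\ 0 < r, eball X r `<=` Om,
      M^-1 * r < setdist (eball X r) (boundary Om) &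
      setdist (eball X r) (boundary Om) < M * r].

(* c i and s i are the center and radius of the i-th of the N.+1 balls. *)
Definition harnack_chain (M : R) (Om : set point) (X1 X2 : point)
    (N : nat) (c : nat -> point) (s : nat -> R) : Prop :=
  [/\ (forall i, (i <= N)%N -> nontangential_ball M Om (c i) (s i)),
      eball (c 0%N) (s 0%N) X1, eball (c N) (s N) X2 &
      forall i, (i < N)%N ->
        eball (c i) (s i) `&` eball (c i.+1) (s i.+1) !=set0].

(* A chain of length M k is one of at most M k balls, with k >= 1; 2 * s i is the
   diameter of the i-th ball. *)
Definition harnack_chain_condition (M : R) (rho : \bar R) (Om : set point) :=
  forall Q r, boundary Om Q -> 0 < r -> (r%:E < rho)%E ->
  forall X1 X2 (e : R) (k : nat), 0 < e -> (0 < k)%N ->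
    Om X1 -> closed_eball Q (r / 4) X1 ->
    Om X2 -> closed_eball Q (r / 4) X2 ->
    let delta := Num.min (dist X1 (boundary Om)) (dist X2 (boundary Om)) in
    e < delta -> enorm (X1 - X2) < 2 ^+ k * e ->
    exists N c s,
      [/\ harnack_chain M Om X1 X2 N c s, N.+1%:R <= M * k%:R &
          forall i, (i <= N)%N -> M^-1 * delta <= 2 * s i].

Definition NTA (Om : set point) : Prop :=
  domain Om /\
  exists (M : R) (rho : \bar R),
    [/\ 1 < M, (0 < rho)%E, (~ bounded_set (boundary Om) -> rho = +oo%E) &
        [/\ corkscrew M rho Om, harnack_chain_condition M rho Om &
            corkscrew M rho (~` closure Om)]].

(* u solves the Dirichlet problem in Om with boundary data f; when Om is
   unbounded, u is required to vanish at infinity. *)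
Definition dirichlet_solution (Om : set point) (f u : point -> R) : Prop :=
  [/\ {within closure Om, continuous u}, harmonic Om u,
      (forall x, boundary Om x -> u x = f x) &
      forall e, 0 < e -> exists L : R,
        forall x, Om x -> L < enorm x -> `|u x| < e].

(* omega represents f |-> u_f(X), where u_f is the solution of the Dirichlet
   problem with boundary data f. *)
Definition harmonic_measure_finite_pole (Om : set point) (X : point)
    (omega : measureRV) : Prop :=
  [/\ radon omega, supported_on omega (boundary Om) &
      forall f, Cc f -> exists2 u, dirichlet_solution Om f u &
        (\int[omega]_y (f y)%:E = (u X)%:E)%E].

Definition harmonic_measure_pole_infty (Om : set point)
    (omega : measureRV) : Prop :=
  [/\ radon omega, supported_on omega (boundary Om) &
      exists u : point -> R,
        [/\ {within closure Om, continuous u}, harmonic Om u,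
            (forall x, Om x -> 0 < u x),
            (forall x, boundary Om x -> u x = 0) &
            forall phi, Cc_infty phi ->
              (\int[omega]_x (phi x)%:E =
               \int[lebesgue_measure_rV n]_(x in Om)
                 (u x * laplacian phi x)%:E)%E]].

Definition harmonic_measure (Om : set point) (omega : measureRV) : Prop :=
  (exists2 X, Om X & harmonic_measure_finite_pole Om X omega) \/
  (~ bounded_set Om /\ harmonic_measure_pole_infty Om omega).

End definitions.

Arguments Pset {R} n d.
Arguments Fset {R} n k.

(* Main.v *)
(* The only facts about omega that matter are that it is Radon and that its
   tangent measures come from harmonic polynomials.  Test a tangent measure
   nu = omega_h against a radial bump phi(./s): since nu = Delta h^+ = Delta h^-,
   the mass G(s) = int phi(./s) dnu behaves like s^(n-2+i) as s -> 0 and like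
   s^(n-2+k) as s -> oo, where i and k are the lowest and the highest degrees
   occurring in h.  The constants in front are positive because one of h^+, h^-
   has a nonzero homogeneous part and, by Euler's identity,
   int H Delta phi > 0 for H >= 0 homogeneous of positive degree.

   Let j be the least degree occurring in any tangent measure, and let
   b = (3/2) 2^(n-2+j), a factor strictly between the dyadic growth rates of the
   degrees j and j+1.  If the mass g of omega at Q did not satisfy
   g(2r) <= b g(r) along some dyadic sequence of scales, then blowing up at the
   first failures of this inequality would, by weak compactness, give a tangent
   measure with G(2^a) <= b^a G(1) for all a, hence homogeneous of degree j,
   but with G(1) >= b G(1/2), which contradicts G(1) = 2^(n-2+j) G(1/2).  So
   the inequality holds along a dyadic sequence; it passes to every tangent
   measure and excludes all degrees above j. *)

From HB Require Import structures.
Require Import Defs.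
From mathcomp Require Import all_boot all_order all_algebra.
From mathcomp Require Import all_classical all_reals all_analysis.
From mathcomp Require Import measurable_realfun.
From mathcomp Require Import ring lra.
From mathcomp Require mpoly.

Set Implicit Arguments.
Unset Strict Implicit.
Unset Printing Implicit Defensive.

Import Order.TTheory GRing.Theory Num.Theory.
Import numFieldNormedType.Exports.
(* the notations of mpoly clash with those of analysis *)
Import (canonicals, coercions) mpoly.

Local Open Scope classical_set_scope.
Local Open Scope ring_scope.

(** * Positive functionals on compactly supported functions *)

(** A smooth bump replaces the indicator of a ball because nu = Delta h^+ is only available against
    smooth test functions. It is radial, so that its Laplacian is again a function of |x|^2 to which
    Euler's identity applies, and it decreases in |x|, so that g is monotone and information on a
    dyadic grid extends to all radii. Compactness comes from the choice of the radii: above a first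
    failure lie as many good steps as wanted, and they bound the rescaled masses at all larger
    scales, hence the integral of every test function. Long runs of good steps exist because a
    tangent measure of lowest degree j grows at small scales with a dyadic factor close to 2^(n-2+j)
    < b, and omega inherits this at any finite number of scales. Any number strictly between 1 and 2
    could play the part of 3/2. Minimality of j already excludes lower degrees from every tangent
    measure, so an upper bound on the growth is enough for homogeneity. *)

Section compactly_supported_functions.
Context {R : realType} {n : nat}.
Local Notation point := 'rV[R]_n.
Implicit Types f g : point -> R.

Lemma closed_ball0_compact (L : R) : compact [set x : point | `|x| <= L].
Proof.
apply: bounded_closed_compact.
  exists L; split; first exact: num_real.
  by move=> M LM x /= xL; exact: le_trans xL (ltW LM).
by apply: (@closed_comp _ _ (fun x : point => `|x|) [set y : R | y <= L]);
  [move=> x _; exact: norm_continuous|exact: closed_le].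
Qed.

Lemma Cc_bounded_supp f : Cc f -> exists2 L, 0 < L & forall x, L < `|x| -> f x = 0.
Proof.
move=> [_ /compact_bounded[M [_ MP]]].
exists (`|M| + 1); first by rewrite ltr_wpDl.
move=> x xL; apply/eqP/negPn/negP => fx0.
have MM : M < `|M| + 1 by rewrite (le_lt_trans (ler_norm M))// ltrDl.
have : closure [set x | f x != 0] x by exact: subset_closure.
by move=> /(MP _ MM) /=; rewrite leNgt xL.
Qed.

Lemma Cc_of_bounded_supp f L : continuous f ->
  (forall x, L < `|x| -> f x = 0) -> Cc f.
Proof.
move=> cf f0; split=> //.
apply: (@subclosed_compact _ _ [set x : point | `|x| <= L]).
- exact: closed_closure.
- exact: closed_ball0_compact.
- rewrite -[X in _ `<=` X](_ : closure [set x : point | `|x| <= L] = _).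
    apply: closureS => x /= fx; rewrite leNgt; apply/negP => /f0 f0x.
    by rewrite f0x eqxx in fx.
  apply/esym/closure_id; apply: compact_closed; first exact: norm_hausdorff.
  exact: closed_ball0_compact.
Qed.

Lemma Cc_dom f g : Cc f -> continuous g -> (forall x, f x = 0 -> g x = 0) -> Cc g.
Proof.
move=> /Cc_bounded_supp[L _ f0] cg fg.
by apply: (@Cc_of_bounded_supp _ L) => // x /f0/fg.
Qed.

Lemma CcD f g : Cc f -> Cc g -> Cc (fun x => f x + g x).
Proof.
move=> Cf Cg; have [L _ f0] := Cc_bounded_supp Cf.
have [M _ g0] := Cc_bounded_supp Cg.
apply: (@Cc_of_bounded_supp _ (Num.max L M)) => [x|x].
  exact: (cvgD (proj1 Cf x) (proj1 Cg x)).
by rewrite gt_max => /andP[/f0 -> /g0 ->]; rewrite addr0.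
Qed.

Lemma CcM f g : Cc f -> continuous g -> Cc (fun x => f x * g x).
Proof.
move=> Cf cg; apply: (Cc_dom Cf) => [x|x ->]; last by rewrite mul0r.
exact: (cvgM (proj1 Cf x) (cg x)).
Qed.

Lemma CcZ a f : Cc f -> Cc (fun x => a * f x).
Proof.
move=> Cf; apply: (Cc_dom Cf) => [x|x ->]; last by rewrite mulr0.
exact: (cvgM (cvg_cst _) (proj1 Cf x)).
Qed.

Lemma CcN f : Cc f -> Cc (fun x => - f x).
Proof. by move=> /(CcZ (-1)); under eq_fun do rewrite mulN1r. Qed.

Lemma CcB f g : Cc f -> Cc g -> Cc (fun x => f x - g x).
Proof. by move=> Cf /CcN; exact: CcD. Qed.

Lemma Cc_comp f (k : R -> R) : Cc f -> continuous k -> k 0 = 0 ->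
  Cc (fun x => k (f x)).
Proof.
move=> Cf ck k0; apply: (Cc_dom Cf) => [x|x ->//].
exact: (continuous_comp (proj1 Cf x) (ck _)).
Qed.

Lemma Cc0 : Cc (fun _ : point => 0 : R).
Proof.
by apply: (@Cc_of_bounded_supp _ 0) => //; exact: cst_continuous.
Qed.

Lemma Cc_sum (I : Type) (r : seq I) (P : pred I) (F : I -> point -> R) :
  (forall i, Cc (F i)) -> Cc (fun x => \sum_(i <- r | P i) F i x).
Proof.
move=> CF; elim: r => [|i r IH].
  by under eq_fun do rewrite big_nil; exact: Cc0.
under eq_fun do rewrite big_cons.
by case: (P i) => //; exact: CcD.
Qed.

Lemma Cc_bounded f : Cc f -> exists2 M, 0 < M & forall x, `|f x| <= M.
Proof.
move=> Cf; have [L L0 f0] := Cc_bounded_supp Cf.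
have : compact (f @` [set x : point | `|x| <= L]).
  apply: continuous_compact; last exact: closed_ball0_compact.
  by apply: continuous_subspaceT => x; exact: Cf.1.
move=> /compact_bounded[M [_ MP]].
exists (`|M| + 1); first by rewrite ltr_wpDl.
move=> x; have [xL|xL] := leP `|x| L; last by rewrite f0// normr0 ltW// ltr_wpDl.
apply: (MP (`|M| + 1)); last by exists x.
by rewrite (le_lt_trans (ler_norm M)) ?ltrDl.
Qed.

(** A tent in the sup norm, equal to 1 for |x| <= L and to 0 for |x| >= L + 1: a majorant in [Cc] of
    the indicator of a ball, used to weigh errors. *)
Definition cutoff (L : R) (x : point) : R := Num.max (Num.min (L + 1 - `|x|) 1) 0.

Lemma continuous_maxr (f g : point -> R) : continuous f -> continuous g ->
  continuous (fun x => Num.max (f x) (g x)).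
Proof. by move=> cf cg x; apply: (@continuous_max R _ f g x); [exact: cf|exact: cg]. Qed.

Lemma continuous_minr (f g : point -> R) : continuous f -> continuous g ->
  continuous (fun x => Num.min (f x) (g x)).
Proof. by move=> cf cg x; apply: (@continuous_min R _ f g x); [exact: cf|exact: cg]. Qed.

Lemma cutoff_Cc L : Cc (cutoff L).
Proof.
apply: (@Cc_of_bounded_supp _ (L + 1)).
  apply: continuous_maxr; last exact: cst_continuous.
  apply: continuous_minr; last exact: cst_continuous.
  have cL : continuous (fun _ : point => L + 1) by exact: cst_continuous.
  exact: (fun x => cvgB (cL x) (@norm_continuous _ _ x)).
by move=> x xL; apply: max_r; rewrite ge_min; apply/orP; left; rewrite subr_le0 ltW.
Qed.

Lemma cutoff_ge0 L x : 0 <= cutoff L x.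
Proof. by rewrite /cutoff le_max lexx orbT. Qed.

Lemma cutoff1 L x : `|x| <= L -> cutoff L x = 1.
Proof.
move=> xL; rewrite /cutoff min_r; first by rewrite max_l.
by rewrite addrAC lerDr subr_ge0.
Qed.

Lemma rV_measurable_open (U : set point) : open U -> measurable (U : set (borelRV R n)).
Proof. by move=> oU; exact: sub_sigma_algebra. Qed.

Lemma continuous_measurable_rV f : continuous f ->
  measurable_fun setT (f : borelRV R n -> measurableTypeR R).
Proof.
move=> cf; apply: (@measurability _ _ (borelRV R n) (measurableTypeR R) setT
  (f : borelRV R n -> _) (@RGenOpens.G R)).
  exact: RGenOpens.measurableE.
move=> _ [_ [a [b ->]] <-].
rewrite setTI; apply: sub_sigma_algebra; apply: open_comp.
  by move=> x _; exact: cf.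
exact: interval_open.
Qed.

Section radon.
Variable mu : {measure set (borelRV R n) -> \bar R}.
Hypothesis rmu : radon mu.

Lemma Cc_integrable f : Cc f -> mu.-integrable setT (EFin \o f).
Proof.
move=> Cf; have [L L0 f0] := Cc_bounded_supp Cf.
have [M M0 fM] := Cc_bounded Cf.
pose K := [set x : point | `|x| <= L].
have mK : measurable (K : set (borelRV R n)).
  rewrite -(setCK K); apply: measurableC; apply: rV_measurable_open.
  apply: closed_openC; apply: compact_closed; first exact: norm_hausdorff.
  exact: closed_ball0_compact.
have -> : EFin \o f = (EFin \o f) \_ K.
  apply/funext => x; rewrite patchE; case: ifPn => //.
  by rewrite notin_setE => /negP; rewrite -ltNge /= => /f0 ->.
apply/(integrable_mkcond _ mK); apply: measurable_bounded_integrable => //.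
- exact/rmu/closed_ball0_compact.
- by apply: measurable_funTS; apply: continuous_measurable_rV; exact: Cf.1.
- exists M; split; first exact: num_real.
  by move=> N MN x _; exact: le_trans (fM x) (ltW MN).
Qed.

Lemma Rintegral_EFin f : Cc f ->
  (\int[mu]_x (f x)%:E = (\int[mu]_x f x)%:E)%E.
Proof.
move=> Cf; rewrite /Rintegral fineK//; apply: integrable_fin_num => //.
exact: Cc_integrable.
Qed.

End radon.

(** The laws are only required on [Cc], where integrals against Radon measures and limits of such
    integrals obey them; elsewhere the value is arbitrary. *)
Record poslin (L : (point -> R) -> R) : Prop := Poslin {
  poslinD : forall f g, Cc f -> Cc g -> L (fun x => f x + g x) = L f + L g;
  poslinZ : forall a f, Cc f -> L (fun x => a * f x) = a * L f;
  poslin_ge0 : forall f, Cc f -> (forall x, 0 <= f x) -> 0 <= L f }.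

Lemma poslin_Rintegral (mu : {measure set (borelRV R n) -> \bar R}) :
  radon mu -> poslin (fun f => \int[mu]_x f x).
Proof.
move=> rmu; split => [f g Cf Cg|a f Cf|f Cf f0].
- by rewrite RintegralD//; exact: Cc_integrable.
- by rewrite RintegralZl//; exact: Cc_integrable.
- by apply: Rintegral_ge0 => x _; exact: f0.
Qed.

Section poslin.
Variable L : (point -> R) -> R.
Hypothesis pL : poslin L.

Lemma poslinN f : Cc f -> L (fun x => - f x) = - L f.
Proof.
move=> Cf; rewrite -mulN1r -(poslinZ pL)//.
by congr L; apply/funext => x; rewrite mulN1r.
Qed.

Lemma poslinB f g : Cc f -> Cc g -> L (fun x => f x - g x) = L f - L g.
Proof.
by move=> Cf Cg; rewrite (poslinD pL)// ?poslinN//; exact: CcN.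
Qed.

Lemma poslin0 : L (fun=> 0) = 0.
Proof.
rewrite -[RHS](subrr (L (fun=> 0))) -poslinB; [|exact: Cc0|exact: Cc0].
by congr L; apply/funext => x; rewrite subr0.
Qed.

Lemma poslin_le f g : Cc f -> Cc g -> (forall x, f x <= g x) -> L f <= L g.
Proof.
move=> Cf Cg fg; rewrite -subr_ge0 -poslinB//; apply: (poslin_ge0 pL).
  exact: CcB.
by move=> x; rewrite subr_ge0.
Qed.

Lemma poslin_sum (I : Type) (r : seq I) (F : I -> point -> R) :
  (forall i, Cc (F i)) ->
  L (fun x => \sum_(i <- r) F i x) = \sum_(i <- r) L (F i).
Proof.
move=> CF; elim: r => [|i r IH].
  by under eq_fun do rewrite big_nil; rewrite big_nil poslin0.
under eq_fun do rewrite big_cons.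
by rewrite big_cons (poslinD pL)// ?IH//; exact: Cc_sum.
Qed.

(** A positive functional on [Cc] need not be bounded for the sup norm, so the distance of f and g
    is weighed by a function h of [Cc]. *)
Lemma poslin_dist f g h e : Cc f -> Cc g -> Cc h ->
  (forall x, `|f x - g x| <= e * h x) -> `|L f - L g| <= e * L h.
Proof.
move=> Cf Cg Ch fgh; rewrite -poslinB// -(poslinZ pL)//.
have Ceh := CcZ e Ch; have Cfg := CcB Cf Cg.
rewrite ler_norml -poslinN//; apply/andP; split; apply: poslin_le => //.
- exact: CcN.
- by move=> x; have := fgh x; rewrite ler_norml => /andP[].
- by move=> x; have := fgh x; rewrite ler_norml => /andP[].
Qed.

End poslin.

End compactly_supported_functions.

(** An unordered sum over pairs can be reindexed along a bijection of nat with nat * nat, which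
    turns a double sequence of functions into a single cover. *)
Lemma nneseries_esum2 {R : realType} (a : nat * nat -> \bar R) :
  (forall i, 0 <= a i)%E ->
  (\sum_(k <oo) \sum_(m <oo) a (k, m) = \esum_(i in setT) a i)%E.
Proof.
move=> a0; rewrite nneseries_esumT; last by move=> k; exact: nneseries_ge0.
under eq_esum do rewrite nneseries_esumT//.
rewrite esum_esum//.
by congr (esum _ _); [apply/seteqP; split=> -[]|apply/funext => -[]].
Qed.

(** Induction step for cutting a function into slices: the second term is the part of a between the
    heights b and b + e. *)
Lemma minr_step {R : realType} (a b e : R) : 0 <= e ->
  Num.min a b + Num.min (Num.max (a - b) 0) e = Num.min a (b + e).
Proof.
move=> e0; have [ab|ba] := leP a b.
  by rewrite max_r ?subr_le0// min_l// addr0 min_l// ler_wpDr.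
rewrite max_l ?subr_ge0 ?ltW//.
by rewrite addr_minr addrC subrK.
Qed.

(** * The Riesz representation theorem *)

Section riesz.
Context {R : realType} {n : nat}.
Local Notation point := 'rV[R]_n.
Variable L : (point -> R) -> R.
Hypothesis pL : poslin L.
Implicit Types (f : point -> R) (F : nat -> point -> R).

(** Countable families of functions cover arbitrary sets directly, without a detour through open
    sets; sigma-subadditivity then amounts to merging covers. *)
Definition riesz_cover (A : set point) : set (nat -> point -> R) :=
  [set F | [/\ forall k, Cc (F k), forall k x, 0 <= F k x &
     forall x, A x -> (1 <= \sum_(k <oo) (F k x)%:E)%E]].

Definition riesz_outer (A : set point) : \bar R :=
  ereal_inf [set (\sum_(k <oo) (L (F k))%:E)%E | F in riesz_cover A].

Lemma riesz_cover_ge0 A F k : riesz_cover A F -> 0 <= L (F k).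
Proof. by move=> [CF F0 _]; exact: (poslin_ge0 pL). Qed.

Lemma riesz_outer_ge0 A : (0 <= riesz_outer A)%E.
Proof.
apply/le_ereal_inf_tmp => _ [F cF <-].
by apply: nneseries_ge0 => k _ _; rewrite lee_fin (riesz_cover_ge0 _ cF).
Qed.

Lemma riesz_outer_le_series2 A (F : nat -> nat -> point -> R) :
  (forall k m, Cc (F k m)) -> (forall k m x, 0 <= F k m x) ->
  (forall x, A x -> (1 <= \sum_(k <oo) \sum_(m <oo) (F k m x)%:E)%E) ->
  (riesz_outer A <= \sum_(k <oo) \sum_(m <oo) (L (F k m))%:E)%E.
Proof.
move=> CF F0 FA.
pose a (i : nat * nat) := (L (F i.1 i.2))%:E.
have a0 i : (0 <= a i)%E by rewrite lee_fin; exact: (poslin_ge0 pL).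
have /card_esym/card_set_bijP[f fbij] := card_nat2.
rewrite (nneseries_esum2 a0) (reindex_esum setT setT f)//.
rewrite -nneseries_esumT; last by move=> i; exact: a0.
apply: ereal_inf_lbound => /=; exists (fun i => F (f i).1 (f i).2) => //.
split => // x Ax.
pose b (i : nat * nat) := (F i.1 i.2 x)%:E.
have b0 i : (0 <= b i)%E by rewrite lee_fin.
rewrite (le_trans (FA _ Ax))//.
rewrite (nneseries_esum2 b0) (reindex_esum setT setT f)//.
by rewrite -nneseries_esumT// => i; exact: b0.
Qed.

Lemma riesz_outer_le f A : Cc f -> (forall x, 0 <= f x) ->
  (forall x, A x -> 1 <= f x) -> (riesz_outer A <= (L f)%:E)%E.
Proof.
move=> Cf f0 fA.
have eq1 (u : nat -> \bar R) : (forall k, u k.+1 = 0) -> (0 <= u 0%N)%E ->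
    (\sum_(k <oo) u k = u 0%N)%E.
  move=> uS u0; rewrite nneseries_recl => [|[|k]|]; rewrite ?uS//.
  by rewrite eseries_cond/= eseries0 ?adde0// => -[|k]//.
apply: ereal_inf_lbound; exists (fun (k : nat) (x : point) => if k is 0%N then f x else 0).
  split => [[|k]//|[|k]//|x Ax]; first exact: Cc0.
  by rewrite eq1 ?lee_fin// fA.
by rewrite eq1//= ?lee_fin ?(poslin_ge0 pL)// => k; rewrite poslin0.
Qed.

(** Dini's argument: on a ball carrying f some partial sum of a cover exceeds f - dl everywhere, and
    positivity of [L] compares f with that finite sum. *)
Lemma riesz_outer_ge f A : Cc f -> (forall x, f x <= 1) ->
  (forall x, ~ A x -> f x <= 0) -> ((L f)%:E <= riesz_outer A)%E.
Proof.
move=> Cf f1 fA; apply/le_ereal_inf_tmp => _ [F [CF F0 FA] <-].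
apply/lee_addgt0Pr => e e0.
have [r r0 fr] := Cc_bounded_supp Cf.
have Cr : Cc (cutoff r : point -> R) by exact: cutoff_Cc.
have Lr : 0 <= L (cutoff r).
  by apply: (poslin_ge0 pL) => // x; exact: cutoff_ge0.
(* Makes dl L(cutoff r) at most e; the + 1 keeps the denominator positive. *)
pose dl := e / (L (cutoff r) + 1).
have L1 : 0 < L (cutoff r) + 1 by rewrite ltr_wpDl.
have dl0 : 0 < dl by rewrite divr_gt0.
pose S N x := \sum_(k < N) F k x.
have CS N : Cc (S N) by apply: Cc_sum.
have Sle N M x : (N <= M)%N -> S N x <= S M x.
  move=> NM; rewrite /S -!(big_mkord predT (fun k => F k x)).
  by rewrite [leRHS](@big_cat_nat _ _ _ N)//= lerDl sumr_ge0.
have : \forall N \near \oo, [set x : point | `|x| <= r] `<=` (fun x => f x - S N x < dl).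
  have := @closed_ball0_compact R n r.
  move=> /compact_near_coveringP; apply => x _.
  have [N fN] : exists N, f x - S N x < dl.
    have [Ax|nAx] := pselect (A x); last first.
      exists 0%N; rewrite /S big_ord0 subr0.
      by rewrite (le_lt_trans (fA _ nAx)).
    have := FA _ Ax; rewrite nneseries_esumT => [H|]; last by move=> k; rewrite lee_fin.
    apply: contrapT => /forallNP H1.
    suff : (\sum_(k <oo) (F k x)%:E <= (1 - dl)%:E)%E.
      rewrite nneseries_esumT; last by move=> k; rewrite lee_fin.
      by move=> /(le_trans H); rewrite lee_fin; lra.
    apply: lime_le.
      by apply: is_cvg_nneseries => k _ _; rewrite lee_fin.
    apply: nearW => N; rewrite sumEFin lee_fin big_mkord.
    have /negP := H1 N; rewrite -leNgt -/(S N x).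
    by move: (f1 x) => /=; lra.
  have cfS : {for x, continuous (fun y => f y - S N y)}.
    exact: (cvgB (proj1 Cf x) (proj1 (CS N) x)).
  have nx : \forall x' \near x, f x' - S N x' < dl.
    exact: (cvgr_lt _ cfS).
  near=> x' M; rewrite /= (le_lt_trans _ (_ : f x' - S N x' < dl))//.
    by rewrite lerB//; apply: Sle; near: M; exact: nbhs_infty_ge.
  by near: x'.
move=> [N _ /(_ N (leqnn N)) KN].
have fS x : f x <= S N x + dl * cutoff r x.
  have [xr|xr] := leP `|x| r; last first.
    rewrite fr// addr_ge0//; first by rewrite /S sumr_ge0.
    by rewrite mulr_ge0 ?cutoff_ge0// ltW.
  by rewrite cutoff1// mulr1; have := KN x xr; rewrite ltrBlDr addrC => /ltW.
apply: (@le_trans _ _ (L (S N) + dl * L (cutoff r))%:E).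
  rewrite lee_fin -(poslinZ pL)// -(poslinD pL)//; last exact: CcZ.
  by apply: poslin_le => //; apply: CcD => //; exact: CcZ.
rewrite EFinD leeD//.
  rewrite /S poslin_sum// -sumEFin -(big_mkord predT (fun k => (L (F k))%:E)).
  by apply: nneseries_lim_ge => k _ _; rewrite lee_fin; exact: (poslin_ge0 pL).
rewrite lee_fin /dl mulrAC ler_pdivrMr// ler_pM2l// lerDl; exact: ler01.
Unshelve. all: by end_near. Qed.

Lemma riesz_outer0 : riesz_outer set0 = 0%E.
Proof.
apply/eqP; rewrite eq_le riesz_outer_ge0 andbT.
have : (riesz_outer set0 <= (L (fun=> 0))%:E)%E by apply: riesz_outer_le => //; exact: Cc0.
by rewrite poslin0.
Qed.

Lemma le_riesz_outer : {homo riesz_outer : A B / A `<=` B >-> (A <= B)%E}.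
Proof.
move=> A B AB; apply: ereal_inf_le_tmp => _ [F [CF F0 FB] <-]; exists F => //.
by split => // x /AB/FB.
Qed.

Lemma riesz_outer_adherent A (e : R) : 0 < e -> (riesz_outer A < +oo)%E ->
  exists2 F, riesz_cover A F &
    (\sum_(k <oo) (L (F k))%:E <= riesz_outer A + e%:E)%E.
Proof.
move=> e0 Aoo; have fA : riesz_outer A \is a fin_num.
  by rewrite ge0_fin_numE// riesz_outer_ge0.
have [_ [F cF <-] /ltW FA] := lb_ereal_inf_adherent e0 fA.
by exists F.
Qed.

Lemma riesz_outer_sigma_subadditive : sigma_subadditive riesz_outer.
Proof.
move=> A; have [[i ioo]|] := pselect (exists i, riesz_outer (A i) = +oo%E).
  rewrite (eseries_pinfty _ _ ioo) ?leey// => k _.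
  by rewrite -ltNye (lt_le_trans _ (riesz_outer_ge0 _)).
rewrite -forallNE => Aoo.
apply/lee_addgt0Pr => e e0.
rewrite (le_trans _ (epsilon_trick _ _ (ltW e0)))//; last first.
  by move=> k; exact: riesz_outer_ge0.
have /choice[G GP] : forall k, exists F, riesz_cover (A k) F /\
    (\sum_(i <oo) (L (F i))%:E <= riesz_outer (A k) + (e / (2 ^ k.+1)%:R)%:E)%E.
  move=> k; have [||F ? ?] := @riesz_outer_adherent (A k) (e / (2 ^ k.+1)%:R).
  - by rewrite divr_gt0// ltr0n expn_gt0.
  - by rewrite ltey; apply/eqP.
  - by exists F.
apply: (@le_trans _ _ (\sum_(k <oo) \sum_(m <oo) (L (G k m))%:E)%E); last first.
  apply: lee_nneseries => [k _ _|k _]; last exact: (GP k).2.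
  by apply: nneseries_ge0 => m _ _; rewrite lee_fin (riesz_cover_ge0 _ (GP k).1).
apply: riesz_outer_le_series2.
- by move=> k m; have [[]] := GP k.
- by move=> k m; have [[]] := GP k.
- move=> x [k _ Akx]; have [[CF F0 FA] _] := GP k.
  rewrite (le_trans (FA _ Akx))//.
  pose s i := (\sum_(m <oo) (G i m x)%:E)%E.
  have s0 i : (0 <= s i)%E.
    by apply: nneseries_ge0 => m _ _; rewrite lee_fin; have [[]] := GP i.
  rewrite [leRHS](nneseriesD1 (n := k))//; last by move=> i _; exact: s0.
  by apply: leeDl; apply: nneseries_ge0 => i _ _; exact: s0.
Qed.

HB.instance Definition _ := isOuterMeasure.Build R point riesz_outer
  riesz_outer0 riesz_outer_ge0 le_riesz_outer riesz_outer_sigma_subadditive.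

(* A cover F of X nearly optimal for the outer measure is split as
   F_k = F_k u_m + F_k (1 - u_m), where u_m = min(1, m d) increases to the
   indicator function of {d > 0}. *)
Lemma riesz_caratheodory (d : point -> R) : continuous d ->
  (forall x, 0 <= d x) -> riesz_outer.-caratheodory [set x | 0 < d x].
Proof.
move=> cd d0; set U := [set x | 0 < d x].
apply: le_caratheodory_measurable => X.
have [Xoo|] := boolP (riesz_outer X < +oo)%E; last first.
  by rewrite -leNgt leye_eq => /eqP XE; rewrite [leRHS]XE leey.
apply/lee_addgt0Pr => e e0.
have e20 : 0 < e / 2 by rewrite divr_gt0.
have [F [CF F0 FX] FLe] := riesz_outer_adherent e20 Xoo.
pose u (m : nat) x := Num.min 1 (m%:R * d x).
have u0 m x : 0 <= u m x by rewrite /u le_min ler01 mulr_ge0.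
have u1 m x : u m x <= 1 by rewrite /u ge_min lexx.
have uS m x : u m x <= u m.+1 x.
  rewrite /u le_min ge_min lexx /= ge_min; apply/orP; right.
  by rewrite ler_wpM2r// ler_nat.
have u00 x : u 0%N x = 0 by rewrite /u mul0r min_r.
have uU0 x m : ~ U x -> u m x = 0.
  move=> /negP; rewrite -leNgt => dx0.
  by rewrite /u (_ : d x = 0) ?mulr0 ?min_r//; apply/le_anti; rewrite dx0 d0.
have uU1 x : U x -> exists m, u m x = 1.
  move=> dx; have [m mx] : exists m : nat, (d x)^-1 < m%:R.
    by exists (Num.Def.archi_bound (d x)^-1); rewrite archi_boundP// invr_ge0.
  exists m; rewrite /u min_l// -ler_pdivrMr// mul1r; exact: ltW.
have cu m : continuous (u m).
  apply: continuous_minr; first exact: cst_continuous.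
  by move=> x; exact: (cvgM (cvg_cst _) (cd x)).
have CFu k m : Cc (fun x => F k x * u m x) by apply: CcM.
have Lu k m : L (fun x => F k x * u m x) <= L (F k).
  by apply: poslin_le => // x; rewrite ler_piMr.
pose a k := sup (range (fun m => L (fun x => F k x * u m x))).
have hs k : has_sup (range (fun m => L (fun x => F k x * u m x))).
  split; first by exists (L (fun x => F k x * u 0%N x)); exists 0%N.
  by exists (L (F k)) => _ [m _ <-].
have a_ge0 k : 0 <= a k.
  apply: (@le_trans _ _ (L (fun x => F k x * u 0%N x))).
    by apply: (poslin_ge0 pL) => // x; exact: mulr_ge0.
  by apply: sup_upper_bound => //; exists 0%N.
have a_le k : a k <= L (F k) by apply: ge_sup; [exact: (hs k).1|move=> _ [m _ <-]].
have /choice[mk mkP] : forall k, exists m,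
    a k - e / 2 / (2 ^ k.+1)%:R < L (fun x => F k x * u m x).
  move=> k; have ek : 0 < e / 2 / (2 ^ k.+1)%:R by rewrite divr_gt0// ltr0n expn_gt0.
  by have [_ [m _ <-] mP] := sup_adherent ek (hs k); exists m.
(* On U the increments F_k (u_(m+1) - u_m) sum to F_k, and their values under [L] telescope to at
   most a_k. *)
have h1 : (riesz_outer (X `&` U) <= \sum_(k <oo) (a k)%:E)%E.
  apply: (@le_trans _ _ (\sum_(k <oo) \sum_(m <oo)
      (L (fun x => (F k x * (u m.+1 x - u m x))%R))%:E)%E).
    apply: riesz_outer_le_series2.
    - by move=> k m; apply: CcM => // x; exact: (cvgB (cu _ x) (cu _ x)).
    - by move=> k m x; rewrite mulr_ge0// subr_ge0.
    - move=> x [Xx Ux]; rewrite (le_trans (FX _ Xx))//.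
      apply: lee_nneseries => [k _ _|k _]; first by rewrite lee_fin.
      have [m um] := uU1 _ Ux.
      rewrite (le_trans _ (nneseries_lim_ge m _))//; last first.
        by move=> i _ _; rewrite lee_fin mulr_ge0// subr_ge0.
      rewrite sumEFin lee_fin -mulr_sumr telescope_sumr// um u00 subr0 mulr1//.
  apply: lee_nneseries => [k _ _|k _].
    apply: nneseries_ge0 => m _ _; rewrite lee_fin; apply: (poslin_ge0 pL).
      by apply: CcM => // x; exact: (cvgB (cu _ x) (cu _ x)).
    by move=> x; rewrite mulr_ge0// subr_ge0.
  apply: lime_le.
    apply: is_cvg_nneseries => m _ _; rewrite lee_fin; apply: (poslin_ge0 pL).
      by apply: CcM => // x; exact: (cvgB (cu _ x) (cu _ x)).
    by move=> x; rewrite mulr_ge0// subr_ge0.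
  apply: nearW => N; rewrite sumEFin lee_fin.
  rewrite (eq_bigr (fun m => L (fun x => F k x * u m.+1 x) - L (fun x => F k x * u m x))); last first.
    move=> m _; rewrite -poslinB//; congr L; apply/funext => x; exact: mulrBr.
  rewrite telescope_sumr// (_ : L (fun x => F k x * u 0%N x) = 0) ?subr0; last first.
    by rewrite -[RHS](poslin0 pL); congr L; apply/funext => x; rewrite u00 mulr0.
  by apply: sup_upper_bound => //; exists N.
(* Off U every u_m vanishes, so the functions F_k (1 - u_(m_k)) still cover; m_k is taken so late
   that hardly more than L(F_k) - a_k is left. *)
have h2 : (riesz_outer (X `&` ~` U) <=
    \sum_(k <oo) ((L (F k) - a k)%:E + (e / 2 / (2 ^ k.+1)%:R)%:E))%E.
  apply: (@le_trans _ _ (\sum_(k <oo) (L (fun x => (F k x - F k x * u (mk k) x)%R))%:E)%E).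
    apply: ereal_inf_lbound; exists (fun k x => F k x - F k x * u (mk k) x) => //.
    split.
    - by move=> k; apply: CcB.
    - by move=> k x; rewrite subr_ge0 ler_piMr.
    - move=> x [Xx nUx]; rewrite (le_trans (FX _ Xx))//.
      under [leRHS]eq_eseriesr do rewrite uU0// mulr0 subr0.
      exact: lexx.
  apply: lee_nneseries => [k _ _|k _].
    rewrite lee_fin; apply: (poslin_ge0 pL); first exact: CcB.
    by move=> x; rewrite subr_ge0 ler_piMr.
  rewrite poslinB// -EFinD lee_fin.
  by have := mkP k; lra.
apply: (le_trans (leeD h1 h2)).
rewrite -nneseriesD; last 2 first.
- by move=> k _ _; rewrite lee_fin.
- by move=> k _ _; rewrite -EFinD lee_fin addr_ge0// ?subr_ge0// divr_ge0// ltW.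
have -> : (\sum_(k <oo) ((a k)%:E + ((L (F k) - a k)%:E + (e / 2 / (2 ^ k.+1)%:R)%:E))
   = \sum_(k <oo) ((L (F k))%:E + (e / 2 / (2 ^ k.+1)%:R)%:E))%E.
  by apply: eq_eseriesr => k _; rewrite addeA -EFinD addrC subrK.
apply: (le_trans (epsilon_trick _ _ (ltW e20))).
  by move=> k; rewrite lee_fin; exact: (poslin_ge0 pL).
rewrite [in leRHS](splitr e) EFinD addeA leeD2r//.
Qed.

Lemma riesz_caratheodory_ball (x : point) (r : R) :
  riesz_outer.-caratheodory (ball x r).
Proof.
have -> : ball x r = [set y | 0 < Num.max (r - `|x - y|) 0].
  rewrite -ball_normE; apply/seteqP; split => y /=.
    by rewrite lt_max subr_gt0 => ->.
  by rewrite lt_max ltxx orbF subr_gt0.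
apply: riesz_caratheodory; last by move=> y; rewrite le_max lexx orbT.
apply: continuous_maxr; last exact: cst_continuous.
have cr : continuous (fun _ : point => r) by exact: cst_continuous.
have cx : continuous (fun y : point => x - y).
  have cx : continuous (fun _ : point => x) by exact: cst_continuous.
  by move=> y; exact: (cvgB (cx y) cvg_id).
move=> y; apply: (cvgB (cr y)).
exact: (continuous_comp (cx y) (@norm_continuous _ _ _)).
Qed.

(** An open set is a countable union of balls with rational centers and radii 1/(k+1), so it is
    enough to treat balls. *)
Lemma riesz_caratheodory_measurable (A : set (borelRV R n)) :
  measurable A -> riesz_outer.-caratheodory A.
Proof.
move=> mA; suff : <<s @open point >> `<=` riesz_outer.-cara.-measurable by apply.
apply: smallest_sub; first exact: sigma_algebra_measurable.
move=> U oU.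
pose D := [set qk : 'rV[rat]_n * nat |
  ball (map_mx ratr qk.1 : point) qk.2.+1%:R^-1 `<=` U].
pose B (qk : 'rV[rat]_n * nat) : set point := ball (map_mx ratr qk.1 : point) qk.2.+1%:R^-1.
suff -> : U = \bigcup_(qk in D) B qk.
  rewrite bigcup_mkcond; apply: countable_bigcupT_measurable; first exact: countableP.
  move=> qk; case: ifP => // _; exact: riesz_caratheodory_ball.
apply/seteqP; split => [p Up|p [qk Dqk]]; last exact: Dqk.
have /nbhs_ballP[e /= e0 He] : nbhs p U by exact: open_nbhs_nbhs.
have [k ke] : exists k : nat, k.+1%:R^-1 < e / 2.
  have e20 : 0 < e / 2 by rewrite divr_gt0.
  have [k _ /(_ k (leqnn k)) /= ke] := near_infty_natSinv_lt (PosNum e20).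
  by exists k.
have [q qk] := rat_rV_ball p (@invk_gt0 R k).
exists (q, k); last exact: ball_sym.
move=> y /= qy; apply: He.
by apply: (@ball_split R point (map_mx ratr q)); exact: le_ball (ltW ke) _ _.
Qed.

Definition riesz_measure (A : set (borelRV R n)) : \bar R := riesz_outer A.

Let riesz_measure_semi_sigma_additive : semi_sigma_additive riesz_measure.
Proof.
move=> A mA tA mUA; apply: caratheodory_measure_sigma_additive => //.
- by move=> i; exact: riesz_caratheodory_measurable.
- exact: riesz_caratheodory_measurable.
Qed.

HB.instance Definition _ := isMeasure.Build _ _ _ riesz_measure
  riesz_outer0 riesz_outer_ge0 riesz_measure_semi_sigma_additive.

Lemma radon_riesz_measure : radon riesz_measure.
Proof.
move=> K /compact_bounded[M [_ MK]].
pose N := `|M| + 1.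
have KN x : K x -> `|x| <= N.
  by apply: MK; rewrite (le_lt_trans (ler_norm _))// ltrDl.
apply: (@le_lt_trans _ _ (L (cutoff N))%:E); last exact: ltry.
apply: riesz_outer_le; [exact: cutoff_Cc|exact: cutoff_ge0|].
by move=> x /KN xN; rewrite cutoff1.
Qed.

(** Together with the reverse bound that follows, this mirrors [riesz_outer_le] and
    [riesz_outer_ge]: the integral and [L] are squeezed between the same measures of level sets. *)
Lemma measure_le_Rintegral (mu : {measure set (borelRV R n) -> \bar R}) f (A : set point) :
  radon mu -> measurable (A : set (borelRV R n)) -> Cc f -> (forall x, 0 <= f x) ->
  (forall x, A x -> 1 <= f x) -> (mu A <= (\int[mu]_x f x)%:E)%E.
Proof.
move=> rmu mA Cf f0 fA; rewrite -Rintegral_EFin// -[mu A]mul1e -integral_cst//.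
rewrite integral_mkcond; apply: ge0_le_integral => //.
- by move=> x _; rewrite patchE; case: ifP.
- apply/(measurable_restrictT _ _).1 => //; exact: measurable_cst.
- by apply/measurable_EFinP; apply: continuous_measurable_rV; exact: Cf.1.
- move=> x _; rewrite patchE; case: ifPn => [/set_mem/fA|_]; first by rewrite lee_fin.
  by rewrite lee_fin.
Qed.

Lemma Rintegral_le_measure (mu : {measure set (borelRV R n) -> \bar R}) f (A : set point) :
  radon mu -> measurable (A : set (borelRV R n)) -> Cc f ->
  (forall x, 0 <= f x) -> (forall x, f x <= 1) ->
  (forall x, ~ A x -> f x <= 0) -> ((\int[mu]_x f x)%:E <= mu A)%E.
Proof.
move=> rmu mA Cf f0 f1 fA; rewrite -Rintegral_EFin// -[mu A]mul1e -integral_cst//.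
rewrite [leRHS]integral_mkcond; apply: ge0_le_integral => //.
- by move=> x _; rewrite lee_fin.
- by apply/measurable_EFinP; apply: continuous_measurable_rV; exact: Cf.1.
- apply/(measurable_restrictT _ _).1 => //; exact: measurable_cst.
- move=> x _; rewrite patchE; case: ifPn => [_|]; first by rewrite lee_fin.
  by move/negP => nA; rewrite lee_fin; apply: fA => Ax; apply: nA; exact: mem_set.
Qed.

(* f is cut into horizontal slices of height e = M/(N+1); both L and the integral
   of the k-th slice lie between e mu{f > (k+1)e} and e mu{f > ke}. *)
Let riesz_integral_ge0 f : Cc f -> (forall x, 0 <= f x) ->
  \int[riesz_measure]_x f x = L f.
Proof.
move=> Cf f0; have [M M0 fM] := Cc_bounded Cf.
have rr := radon_riesz_measure.
set mu : {measure set (borelRV R n) -> \bar R} := riesz_measure.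
pose I (h : point -> R) := \int[mu]_x h x.
have pI : poslin I by exact: poslin_Rintegral.
pose B (t : R) : set point := [set x | t < f x].
have mB t : measurable (B t : set (borelRV R n)).
  apply: rV_measurable_open; apply: (@open_comp _ _ f [set y | t < y]).
    by move=> x _; exact: Cf.1.
  exact: open_gt.
have B0 : (mu (B 0%R) < +oo)%E.
  have [r r0 fr] := Cc_bounded_supp Cf.
  apply: (@le_lt_trans _ _ (L (cutoff r))%:E); last exact: ltry.
  apply: riesz_outer_le; [exact: cutoff_Cc|exact: cutoff_ge0|].
  move=> x Bx; rewrite cutoff1// leNgt; apply/negP => /fr fx0.
  by rewrite /B /= fx0 ltxx in Bx.
have Bfin t : 0 <= t -> mu (B t) \is a fin_num.
  move=> t0; rewrite ge0_fin_numE//; apply: le_lt_trans B0.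
  apply: le_measure; rewrite ?inE//.
  by move=> x; exact: le_lt_trans.
have key N : `|I f - L f| <= M / N.+1%:R * fine (mu (B 0)).
  pose e := M / N.+1%:R.
  have e0 : 0 < e by rewrite divr_gt0.
  pose g (k : nat) x := Num.min (Num.max (f x - k%:R * e) 0) e.
  have Cg k : Cc (g k).
    apply: (Cc_dom Cf).
      apply: continuous_minr; last exact: cst_continuous.
      apply: continuous_maxr; last exact: cst_continuous.
      have ck : continuous (fun _ : point => k%:R * e) by exact: cst_continuous.
      by move=> x; exact: (cvgB (proj1 Cf x) (ck x)).
    move=> x fx0; rewrite /g fx0 sub0r max_r; first by rewrite min_l// ltW.
    by rewrite oppr_le0 mulr_ge0// ltW.
  have g0 k x : 0 <= g k x by rewrite /g le_min le_max lexx orbT /= ltW.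
  have ge k x : g k x <= e by rewrite /g ge_min lexx orbT.
  have gsum m x : \sum_(k < m) g k x = Num.min (f x) (m%:R * e).
    elim: m => [|m IH]; first by rewrite big_ord0 mul0r min_r.
    rewrite big_ord_recr /= IH /g -natr1 mulrDl mul1r.
    by rewrite minr_step// ltW.
  have fE : f = fun x => \sum_(k < N.+1) g k x.
    apply/funext => x; rewrite gsum min_l// /e mulrCA divff ?mulr1//.
    by have := fM x; rewrite ger0_norm.
  pose Bk (k : nat) := B (k%:R * e).
  pose b (k : nat) := fine (mu (Bk k)).
  have bE k : ((b k)%:E = mu (Bk k))%E.
    by rewrite /b fineK// Bfin// mulr_ge0// ltW.
  have gB k x : Bk k.+1 x -> 1 <= e^-1 * g k x.
    rewrite /Bk /B /= -natr1 mulrDl mul1r => fx; rewrite mulrC ler_pdivlMr// mul1r.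
    by rewrite /g le_min lexx andbT le_max; apply/orP; left; rewrite lerBrDl ltW.
  have gnB k x : ~ Bk k x -> e^-1 * g k x <= 0.
    move=> /negP; rewrite -leNgt => fx.
    by rewrite /g max_r ?subr_le0// min_l ?mulr0// ltW.
  have g1 k x : e^-1 * g k x <= 1 by rewrite mulrC ler_pdivrMr// mul1r.
  have g00 k x : 0 <= e^-1 * g k x by rewrite mulr_ge0// invr_ge0 ltW.
  have bnd (Lam : (point -> R) -> R) k : poslin Lam ->
     (mu (Bk k.+1) <= (Lam (fun x => e^-1 * g k x)%R)%:E)%E ->
     ((Lam (fun x => e^-1 * g k x)%R)%:E <= mu (Bk k))%E ->
     e * b k.+1 <= Lam (g k) <= e * b k.
    move=> pLam; rewrite -!bE !lee_fin (poslinZ pLam)// mulrC ler_pdivlMr// ler_pdivrMr//.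
    by rewrite ![e * _]mulrC => -> ->.
  have IB k : e * b k.+1 <= I (g k) <= e * b k.
    apply: bnd => //.
      by apply: measure_le_Rintegral => //; [exact: mB|exact: CcZ|exact: gB].
    by apply: Rintegral_le_measure => //; [exact: mB|exact: CcZ|exact: gnB].
  have LB k : e * b k.+1 <= L (g k) <= e * b k.
    apply: bnd => //.
      by apply: riesz_outer_le => //; [exact: CcZ|exact: gB].
    by apply: riesz_outer_ge => //; [exact: CcZ|exact: gnB].
  rewrite {1 2}fE !poslin_sum// -sumrB.
  apply: (le_trans (ler_norm_sum _ _ _)).
  (* For slice k both values lie in an interval of length e (b_k - b_(k+1)); these lengths telescope
     to at most e b_0, that is M/(N+1) times mu{f > 0}. *)
  apply: (@le_trans _ _ (\sum_(k < N.+1) (e * b k - e * b k.+1))).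
    apply: ler_sum => k _; rewrite ler_norml.
    by have /andP[? ?] := IB k; have /andP[? ?] := LB k; apply/andP; split; lra.
  rewrite -(big_mkord predT (fun k => e * b k - e * b k.+1)).
  under eq_bigr do rewrite -opprB.
  rewrite sumrN telescope_sumr// opprB /b /Bk mul0r lerBlDr lerDl.
  by rewrite mulr_ge0 ?fine_ge0// ltW.
apply/eqP; rewrite -subr_eq0 -normr_le0; apply/ler_addgt0Pr => e e0; rewrite add0r.
pose c := M * fine (mu (B 0)).
have c0 : 0 <= c by rewrite mulr_ge0 ?fine_ge0// ltW.
have [N cN] : exists N : nat, c / e < N%:R.
  by exists (Num.Def.archi_bound (c / e)); rewrite archi_boundP// divr_ge0// ltW.
apply: (le_trans (key N)); rewrite mulrAC ler_pdivrMr// -/c.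
move: cN; rewrite ltr_pdivrMr// mulrC => /ltW/le_trans; apply.
by rewrite ler_pM2l// ler_nat.
Qed.

Lemma riesz_integral f : Cc f -> \int[riesz_measure]_x f x = L f.
Proof.
move=> Cf.
have Cp : Cc (fun x => Num.max (f x) 0).
  apply: (Cc_dom Cf) => [|x ->]; last by rewrite maxxx.
  by apply: continuous_maxr; [exact: Cf.1|exact: cst_continuous].
have Cm : Cc (fun x => Num.max (- f x) 0).
  have Cn := CcN Cf; apply: (Cc_dom Cn) => [|x ->]; last by rewrite maxxx.
  by apply: continuous_maxr; [exact: Cn.1|exact: cst_continuous].
have -> : f = fun x => Num.max (f x) 0 - Num.max (- f x) 0.
  by apply/funext => x; rewrite /Num.max; case: ifPn; case: ifPn; rewrite -?leNgt; lra.
have pI := poslin_Rintegral radon_riesz_measure.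
rewrite (poslinB pI)// (poslinB pL)// !riesz_integral_ge0// => x.
- by rewrite le_max lexx orbT.
- by rewrite le_max lexx orbT.
Qed.

Theorem riesz_representation : exists mu : {measure set (borelRV R n) -> \bar R},
  radon mu /\ forall f, Cc f -> \int[mu]_x f x = L f.
Proof.
by exists riesz_measure; split; [exact: radon_riesz_measure|exact: riesz_integral].
Qed.

End riesz.

(** * Weak compactness *)

Section weak_compactness.
Context {R : realType} {n : nat}.
Local Notation point := 'rV[R]_n.
Implicit Types (f : point -> R).

(** Upper envelope of finitely many cones with rational apexes [q.1], rational heights [q.2] and
    common slope [N.+1], truncated at 0: a countable family. *)
Definition rat_cone (s : seq ('rV[rat]_n * rat)) (N : nat) (x : point) : R :=
  \big[Num.max/0]_(q <- s) (ratr q.2 - N.+1%:R * `|x - map_mx ratr q.1|).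

Lemma rat_cone_Cc s N : Cc (rat_cone s N).
Proof.
rewrite /rat_cone; elim: s => [|q s IH].
  by under eq_fun do rewrite big_nil; exact: Cc0.
under eq_fun do rewrite big_cons.
pose c (x : point) := ratr q.2 - N.+1%:R * `|x - map_mx ratr q.1|.
have cc : continuous c.
  have c1 : continuous (fun _ : point => ratr q.2 : R) by exact: cst_continuous.
  have c2 : continuous (fun x : point => x - map_mx ratr q.1).
    have c3 : continuous (fun _ : point => map_mx ratr q.1 : point) by exact: cst_continuous.
    by move=> x; exact: (cvgB cvg_id (c3 x)).
  have c4 : continuous (fun x : point => `|x - map_mx ratr q.1|).
    by move=> x; exact: (continuous_comp (c2 x) (@norm_continuous _ _ _)).
  by move=> x; exact: (cvgB (c1 x) (cvgM (cvg_cst _) (c4 x))).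
have Ccp : Cc (fun x => Num.max (c x) 0).
  apply: (@Cc_of_bounded_supp _ _ _ (`|ratr q.2| + `|map_mx ratr q.1 : point|)).
    by apply: continuous_maxr => //; exact: cst_continuous.
  move=> x xL; apply: max_r; rewrite /c subr_le0.
  have h1 : `|x| - `|map_mx ratr q.1 : point| <= `|x - map_mx ratr q.1| by exact: lerB_dist.
  have h2 := ler_norm (ratr q.2 : R).
  have h3 : `|x - map_mx ratr q.1| <= N.+1%:R * `|x - map_mx ratr q.1|.
    by rewrite ler_peMl// ler1n.
  lra.
have -> : (fun x : point => Num.max (c x) (\big[Num.max/0]_(j <- s)
     (ratr j.2 - N.+1%:R * `|x - map_mx ratr j.1|))) =
   (fun x => Num.max (Num.max (c x) 0) (rat_cone s N x)).
  by apply/funext => x; rewrite -maxA (max_r (bigmax_ge_id _ _ _ _)).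
apply: (Cc_dom (f := fun x => `|Num.max (c x) 0| + `|rat_cone s N x|)).
- apply: CcD; first by apply: (Cc_comp (k := Num.norm) Ccp); [exact: norm_continuous|exact: normr0].
  by apply: (Cc_comp (k := Num.norm) IH); [exact: norm_continuous|exact: normr0].
- by apply: continuous_maxr; [exact: Ccp.1|exact: IH.1].
- move=> x /eqP; rewrite paddr_eq0// !normr_eq0 => /andP[/eqP -> /eqP ->].
  exact: maxxx.
Qed.

(** Compactness handles |x| <= r + 1; since dl < 1, farther points are only compared with points
    where f vanishes too. *)
Lemma Cc_unif_continuous f e : Cc f -> 0 < e ->
  exists2 dl, 0 < dl < 1 & forall x y, `|x - y| < dl -> `|f x - f y| < e.
Proof.
move=> Cf e0; have [r r0 fr] := Cc_bounded_supp Cf.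
have := @closed_ball0_compact R n (r + 1).
move/compact_near_coveringP => /(_ R ((0 : R)^'+) (fun dl x => forall y, `|x - y| < dl -> `|f x - f y| < e)
  (@filter_filter _ _ (at_right_proper_filter (0 : R)))).
have h x : [set x : point | `|x| <= r + 1] x ->
   \forall x' \near x & dl \near 0^'+, forall y, `|x' - y| < dl -> `|f x' - f y| < e.
  move=> _; have := Cf.1 x; have e20 : 0 < e / 2 by rewrite divr_gt0.
  move/cvgrPdist_lt => /(_ _ e20) /nbhs_ballP[d /= d0 dP].
  have nx : \forall x' \near x, `|x - x'| < d / 2.
    apply/nbhs_ballP; exists (d / 2) => /=; first by rewrite divr_gt0.
    by move=> z; rewrite -ball_normE.
  near=> x' dl => y /= x'y.
  have xx' : `|x - x'| < d / 2.
    by near: x'.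
  have dld : dl <= d / 2 by near: dl; apply: nbhs_right_le; rewrite divr_gt0.
  have h1 : `|f x - f x'| < e / 2.
    by apply: dP; rewrite -ball_normE /=; lra.
  have h2 : `|f x - f y| < e / 2.
    apply: dP; rewrite -ball_normE /=.
    have := ler_distD x' x y; lra.
  have := ler_distD (f x) (f x') (f y); rewrite (distrC (f x') (f x)); lra.
move=> /(_ h) H.
have [dl [dlH dl01]] : exists dl, ([set x : point | `|x| <= r + 1] `<=`
   (fun x => forall y, `|x - y| < dl -> `|f x - f y| < e)) /\ 0 < dl < 1.
  have h0 : \forall dl \near (0 : R)^'+, 0 < dl by exact: nbhs_right_gt.
  have h1 : \forall dl \near (0 : R)^'+, dl < 1 by exact: nbhs_right_lt.
  have [dl [? [? ?]]] := @filter_ex _ _ (at_right_proper_filter (0 : R)) _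
    (filterI H (filterI h0 h1)).
  by exists dl; split => //; apply/andP.
exists dl => // x y xy; have [xr|xr] := leP `|x| (r + 1); first exact: dlH.
have yr : r < `|y|.
  by have := lerB_dist x y; move: dl01 => /andP[? ?]; lra.
by rewrite !fr ?subrr ?normr0//; lra.
Unshelve. all: by end_near. Qed.

(** Put cones slightly below f at the points of a fine rational net. They are so steep that they are
    negative beyond distance dl, and within dl uniform continuity keeps them under f + e/3. The
    radius r is fixed before e, so that all errors are multiples of one function of [Cc]. *)
Lemma rat_cone_approx f : Cc f -> (forall x, 0 <= f x) ->
  exists r : nat, forall e, 0 < e -> exists s N,
    forall x, `|f x - rat_cone s N x| <= e * cutoff r%:R x.
Proof.
move=> Cf f0; have [r0 r00 fr0] := Cc_bounded_supp Cf.
have [M M0 fM] := Cc_bounded Cf.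
have [r rr0] : exists r : nat, r0 + 1 < r%:R.
  by exists (Num.Def.archi_bound (r0 + 1)); rewrite archi_boundP// addr_ge0// ltW.
exists r => e e0.
have e30 : 0 < e / 3 by rewrite divr_gt0.
have [dl /andP[dl0 dl1] fdl] := Cc_unif_continuous Cf e30.
have [N MN] : exists N : nat, M / dl < N%:R.
  by exists (Num.Def.archi_bound (M / dl)); rewrite archi_boundP// divr_ge0// ltW.
have {}MN : M <= N.+1%:R * dl.
  move: MN; rewrite ltr_pdivrMr// => /ltW/le_trans; apply.
  by rewrite ler_pM2r// ler_nat.
pose Q (q : 'rV[rat]_n) : point := map_mx ratr q.
have /choice[a aP] : forall q, exists a : rat, f (Q q) - e / 3 < ratr a < f (Q q).
  move=> q; have : f (Q q) - e / 3 < f (Q q) by lra.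
  by move=> /rat_in_itvoo[a]; rewrite in_itv/=; exists a.
(* A net this fine lets a cone drop by at most e/3 between its apex and the points it has to
   serve. *)
pose eta := Num.min dl (e / 3 / N.+1%:R).
have eta0 : 0 < eta by rewrite lt_min dl0 divr_gt0.
have := @closed_ball0_compact R n r%:R; rewrite compact_cover.
move=> /(_ _ setT (fun q => ball (Q q) eta)) [].
- by move=> q _; exact: ball_open.
- move=> x _; have [q xq] := rat_rV_ball x eta0.
  by exists q => //; exact: ball_sym.
move=> D _ DK; exists [seq (q, a q) | q <- finmap.enum_fset D], N => x.
rewrite /rat_cone big_map /=.
have up : \big[Num.max/0]_(q <- finmap.enum_fset D) (ratr (a q) - N.+1%:R * `|x - Q q|) <= f x + e / 3.
  apply: bigmax_le => [|q _]; first by rewrite addr_ge0// ltW.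
  have /andP[_ aq] := aP q.
  have [xq|xq] := ltP `|x - Q q| dl.
    have := fdl _ _ xq; rewrite ltr_norml => /andP[? _].
    by have : 0 <= N.+1%:R * `|x - Q q|; [rewrite mulr_ge0|lra].
  have : N.+1%:R * dl <= N.+1%:R * `|x - Q q| by rewrite ler_pM2l.
  by have := fM (Q q); rewrite ger0_norm//; have := f0 x; lra.
have ge0 : 0 <= \big[Num.max/0]_(q <- finmap.enum_fset D) (ratr (a q) - N.+1%:R * `|x - Q q|).
  exact: bigmax_ge_id.
have [xr|xr] := leP `|x| r%:R.
  rewrite cutoff1// mulr1 ler_norml.
  have [q /= qD] := DK _ xr; rewrite -ball_normE /= => xq.
  have low : ratr (a q) - N.+1%:R * `|x - Q q| <=
      \big[Num.max/0]_(q <- finmap.enum_fset D) (ratr (a q) - N.+1%:R * `|x - Q q|).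
    exact: (le_bigmax_seq 0 q xpredT).
  have /andP[aq _] := aP q.
  move: xq; rewrite distrC lt_min => /andP[xq1 xq2].
  have h1 : N.+1%:R * `|x - Q q| <= e / 3.
    by rewrite mulrC -ler_pdivlMr// ltW.
  have := fdl _ _ xq1; rewrite ltr_norml => /andP[? ?].
  by apply/andP; split; lra.
rewrite fr0; last by lra.
have -> : \big[Num.max/0]_(q <- finmap.enum_fset D) (ratr (a q) - N.+1%:R * `|x - Q q|) = 0.
  apply/le_anti; rewrite ge0 andbT; apply: bigmax_le => // q _.
  have /andP[_ aq] := aP q.
  have [xq|xq] := ltP `|x - Q q| dl.
    have fq : f (Q q) = 0 by apply: fr0; have := lerB_dist x (Q q); lra.
    by have : 0 <= N.+1%:R * `|x - Q q|; [rewrite mulr_ge0|lra].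
  have : N.+1%:R * dl <= N.+1%:R * `|x - Q q| by rewrite ler_pM2l.
  by have := fM (Q q); rewrite ger0_norm//; lra.
by rewrite subrr normr0 mulr_ge0 ?cutoff_ge0// ltW.
Qed.

(** Cutoffs are listed along with the cones because they weigh the approximation errors, so their
    values under the functionals must converge as well. A number that codes nothing yields 0. *)
Definition test_fun (i : nat) : point -> R :=
  if unpickle i is Some k
  then match k : (seq ('rV[rat]_n * rat) * nat) + nat with
       | inl p => rat_cone p.1 p.2 | inr m => cutoff m%:R end
  else fun=> 0.

Lemma test_fun_Cc i : Cc (test_fun i).
Proof.
rewrite /test_fun; case: unpickle => [[p|m]|]; [exact: rat_cone_Cc|exact: cutoff_Cc|exact: Cc0].
Qed.

Lemma test_fun_cone s N : exists i, test_fun i = rat_cone s N.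
Proof.
exists (pickle (inl (s, N) : (seq ('rV[rat]_n * rat) * nat) + nat)%type).
by rewrite /test_fun pickleK.
Qed.

Lemma test_fun_cutoff m : exists i, test_fun i = cutoff m%:R.
Proof.
exists (pickle (inr m : (seq ('rV[rat]_n * rat) * nat) + nat)%type).
by rewrite /test_fun pickleK.
Qed.

Lemma test_fun_determining (Lam : nat -> (point -> R) -> R) (L : (point -> R) -> R) :
  (forall m, poslin (Lam m)) -> poslin L ->
  (forall i, Lam m (test_fun i) @[m --> \oo] --> L (test_fun i)) ->
  forall f, Cc f -> Lam m f @[m --> \oo] --> L f.
Proof.
move=> pLam pL H.
have pos f : Cc f -> (forall x, 0 <= f x) -> Lam m f @[m --> \oo] --> L f.
  move=> Cf f0; have [r rP] := rat_cone_approx Cf f0.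
  have [ir irE] := test_fun_cutoff r.
  have Lr0 : 0 <= L (cutoff r%:R).
    by apply: (poslin_ge0 pL); [exact: cutoff_Cc|exact: cutoff_ge0].
  have Hr := H ir; rewrite irE in Hr.
  apply/cvgrPdist_le => e e0.
  (* With l = L(cutoff r), the errors are eventually at most e/C times l + 1, l and 1, and C is
     their sum. *)
  pose C := 2 * L (cutoff r%:R) + 2.
  have C0 : 0 < C by rewrite /C; lra.
  have [s [N sN]] := rP (e / C) (divr_gt0 e0 C0).
  have [j jE] := test_fun_cone s N.
  have Hj := H j; rewrite jE in Hj.
  have Cs := rat_cone_Cc s N.
  have Cr : Cc (cutoff r%:R : point -> R) by exact: cutoff_Cc.
  near=> m.
  have h1 : `|Lam m f - Lam m (rat_cone s N)| <= e / C * Lam m (cutoff r%:R).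
    exact: poslin_dist.
  have h2 : `|L f - L (rat_cone s N)| <= e / C * L (cutoff r%:R).
    exact: poslin_dist.
  have h3 : `|L (rat_cone s N) - Lam m (rat_cone s N)| <= e / C.
    by near: m; move/cvgrPdist_le : Hj; apply; rewrite divr_gt0.
  have h4 : `|L (cutoff r%:R) - Lam m (cutoff r%:R)| <= 1.
    by near: m; move/cvgrPdist_le : Hr; apply.
  have h5 : Lam m (cutoff r%:R) <= L (cutoff r%:R) + 1.
    by move: h4; rewrite ler_norml; lra.
  have h6 : e / C * Lam m (cutoff r%:R) <= e / C * (L (cutoff r%:R) + 1).
    by rewrite ler_pM2l// divr_gt0.
  have h7 : e / C * (L (cutoff r%:R) + 1) + e / C * L (cutoff r%:R) + e / C = e.
    have eC : e / C * C = e by rewrite divfK// gt_eqF.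
    by move: eC; rewrite {2}/C; set e' := e / C; lra.
  have t1 := ler_distD (L (rat_cone s N)) (L f) (Lam m f).
  have t2 := ler_distD (Lam m (rat_cone s N)) (L (rat_cone s N)) (Lam m f).
  move: h1; rewrite distrC; lra.
move=> f Cf.
have Cp : Cc (fun x => Num.max (f x) 0).
  apply: (Cc_dom Cf) => [|x ->]; last by rewrite maxxx.
  by apply: continuous_maxr; [exact: Cf.1|exact: cst_continuous].
have Cm : Cc (fun x => Num.max (- f x) 0).
  have Cn := CcN Cf; apply: (Cc_dom Cn) => [|x ->]; last by rewrite maxxx.
  by apply: continuous_maxr; [exact: Cn.1|exact: cst_continuous].
have -> : f = fun x => Num.max (f x) 0 - Num.max (- f x) 0.
  by apply/funext => x; rewrite /Num.max; case: ifPn; case: ifPn; rewrite -?leNgt; lra.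
rewrite (poslinB pL)//.
under eq_fun do rewrite (poslinB (pLam _))//.
by apply: cvgB; apply: pos => // x; rewrite le_max lexx orbT.
Unshelve. all: by end_near. Qed.

(* The limit functional is taken along an ultrafilter, so that no diagonal
   extraction is needed; the subsequence is then chosen using the countable
   determining family test_fun. *)
Theorem weak_compactness (Lam : nat -> (point -> R) -> R) (u : nat -> R) :
  (forall m, poslin (Lam m)) ->
  (forall f, Cc f -> exists C, \forall m \near \oo, `|Lam m f| <= C) ->
  (forall m, 0 < u m) -> u @ \oo --> (0 : R) ->
  exists (e : nat -> nat) (mu : {measure set (borelRV R n) -> \bar R}),
    [/\ radon mu, nonincreasing_seq (u \o e), u \o e @ \oo --> (0 : R),
        (forall m, (m <= e m)%N) &
        forall f, Cc f -> Lam (e m) f @[m --> \oo] --> \int[mu]_x f x].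
Proof.
move=> pLam Lb u0 ucvg.
have [G [GU ooG]] := @ultraFilterLemma _ (\oo : set_system nat) _.
have /choice[L LP] : forall f, exists l, Cc f -> Lam m f @[m --> G] --> (l : R).
  move=> f; have [Cf|nCf] := pselect (Cc f); last by exists 0.
  have [C CP] := Lb _ Cf.
  have [|l [_ lP]] := @segment_compact R (- C) C (Lam m f @[m --> G]) _.
    by apply: ooG; apply: filterS CP => m /=; rewrite ler_norml in_itv/=.
  exists l => _ B Bl.
  have [//|nB] := in_ultra_setVsetC ((fun m => Lam m f) @^-1` B) GU.
  by have [x []] := lP (~` B) B nB Bl.
have PG : ProperFilter G by exact: ultra_proper.
have FG : Filter G by exact: filter_filter.
have pL : poslin L.
  split.
  - move=> f g Cf Cg.
    have h := cvgD (LP _ Cf) (LP _ Cg).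
    have h' : Lam m (fun x => f x + g x) @[m --> G] --> L f + L g.
      under eq_fun do rewrite (poslinD (pLam _))//.
      exact: h.
    exact: (cvg_unique _ (LP _ (CcD Cf Cg)) h').
  - move=> a f Cf.
    have h := cvgM (cvg_cst a) (LP _ Cf).
    have h' : Lam m (fun x => a * f x) @[m --> G] --> a * L f.
      under eq_fun do rewrite (poslinZ (pLam _))//.
      exact: h.
    exact: (cvg_unique _ (LP _ (CcZ a Cf)) h').
  - move=> f Cf f0; rewrite -(cvg_lim _ (LP _ Cf))//.
    apply: limr_ge; first by apply/cvg_ex; exists (L f); exact: LP.
    by apply: nearW => m; exact: (poslin_ge0 (pLam m)).
have [mu [rmu muL]] := riesz_representation pL.
(* Members of an ultrafilter are nonempty, so a single j meets all the demands at once; u_j <= u_k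
   is what makes the selected subsequence of u nonincreasing. *)
have /choice[next nextP] : forall mk : nat * nat, exists j : nat,
    [/\ (mk.1 <= j)%N, u j <= u mk.2 &
        forall i, (i <= mk.1)%N ->
          `|L (test_fun i) - Lam j (test_fun i)| < mk.1.+1%:R^-1].
  move=> [m k] /=.
  suff : G [set j | [/\ (m <= j)%N, u j <= u k & forall i, (i <= m)%N ->
          `|L (test_fun i) - Lam j (test_fun i)| < m.+1%:R^-1]].
    by move=> /filter_ex.
  have g1 : G [set j | (m <= j)%N] by apply: ooG; exact: nbhs_infty_ge.
  have g2 : G [set j | u j <= u k].
    by apply: ooG; apply: (cvgr_le _ ucvg).
  have g3 i : G [set j | `|L (test_fun i) - Lam j (test_fun i)| < m.+1%:R^-1].
    by have := LP _ (test_fun_Cc i); move=> /cvgrPdist_lt; apply.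
  have g4 m' : G [set j | forall i, (i < m')%N ->
      `|L (test_fun i) - Lam j (test_fun i)| < m.+1%:R^-1].
    elim: m' => [|m' IH]; first by apply: filterS filterT => j _ i.
    apply: filterS (filterI IH (g3 m')) => j [h1 h2] i.
    by rewrite ltnS leq_eqVlt => /predU1P[->//|/h1].
  by apply: filterS (filterI g1 (filterI g2 (g4 m.+1))) => j /= [jm [jk jI]]; split.
pose fix e (m : nat) : nat :=
  match m with 0 => next (0, 0)%N | m'.+1 => next (m'.+1, e m') end.
have em m : (m <= e m)%N.
  by case: m => [|m]//=; have [] := nextP (m.+1, e m).
have eu m : u (e m.+1) <= u (e m) by have [] := nextP (m.+1, e m).
have eL m i : (i <= m)%N -> `|L (test_fun i) - Lam (e m) (test_fun i)| < m.+1%:R^-1.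
  by case: m => [|m]; [have [_ _] := nextP (0, 0)%N|have [_ _] := nextP (m.+1, e m)]; apply.
have eoo : e @ \oo --> \oo.
  by apply/cvgnyPge => A; near=> m; rewrite (leq_trans _ (em m))//; near: m; exact: nbhs_infty_ge.
exists e, mu; split => //.
- by apply/nonincreasing_seqP => m; exact: eu.
- exact: (cvg_comp _ _ eoo ucvg).
- move=> f Cf; rewrite muL//.
  apply: (@test_fun_determining (fun m => Lam (e m)) L) => // i.
  apply/cvgrPdist_lt => eps eps0; near=> m.
  apply: (@lt_trans _ _ m.+1%:R^-1).
    by apply: eL; near: m; exact: nbhs_infty_ge.
  by near: m; exact: (near_infty_natSinv_lt (PosNum eps0)).
Unshelve. all: by end_near. Qed.

End weak_compactness.

(** * Lebesgue measure and dilations *)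

Section lebesgue_rV.
Context {R : realType}.

Lemma measurable_scale (s : R) :
  measurable_fun setT ( *%R s : measurableTypeR R -> measurableTypeR R).
Proof. by apply: measurable_funM => //; exact: measurable_cst. Qed.

(** Both measures agree on half-open intervals, which determine Lebesgue measure. *)
Lemma lebesgue_measure_scale (s : {posnum R}) (A : set (measurableTypeR R)) :
  measurable A ->
  pushforward (mscale (NngNum (ltW (gt0 s))) lebesgue_measure)
    ( *%R s%:num : measurableTypeR R -> measurableTypeR R) A = lebesgue_measure A.
Proof.
have ms := measurable_scale s%:num.
move=> mA; apply/esym/lebesgue_measure_unique => // _ [[a b] _ <-] /=.
have s0 : 0 < s%:num by [].
rewrite /pushforward /mscale /=.
have -> : *%R s%:num @^-1` `]a, b]%classic = `](a / s%:num), (b / s%:num)]%classic.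
  by apply/seteqP; split => x /=; rewrite !in_itv /= ltr_pdivrMr// ler_pdivlMr// mulrC.
rewrite !lebesgue_measure_itv /= !lte_fin ltr_pM2r ?invr_gt0//.
case: ifPn => _; last by rewrite mule0.
by rewrite -!EFinB -EFinM; congr (_%:E); field; rewrite gt_eqF.
Qed.

Lemma ge0_integral_lebesgue_scale (s : R) (f : measurableTypeR R -> \bar R) :
  0 < s -> measurable_fun setT f -> (forall x, 0 <= f x)%E ->
  (\int[lebesgue_measure]_x f (s * x)%R =
   (s^-1)%:E * \int[lebesgue_measure]_x f x)%E.
Proof.
move=> s0 mf f0; have ms := measurable_scale s.
pose sp := PosNum s0.
have -> : (\int[lebesgue_measure]_x f x =
  \int[pushforward (mscale (NngNum (ltW (gt0 sp))) lebesgue_measure)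
    ( *%R s : measurableTypeR R -> measurableTypeR R)]_x f x)%E.
  by apply: eq_measure_integral => // A mA _; exact/esym/(lebesgue_measure_scale sp mA).
rewrite (ge0_integral_pushforward ms)// preimage_setT ge0_integral_mscale//=.
  by rewrite muleA -EFinM mulVf ?gt_eqF// mul1e.
exact: measurableT_comp.
Qed.

Local Notation lambda := (lebesgue_measure_rV (R := R)).

(** Balls of the sup norm are cubes, hence products of intervals. *)
Lemma lebesgue_rV_ball n (x : 'rV[R]_n) (r : R) : 0 < r ->
  lambda n (ball x r) = ((r *+ 2) ^+ n)%:E.
Proof.
move=> r0; elim: n x => [|n IH] x /=.
  rewrite expr0 diracE mem_set//; apply/rV_ball => // i.
  by case: i.
rewrite /lebesgue_step /pushforward.
have -> : @consRV R n @^-1` ball x r =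
    ball (x 0 0) r `*` ball (\row_i x 0 (lift 0 i) : 'rV[R]_n) r.
  apply/seteqP; split => [p /rV_ball H|p [p1 /rV_ball p2]].
    split; first by have := H r0 0; rewrite consRV0.
    by apply/rV_ball => // i; have := H r0 (lift 0 i); rewrite consRVS !mxE.
  apply/rV_ball => // i.
  case: (unliftP 0 i) => [j ->|->]; last by rewrite consRV0.
  by rewrite consRVS; have := p2 r0 j; rewrite mxE.
rewrite product_measure1E.
- rewrite (IH (\row_i x 0 (lift 0 i))) exprS EFinM; congr (_ * _)%E.
  exact: (lebesgue_measure_ball _ (ltW r0)).
- exact: measurable_ball.
- by apply: rV_measurable_open; exact: ball_open.
Qed.

Lemma radon_lebesgue_rV n : radon (lambda n).
Proof.
move=> K cK; have /compact_bounded[M [_ MK]] := cK.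
have N0 : 0 < `|M| + 2 by rewrite ltr_wpDl.
apply: (@le_lt_trans _ _ (lambda n (ball 0 (`|M| + 2)))); last first.
  by rewrite lebesgue_rV_ball// ltry.
apply: le_measure.
- rewrite inE -(setCK K); apply: measurableC; apply: rV_measurable_open.
  by apply: closed_openC; apply: compact_closed => //; exact: norm_hausdorff.
- by rewrite inE; apply: rV_measurable_open; exact: ball_open.
- move=> x /(MK (`|M| + 1)); rewrite -ball_normE /= sub0r normrN => H.
  have /H : M < `|M| + 1 by rewrite (le_lt_trans (ler_norm M))// ltrDl.
  by lra.
Qed.

Lemma lebesgue_rV_open_gt0 n (U : set 'rV[R]_n) x : open U -> U x ->
  (0 < lambda n U)%E.
Proof.
move=> oU Ux.
have /nbhs_ballP[e /= e0 He] : nbhs x U by exact: open_nbhs_nbhs.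
apply: (@lt_le_trans _ _ (lambda n (ball x e))).
  by rewrite lebesgue_rV_ball// lte_fin exprn_gt0// mulrn_wgt0.
apply: le_measure => //; rewrite inE; apply: rV_measurable_open => //.
exact: ball_open.
Qed.

Lemma measurable_scale_rV n (s : R) : measurable_fun setT
  (fun x : borelRV R n => (s *: (x : 'rV[R]_n) : borelRV R n)).
Proof.
apply: (@measurability _ _ _ (borelRV R n) _ _ (@open 'rV[R]_n)) => // _ [U oU <-].
rewrite setTI; apply: sub_sigma_algebra; apply: open_comp => // x _.
exact: scaler_continuous.
Qed.

(** Tonelli and induction on the dimension: each coordinate contributes a factor 1/s. *)
Lemma ge0_integral_lebesgue_rV_scale n (s : R) (f : borelRV R n -> \bar R) :
  0 < s -> measurable_fun setT f -> (forall x, 0 <= f x)%E ->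
  (\int[lambda n]_x f (s *: (x : 'rV[R]_n))%R =
   (s^-1 ^+ n)%:E * \int[lambda n]_x f x)%E.
Proof.
move=> s0; elim: n f => [|n IH] f mf f0.
  rewrite expr0 mul1e; congr (integral _ _ _); apply/funext => x; congr f.
  by apply/rowP => -[].
have step (g : borelRV R n.+1 -> \bar R) : measurable_fun setT g -> (forall x, 0 <= g x)%E ->
    (\int[lambda n.+1]_x g x =
     \int[lebesgue_measure]_t \int[lambda n]_y g (consRV (t, y)))%E.
  move=> mg g0 /=; rewrite (ge0_integral_pushforward (@measurable_consRV R n))//.
  rewrite preimage_setT fubini_tonelli1//; last by move=> x; exact: g0.
  exact: measurableT_comp mg (@measurable_consRV R n).
rewrite step//; last first.
  exact: measurableT_comp mf (@measurable_scale_rV _ s).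
have mfc : measurable_fun setT (f \o @consRV R n).
  exact: measurableT_comp mf (@measurable_consRV R n).
have -> : (\int[lebesgue_measure]_t \int[lambda n]_y f (s *: (consRV (t, y) : 'rV[R]_n.+1))%R =
   \int[lebesgue_measure]_t ((s^-1 ^+ n)%:E * \int[lambda n]_y f (consRV ((s * t)%R, y))))%E.
  apply: eq_integral => t _.
  rewrite -IH//; last first.
    have mp : measurable_fun setT
        (fun y : borelRV R n => ((s * t)%R : measurableTypeR R, y)).
      by apply: measurable_fun_pair => //; exact: measurable_cst.
    exact: (measurableT_comp mfc mp).
  apply: eq_integral => y _; congr f; apply/rowP => i; rewrite mxE.
  case: (unliftP 0 i) => [j ->|->]; first by rewrite !consRVS mxE.
  by rewrite !consRV0.
pose F t := (\int[lambda n]_y f (consRV (t, y)))%E.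
have mF : measurable_fun setT F by apply: (@measurable_fun_fubini_tonelli_F _ _ _ _ R (lambda n) (f \o @consRV R n)) => // z; exact: f0.
have F0 t : (0 <= F t)%E by apply: integral_ge0.
rewrite ge0_integralZl//; last 3 first.
- exact: (measurableT_comp mF (measurable_scale s)).
- by move=> t _; exact: F0.
- by rewrite lee_fin exprn_ge0// invr_ge0 ltW.
rewrite (ge0_integral_lebesgue_scale s0 mF F0) step// muleA -EFinM.
by rewrite -exprSr.
Qed.

Lemma Rintegral_lebesgue_rV_scale n (s : R) (f : 'rV[R]_n -> R) :
  0 < s -> Cc f ->
  \int[lambda n]_x f (s *: (x : 'rV[R]_n)) = s^-1 ^+ n * \int[lambda n]_x f x.
Proof.
move=> s0 Cf; have rl := @radon_lebesgue_rV n.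
have pI := poslin_Rintegral rl.
have Cfs (h : 'rV[R]_n -> R) : Cc h -> Cc (fun x => h (s *: x)).
  move=> Ch; have [L L0 h0] := Cc_bounded_supp Ch.
  apply: (@Cc_of_bounded_supp _ _ _ (L / s)) => [x|x xL].
    exact: (continuous_comp (@scaler_continuous _ _ s x) (proj1 Ch _)).
  by apply: h0; rewrite normrZ gtr0_norm// mulrC -ltr_pdivrMr.
have ge0 (h : 'rV[R]_n -> R) : Cc h -> (forall x, 0 <= h x) ->
    \int[lambda n]_x h (s *: (x : 'rV[R]_n)) = s^-1 ^+ n * \int[lambda n]_x h x.
  move=> Ch h0; apply: EFin_inj; rewrite EFinM -!Rintegral_EFin//; last exact: Cfs.
  apply: (@ge0_integral_lebesgue_rV_scale n s (EFin \o h)) => //.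
  by apply/measurable_EFinP; apply: continuous_measurable_rV; exact: Ch.1.
have Cp : Cc (fun x => Num.max (f x) 0).
  apply: (Cc_dom Cf) => [|x ->]; last by rewrite maxxx.
  by apply: continuous_maxr; [exact: Cf.1|exact: cst_continuous].
have Cm : Cc (fun x => Num.max (- f x) 0).
  have Cn := CcN Cf; apply: (Cc_dom Cn) => [|x ->]; last by rewrite maxxx.
  by apply: continuous_maxr; [exact: Cn.1|exact: cst_continuous].
have -> : f = fun x => Num.max (f x) 0 - Num.max (- f x) 0.
  by apply/funext => x; rewrite /Num.max; case: ifPn; case: ifPn; rewrite -?leNgt; lra.
have := poslinB pI Cp Cm; have := poslinB pI (Cfs _ Cp) (Cfs _ Cm) => /= -> ->.
have mx (x : R) : 0 <= Num.max x 0 by rewrite le_max lexx orbT.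
have := ge0 _ Cp (fun x => mx _); have := ge0 _ Cm (fun x => mx _) => /= -> ->.
by rewrite mulrBr.
Qed.

Lemma Rintegral_gt0 n (mu : {measure set (borelRV R n) -> \bar R}) (f : 'rV[R]_n -> R) x :
  radon mu -> spt mu x -> Cc f -> (forall y, 0 <= f y) -> 0 < f x -> 0 < \int[mu]_y f y.
Proof.
move=> rmu smu Cf f0 fx.
pose U := [set y | f x / 2 < f y].
have oU : open U.
  apply: (@open_comp _ _ f [set z | f x / 2 < z]); last exact: open_gt.
  by move=> y _; exact: Cf.1.
have fx2 : 0 < f x / 2 by rewrite divr_gt0.
have Ux : U x by rewrite /U /=; lra.
have := smu U oU Ux.
have Cf2 := CcZ (f x / 2)^-1 Cf.
move=> /lt_le_trans => /(_ (\int[mu]_y ((f x / 2)^-1 * f y))%:E).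
rewrite lte_fin (RintegralZl _ _ (Cc_integrable rmu Cf))// pmulr_rgt0 ?invr_gt0//; apply.
rewrite -(RintegralZl _ _ (Cc_integrable rmu Cf))//.
apply: measure_le_Rintegral => //.
- exact: rV_measurable_open.
- by move=> y; rewrite mulr_ge0// invr_ge0 ltW.
- by move=> y /= /ltW Uy; rewrite mulrC ler_pdivlMr// mul1r.
Qed.

Lemma spt_lebesgue_rV n x : spt (lambda n) x.
Proof. by move=> U oU Ux; exact: lebesgue_rV_open_gt0 oU Ux. Qed.

End lebesgue_rV.

(** * Radial bump functions *)

Section bump.
Context {R : realType}.

Lemma is_derive1_comp (f g : R -> R) (x a b : R) :
  is_derive x 1 f a -> is_derive (f x) 1 g b -> is_derive x 1 (g \o f) (b * a).
Proof.
move=> /is_derive1_caratheodory[f1 [fE cf <-]].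
move=> /is_derive1_caratheodory[g1 [gE cg <-]].
apply/is_derive1_caratheodory; exists (fun z => g1 (f z) * f1 z); split => //.
  by move=> z /=; rewrite gE fE mulrA.
have cfx : {for x, continuous f}.
  have -> : f = fun z => f1 z * (z - x) + f x.
    by apply/funext => z; rewrite -fE subrK.
  apply: cvgD; last exact: cvg_cst.
  by apply: cvgM => //; apply: cvgB; [exact: cvg_id|exact: cvg_cst].
by apply: cvgM => //; exact: (continuous_comp cfx cg).
Qed.

(* Dividing by powers of 1 - t makes the family closed under differentiation. *)
Definition theta (m : nat) (t : R) : R :=
  if t < 1 then expR (- (1 - t)^-1) / (1 - t) ^+ m else 0.

Lemma theta_ge0 m t : 0 <= theta m t.
Proof.
rewrite /theta; case: ifPn => // t1.
by rewrite divr_ge0 ?expR_ge0// exprn_ge0// subr_ge0 ltW.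
Qed.

Lemma theta_gt0 m t : t < 1 -> 0 < theta m t.
Proof. by move=> t1; rewrite /theta t1 divr_gt0 ?expR_gt0// exprn_gt0// subr_gt0. Qed.

Lemma theta_eq0 m t : 1 <= t -> theta m t = 0.
Proof. by move=> t1; rewrite /theta ltNge t1. Qed.

Lemma theta0_le (s t : R) : s <= t -> theta 0 t <= theta 0 s.
Proof.
move=> st; have [t1|t1] := leP 1 t; first by rewrite (theta_eq0 _ t1) theta_ge0.
have s1 := le_lt_trans st t1.
rewrite /theta t1 s1 !expr0 !divr1 ler_expR lerN2 lef_pV2 ?posrE ?subr_gt0//.
by rewrite lerD2l lerN2.
Qed.

Lemma thetaS m t : theta m t = theta m.+1 t * (1 - t).
Proof.
rewrite /theta; case: ifPn => [t1|_]; last by rewrite mul0r.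
have t0 : 1 - t != 0 by rewrite gt_eqF// subr_gt0.
by rewrite exprSr invfM -!mulrA mulVf// mulr1.
Qed.

(** From exp(v) >= v^(m+1)/(m+1)! at v = 1/(1 - t). The bound vanishes at t = 1, which gives
    continuity there and, applied to m + 1, differentiability. *)
Lemma theta_le m t : theta m t <= m.+1`!%:R * `|1 - t|.
Proof.
have [t1|t1] := ltP t 1; last by rewrite theta_eq0// mulr_ge0.
have u0 : 0 < 1 - t by rewrite subr_gt0.
rewrite gtr0_norm// /theta t1 ler_pdivrMr ?exprn_gt0//.
have := @expR_ge1Dxn R (1 - t)^-1 m; rewrite invr_ge0 ltW// => /(_ isT) h.
have F0 : 0 < m.+1`!%:R :> R by rewrite ltr0n fact_gt0.
rewrite expRN -mulrA -exprS -[leRHS]invrK lef_pV2 ?posrE ?expR_gt0 ?invr_gt0//; last first.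
  by rewrite mulr_gt0// exprn_gt0.
by apply: le_trans h; rewrite invfM mulrC exprVn ler_wpDl.
Qed.

Lemma theta_at1 m : theta m x @[x --> (1 : R)] --> (0 : R).
Proof.
apply: (@squeeze_cvgr _ _ _ _ (fun=> 0) (fun x => m.+1`!%:R * `|1 - x|)).
- by apply: nearW => x; rewrite theta_ge0 theta_le.
- exact: cvg_cst.
- rewrite -[X in _ --> X](_ : m.+1`!%:R * `|1 - 1| = 0); last by rewrite subrr normr0 mulr0.
  apply: cvgM; first exact: cvg_cst.
  by apply: cvg_norm; apply: cvgB; [exact: cvg_cst|exact: cvg_id].
Qed.

(** For t < 1 put v = 1/(1 - t): then theta_m = v^m exp(-v) and v' = v^2. At t = 1 the difference
    quotient is -theta_(m+1), which tends to 0. *)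
Lemma is_derive_theta m t :
  is_derive (t : R) (1 : R) (theta m) (m%:R * theta m.+1 t - theta m.+2 t).
Proof.
have key (v E : R) (k : nat) : k%:R * (E * v ^+ k.+1) - E * v ^+ k.+2 =
    E * (k%:R * v ^+ k.-1 * v ^+ 2) + v ^+ k * (E * - v ^+ 2).
  by case: k => [|k]; rewrite /= ?mul0r !exprS; ring.
have [t1|t1|->] := ltgtP t 1.
- pose u (z : R) := 1 - z.
  have u0 : 1 - t != 0 by rewrite gt_eqF// subr_gt0.
  have du : is_derive t 1 u (-1).
    apply/is_derive1_caratheodory; exists (fun=> -1); split => //; last exact: cvg_cst.
    by move=> z; rewrite /u; ring.
  have dV : is_derive t 1 (fun z => (u z)^-1) ((1 - t)^-1 ^+ 2).
    apply: DeriveDef; first by apply: derivableV => //; exact: ex_derive.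
    rewrite deriveV//.
    by rewrite derive_val /GRing.scale /= mulrN1 opprK exprVn.
  have dE : is_derive t 1 (fun z => expR (- (u z)^-1)) (expR (- (1 - t)^-1) * - (1 - t)^-1 ^+ 2).
    exact: (@is_derive1_comp (fun z => - (u z)^-1) expR t _ _
      (is_deriveN dV) (is_derive_expR _)).
  have dX := @is_deriveX _ _ _ m t 1 _ dV.
  have dM := is_deriveM dE dX.
  apply: (near_eq_is_derive (f := (fun z => expR (- (u z)^-1)) * (fun z => (u z)^-1) ^+ m)).
    near=> z; rewrite /theta (_ : z < 1); last by near: z; exact: lt_nbhsl.
    by rewrite -exprVn mulrfctE exprfctE.
  apply: (is_derive_eq dM).
  rewrite /theta t1 exprfctE /GRing.scale /= -!exprVn.
  exact/esym/key.
- rewrite !theta_eq0 ?ltW// mulr0 subr0.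
  have d0 : is_derive t 1 (cst (0 : R)) (0 : R) by exact: is_derive_cst.
  apply: (near_eq_is_derive _ d0).
  near=> z; rewrite theta_eq0//; apply: ltW; near: z; exact: lt_nbhsr.
- rewrite !theta_eq0// mulr0 subr0.
  apply/is_derive1_caratheodory; exists (fun z => - theta m.+1 z); split => //.
  + by move=> z; rewrite (theta_eq0 m (lexx 1)) subr0 (thetaS m); ring.
  + rewrite /prop_for /continuous_at theta_eq0// oppr0 -oppr0.
    by apply: cvgN; exact: theta_at1.
  + by rewrite theta_eq0// oppr0.
Unshelve. all: by end_near. Qed.

Lemma continuous_theta m : continuous (theta m).
Proof.
move=> t; apply: differentiable_continuous; apply/derivable1_diffP.
by have := is_derive_theta m t => -[].
Qed.

(** Lets partial derivatives be computed by one-variable calculus on a line through x. *)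
Lemma is_derive_along {V : normedModType R} (f : V -> R) (x v : V) (df : R) :
  is_derive (0 : R) 1 (fun h : R => f (h *: v + x)) df -> is_derive x v f df.
Proof.
have E : (fun h : R => h^-1 *: (((fun h : R => f (h *: v + x)) \o shift 0) (h *: 1) -
     (fun h : R => f (h *: v + x)) 0)) =
   (fun h => h^-1 *: ((f \o shift x) (h *: v) - f x)).
  by apply/funext => h /=; rewrite addr0 scale0r add0r /GRing.scale /= mulr1.
move=> -[D <-]; split; first by rewrite /derivable -E.
by rewrite /derive -E.
Qed.

Context {n : nat}.
Local Notation point := 'rV[R]_n.
Implicit Types f g : point -> R.

Lemma Ck_continuous k f : Ck k setT f -> continuous f.
Proof. by case: k => [|k] /= => [cf x|[cf _] x]; exact: cf. Qed.

Lemma CkS k f : Ck k.+1 setT f -> Ck k setT f.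
Proof.
elim: k f => [|k IH] f /=; first by case.
by move=> [cf H]; split => // i; have [? ?] := H i; split => //; exact: IH.
Qed.

Lemma Ck_add k f g : Ck k setT f -> Ck k setT g -> Ck k setT (fun x => f x + g x).
Proof.
elim: k f g => [|k IH] f g /=.
  by move=> cf cg x _; exact: (cvgD (cf x I) (cg x I)).
move=> [cf Hf] [cg Hg]; split.
  by move=> x _; exact: (cvgD (cf x I) (cg x I)).
move=> i; have [df Cf] := Hf i; have [dg Cg] := Hg i; split.
  by move=> x _; apply: derivableD; [exact: df|exact: dg].
rewrite (_ : partial i _ = fun x => partial i f x + partial i g x); first exact: IH.
by apply/funext => x; apply: deriveD; [exact: df|exact: dg].
Qed.

Lemma Ck_mul k f g : Ck k setT f -> Ck k setT g -> Ck k setT (fun x => f x * g x).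
Proof.
elim: k f g => [|k IH] f g.
  by move=> cf cg x _; exact: (cvgM (cf x I) (cg x I)).
move=> Cf Cg; have := CkS Cf; have := CkS Cg => Cgk Cfk.
move: Cf Cg => [cf Hf] [cg Hg]; split.
  by move=> x _; exact: (cvgM (cf x I) (cg x I)).
move=> i; have [df Cf] := Hf i; have [dg Cg] := Hg i; split.
  by move=> x _; apply: derivableM; [exact: df|exact: dg].
rewrite (_ : partial i _ = fun x => f x * partial i g x + g x * partial i f x).
  by apply: Ck_add; exact: IH.
by apply/funext => x; apply: deriveM; [exact: df|exact: dg].
Qed.

Lemma Ck_cst k (c : R) : Ck k setT (fun _ : point => c).
Proof.
elim: k c => [|k IH] c /=; first by move=> x _; exact: (@cst_continuous _ _ c x).
split=> [x _|i]; first exact: (@cst_continuous _ _ c x).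
split; first by move=> x _; exact: derivable_cst.
by rewrite (_ : partial i _ = fun=> 0)//; apply/funext => x; exact: derive_cst.
Qed.

Lemma is_derive_coord (i j : 'I_n) (x : point) :
  is_derive x (delta_mx 0 i) (fun y : point => y 0 j) ((i == j)%:R).
Proof.
apply: is_derive_along; apply/is_derive1_caratheodory.
exists (fun=> (i == j)%:R); split => //; last exact: cvg_cst.
by move=> z; rewrite !mxE eqxx /= (eq_sym j); ring.
Qed.

Lemma Ck_coord k (j : 'I_n) : Ck k setT (fun x : point => x 0 j).
Proof.
have cj : continuous (fun x : point => x 0 j) by exact: coord_continuous.
case: k => [|k] /=; first by move=> x _; exact: cj.
split=> [x _|i]; first exact: cj.
split; first by move=> x _; have [] := is_derive_coord i j x.
rewrite (_ : partial i _ = fun=> (i == j)%:R); first exact: Ck_cst.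
by apply/funext => x; have [] := is_derive_coord i j x.
Qed.

(** The squared Euclidean norm, a polynomial and hence smooth, in contrast with the sup norm. *)
Definition nrm2 (x : point) : R := \sum_i x 0 i ^+ 2.

Lemma nrm2_ge0 x : 0 <= nrm2 x.
Proof. by apply: sumr_ge0 => i _; exact: sqr_ge0. Qed.

Lemma coord_le_norm (x : point) i : `|x 0 i| <= `|x|.
Proof.
rewrite /Num.norm /= mx_normrE.
exact: (le_bigmax _ (fun ij : 'I_1 * 'I_n => `|x ij.1 ij.2|) (0, i)).
Qed.

Lemma norm_le_nrm2 (x : point) : `|x| ^+ 2 <= nrm2 x.
Proof.
rewrite -(sqr_sqrtr (nrm2_ge0 x)) lerXn2r ?nnegrE ?sqrtr_ge0//.
rewrite {1}/Num.norm /= mx_normrE; apply/bigmax_leP; split; first exact: sqrtr_ge0.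
move=> [i j] _ /=; rewrite ord1 -sqrtr_sqr; apply: ler_wsqrtr.
by rewrite /nrm2 (bigD1 j)//= lerDl sumr_ge0// => k _; exact: sqr_ge0.
Qed.

Lemma nrm2_le_norm (x : point) : nrm2 x <= n%:R * `|x| ^+ 2.
Proof.
rewrite /nrm2 mulr_natl -[X in _ *+ X](card_ord n) -sumr_const; apply: ler_sum => i _.
by rewrite -real_normK ?num_real// lerXn2r ?nnegrE// coord_le_norm.
Qed.

Lemma nrm2Z (s : R) x : nrm2 (s *: x) = s ^+ 2 * nrm2 x.
Proof. by rewrite /nrm2 mulr_sumr; apply: eq_bigr => i _; rewrite mxE exprMn. Qed.

Lemma continuous_nrm2 : continuous nrm2.
Proof.
have : Ck 0 setT nrm2.
  rewrite (_ : nrm2 = fun x => \sum_(i <- index_enum 'I_n) x 0 i * x 0 i); last first.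
    by apply/funext => x; apply: eq_bigr => i _; rewrite expr2.
  elim: (index_enum _) => [|i s IH].
    rewrite (_ : (fun _ => _) = fun=> 0); first exact: Ck_cst.
    by apply/funext => x; rewrite big_nil.
  under eq_fun do rewrite big_cons.
  exact: (Ck_add (Ck_mul (Ck_coord 0 i) (Ck_coord 0 i)) IH).
exact: Ck_continuous.
Qed.

(** Scale s corresponds to a = s^-2; the index m follows the powers of 1/(1 - t) produced by
    differentiation. *)
Definition bump (m : nat) (a : R) (x : point) : R := theta m (a * nrm2 x).

Lemma is_derive_bump m a i x : is_derive x (delta_mx 0 i) (bump m a)
  ((m%:R * bump m.+1 a x - bump m.+2 a x) * (2 * a * x 0 i)).
Proof.
apply: is_derive_along.
pose q (h : R) := a * (nrm2 x + 2 * x 0 i * h + h ^+ 2).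
have qE h : a * nrm2 (h *: delta_mx 0 i + x) = q h.
  rewrite /q /nrm2; congr (a * _).
  rewrite [LHS](bigD1 i)//= [in RHS](bigD1 i)//= !mxE !eqxx mulr1.
  rewrite (eq_bigr (fun j => x 0 j ^+ 2)); first by ring.
  by move=> j ji; rewrite !mxE (negbTE ji) andbF mulr0 add0r.
rewrite (_ : (fun h => _) = theta m \o q); last first.
  by apply/funext => h; rewrite /bump qE.
have dq : is_derive (0 : R) 1 q (2 * a * x 0 i).
  apply/is_derive1_caratheodory.
  exists (fun h => a * (2 * x 0 i + h)); split.
  - by move=> z; rewrite /q; ring.
  - apply: cvgM; first exact: cvg_cst.
    by apply: cvgD; [exact: cvg_cst|exact: cvg_id].
  - by ring.
have q0 : q 0 = a * nrm2 x by rewrite /q; ring.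
rewrite /bump -q0; exact: (is_derive1_comp dq (is_derive_theta m (q 0))).
Qed.

Lemma partial_bump m a i : partial i (bump m a) =
  (fun x => (m%:R * bump m.+1 a x + -1 * bump m.+2 a x) * (2 * a * x 0 i)).
Proof.
by apply/funext => x; rewrite mulN1r /partial; have [] := is_derive_bump m a i x.
Qed.

(** Induction on k for all m together: partial derivatives are combinations of bumps of higher
    index, times a coordinate. *)
Lemma Ck_bump k m a : Ck k setT (bump m a).
Proof.
have cb m' : continuous (bump m' a).
  have cn : continuous (fun x => a * nrm2 x).
    by move=> x; exact: (cvgM (cvg_cst _) (@continuous_nrm2 x)).
  by move=> x; exact: (continuous_comp (cn x) (@continuous_theta m' _)).
elim: k m => [|k IH] m /=; first by move=> x _; exact: cb.
split=> [x _|i]; first exact: cb.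
split; first by move=> x _; have [] := is_derive_bump m a i x.
rewrite partial_bump; apply: Ck_mul; last by apply: Ck_mul; [exact: Ck_cst|exact: Ck_coord].
by apply: Ck_add; (apply: Ck_mul; [exact: Ck_cst|exact: IH]).
Qed.

Lemma bump_eq0 m a L x : 0 < L -> 1 <= a * L ^+ 2 -> L < `|x| -> bump m a x = 0.
Proof.
move=> L0 aL xL; apply: theta_eq0; apply: (le_trans aL).
have a0 : 0 < a.
  by rewrite -(pmulr_lgt0 _ (exprn_gt0 2 L0)); exact: lt_le_trans aL.
rewrite ler_pM2l//; apply: le_trans (norm_le_nrm2 x).
by rewrite lerXn2r ?nnegrE// ltW.
Qed.

Lemma bump_Cc_infty m a : 0 < a -> Cc_infty (bump m a).
Proof.
move=> a0; split=> [k|]; first exact: Ck_bump.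
(* Any L with a L^2 >= 1 will do, and a (a^-1 + 1)^2 = a^-1 + 2 + a. *)
apply: (proj2 (Cc_of_bounded_supp (L := a^-1 + 1) _ _)).
  exact: (Ck_continuous (Ck_bump 0 m a)).
move=> x; apply: bump_eq0; first by rewrite addr_gt0// invr_gt0.
have a1 : 0 < a^-1 by rewrite invr_gt0.
have -> : a * (a^-1 + 1) ^+ 2 = a^-1 + 2 + a by field; rewrite gt_eqF.
lra.
Qed.

Lemma bump_Cc m a : 0 < a -> Cc (bump m a).
Proof.
by move=> a0; split; [exact: (Ck_continuous (Ck_bump 0 m a))|exact: (bump_Cc_infty m a0).2].
Qed.

(** The derivative of [theta 2], that is, minus the second derivative of [theta 0]. *)
Definition dtheta (t : R) : R := 2 * theta 3 t - theta 4 t.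

(* The Laplacian of bump 0 1 is a function of |x|^2, namely
   4 t theta_0''(t) + 2 n theta_0'(t) at t = |x|^2, where theta_0' = - theta_2. *)
Definition bump_lap (t : R) : R :=
  - 4 * t * dtheta t - 2 * n%:R * theta 2 t.

Lemma laplacian_bump a x : laplacian (bump 0 a) x = a * bump_lap (a * nrm2 x).
Proof.
rewrite /laplacian.
rewrite (eq_bigr (fun i => - 4 * a ^+ 2 * dtheta (a * nrm2 x) * x 0 i ^+ 2 -
    2 * a * theta 2 (a * nrm2 x))); last first.
  move=> i _; rewrite partial_bump.
  have dM := is_deriveM (is_derive_bump 2 a i x) (is_derive_coord i i x).
  have dZ := is_deriveZ (- 2 * a) dM.
  rewrite /partial (_ : (fun y => _) = (- 2 * a) \*: (bump 2 a * (fun y : point => y 0 i))); last first.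
    by apply/funext => y /=; rewrite mulrfctE /GRing.scale /=; ring.
  have [_ ->] := dZ.
  rewrite /GRing.scale /= eqxx mulr1n /dtheta /bump.
  ring.
rewrite big_split /= -mulr_sumr -/(nrm2 x) sumr_const card_ord /bump_lap -mulr_natr.
ring.
Qed.

End bump.

(** * Euler's identity for homogeneous functions, tested against the bump *)

Section homogeneous_functions.
Context {R : realType} {n : nat}.
Local Notation point := 'rV[R]_n.
Local Notation lambda := (lebesgue_measure_rV (R := R) n).
Implicit Types H : point -> R.

Lemma theta_bounded : exists2 B : nat -> R, forall m, 0 <= B m &
  forall m (t : R), 0 <= t -> theta m t <= B m.
Proof.
exists (fun m => m.+1`!%:R) => // m t t0.
have [t1|t1] := ltP t 1; last by rewrite theta_eq0.
apply: (le_trans (theta_le m t)); rewrite ger0_norm; last by rewrite subr_ge0 ltW.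
by rewrite mulrC ler_piMl// gerBl.
Qed.

Definition ddtheta (t : R) : R := 6 * theta 4 t - 6 * theta 5 t + theta 6 t.

Lemma is_derive_dtheta (t : R) : is_derive t (1 : R) dtheta (ddtheta t).
Proof.
have d3 := is_deriveZ (2 : R) (is_derive_theta 3 t).
have d4 := is_derive_theta 4 t.
apply: (is_derive_eq (is_deriveB d3 d4)).
by rewrite /GRing.scale /= /ddtheta; ring.
Qed.

Lemma is_derive_theta2 (t : R) : is_derive t (1 : R) (theta 2) (dtheta t).
Proof. exact: is_derive_theta. Qed.

Lemma dtheta_bounded : exists2 C : R, 0 <= C & forall t : R, 0 <= t -> `|dtheta t| <= C.
Proof.
have [B B0 BP] := theta_bounded.
exists (2 * B 3 + B 4); first by rewrite addr_ge0// mulr_ge0.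
move=> t t0; have := BP 3 t t0; have := BP 4 t t0.
have := theta_ge0 3 t; have := theta_ge0 4 t.
by rewrite /dtheta ler_norml => *; apply/andP; split; lra.
Qed.

Lemma dtheta_lipschitz : exists2 C : R, 0 <= C & forall t u : R, 0 <= t -> t <= u ->
  `|dtheta u - dtheta t| <= C * (u - t).
Proof.
have [B B0 BP] := theta_bounded.
exists (6 * B 4 + 6 * B 5 + B 6); first by rewrite !addr_ge0// mulr_ge0.
move=> t u t0 tu.
have [||c] := @MVT_segment R dtheta ddtheta t u tu.
- by move=> x _; exact: is_derive_dtheta.
- apply: continuous_subspaceT => x; apply: differentiable_continuous.
  by apply/derivable1_diffP; have [] := is_derive_dtheta x.
rewrite in_itv/= => /andP[tc _] ->; rewrite normrM (ger0_norm (_ : 0 <= u - t)) ?subr_ge0//.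
rewrite ler_wpM2r ?subr_ge0//.
have c0 : 0 <= c by exact: le_trans tc.
have := BP 4 c c0; have := BP 5 c c0; have := BP 6 c c0.
have := theta_ge0 4 c; have := theta_ge0 5 c; have := theta_ge0 6 c.
by rewrite /ddtheta ler_norml => *; apply/andP; split; lra.
Qed.

(** A second-order remainder, uniform in t, justifies differentiating under the integral sign. It
    vanishes for t >= 1, so it can be integrated against a homogeneous factor. *)
Lemma theta2_quotient : exists2 C : R, 0 <= C & forall h t : R, 0 < h <= 1 -> 0 <= t ->
  `|(theta 2 ((1 + h) ^+ 2 * t) - theta 2 t) - h * (2 * t * dtheta t)| <=
    h ^+ 2 * (C * (t < 1)%R%:R).
Proof.
have [A A0 AP] := dtheta_bounded; have [B B0 BP] := dtheta_lipschitz.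
exists (A + 6 * B) => [|h t /andP[h0 h1] t0]; first by rewrite addr_ge0// mulr_ge0.
have h21 : 1 <= (1 + h) ^+ 2 by rewrite exprn_ege1// lerDl ltW.
have [t1|t1] := ltP t 1; last first.
  rewrite mulr0 mulr0 !theta_eq0//; last first.
    by apply: (le_trans t1); rewrite ler_peMl.
  by rewrite /dtheta !theta_eq0// !(mulr0, subr0) normr0.
have tu : t <= (1 + h) ^+ 2 * t by rewrite ler_peMl.
have [||c] := @MVT_segment R (theta 2) dtheta t _ tu.
- by move=> x _; exact: is_derive_theta2.
- by apply: continuous_subspaceT => x; exact: continuous_theta.
rewrite in_itv/= => /andP[tc cu] ->.
(* c is the mean value point; splitting off [dtheta t] isolates the linear term, and c - t <= 3 h
   makes the rest quadratic in h. *)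
have -> : dtheta c * ((1 + h) ^+ 2 * t - t) - h * (2 * t * dtheta t) =
   h ^+ 2 * (t * dtheta c) + h * (2 * t) * (dtheta c - dtheta t) by ring.
rewrite mulr1; apply: (le_trans (ler_normD _ _)).
have h1' : `|h ^+ 2 * (t * dtheta c)| <= h ^+ 2 * A.
  rewrite normrM (ger0_norm (sqr_ge0 h)) ler_wpM2l ?sqr_ge0// normrM ger0_norm//.
  rewrite -[leRHS]mul1r; apply: ler_pM => //; first exact: ltW.
  by apply: AP; exact: le_trans tc.
have h2' : `|h * (2 * t) * (dtheta c - dtheta t)| <= h ^+ 2 * (6 * B).
  rewrite normrM ger0_norm; last by rewrite !mulr_ge0 // ltW.
  have b1 := BP t c t0 tc.
  have b2 : c - t <= 3 * h.
    apply: (@le_trans _ _ ((1 + h) ^+ 2 * t - t)); first by rewrite lerB.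
    have -> : (1 + h) ^+ 2 * t - t = (h * (2 + h)) * t by ring.
    apply: (@le_trans _ _ (h * (2 + h))).
      by rewrite ler_piMr ?ltW// mulr_gt0// addr_gt0.
    by rewrite [leRHS]mulrC ler_wpM2l ?(ltW h0)//; lra.
  have b3 : `|dtheta c - dtheta t| <= B * (3 * h).
    by apply: (le_trans b1); rewrite ler_wpM2l.
  have -> : h ^+ 2 * (6 * B) = h * 2 * (B * (3 * h)) by ring.
  apply: ler_pM => //; first by rewrite !mulr_ge0 // ltW.
  by rewrite ler_wpM2l ?(ltW h0)//; lra.
by rewrite [leRHS]mulrDr; exact: lerD.
Qed.

Definition homogeneous (j : nat) H :=
  forall s x, 0 < s -> H (s *: x) = s ^+ j * H x.

Lemma Cc_bumpM H m a : 0 < a -> continuous H -> Cc (fun x => H x * bump m a x).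
Proof.
move=> a0 cH; have := CcM (bump_Cc m a0) cH.
by under eq_fun do rewrite mulrC.
Qed.

Lemma Cc_Euler H : continuous H -> Cc (fun x => H x * (2 * nrm2 x * dtheta (nrm2 x))).
Proof.
move=> cH; have cn := @continuous_nrm2 R n.
have cnH : continuous (fun x : point => 2 * nrm2 x * H x).
  by move=> x; exact: (cvgM (cvgM (cvg_cst (2 : R)) (cn x)) (cH x)).
have := CcM (CcB (CcZ 2 (bump_Cc 3 (@ltr01 R))) (bump_Cc 4 (@ltr01 R))) cnH.
by congr Cc; apply/funext => x; rewrite /dtheta /bump mul1r /=; ring.
Qed.

(* Differentiate s |-> int H(x) theta_2(|s x|^2) dx = s^(-n-j) int H theta_2(|.|^2)
   at s = 1. *)
Lemma homogeneous_Euler j H : continuous H -> homogeneous j H -> (forall x, 0 <= H x) ->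
  \int[lambda]_x (H x * (2 * nrm2 x * dtheta (nrm2 x))) =
  - (n + j)%:R * \int[lambda]_x (H x * theta 2 (nrm2 x)).
Proof.
move=> cH hH H0.
set E := LHS; set A := \int[lambda]_x (H x * theta 2 (nrm2 x)).
have pI := poslin_Rintegral (@radon_lebesgue_rV R n).
have C2 a : 0 < a -> Cc (fun x => H x * theta 2 (a * nrm2 x)).
  by move=> a0; exact: Cc_bumpM.
have C21 : Cc (fun x => H x * theta 2 (nrm2 x)).
  by have := C2 1 ltr01; under eq_fun do rewrite mul1r.
(* Substituting y = s x gives s^-n from the volume and s^-j from H. *)
have scal s : 0 < s -> \int[lambda]_x (H x * theta 2 (s ^+ 2 * nrm2 x)) = s^-1 ^+ (n + j) * A.
  move=> s0; rewrite exprD mulrAC -[X in _ = X * _](Rintegral_lebesgue_rV_scale s0 C21).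
  rewrite mulrC -(poslinZ pI); last first.
    have := CcZ (s ^+ j) (C2 _ (exprn_gt0 2 s0)); congr Cc.
    by apply/funext => x; rewrite hH// nrm2Z mulrA.
  congr Rintegral; apply/funext => x; rewrite hH// nrm2Z !mulrA -exprMn mulVf ?gt_eqF//.
  by rewrite expr1n mul1r.
have CE := Cc_Euler cH.
have [C C0 CP] := theta2_quotient.
have Cc1 : Cc (fun x => cutoff 1 x * H x).
  by apply: CcM => //; exact: cutoff_Cc.
pose D := C * \int[lambda]_x (cutoff 1 x * H x).
pose N := (n + j)%N.
have key h : 0 < h <= 1 -> `|(((1 + h)^-1 ^+ N * A) - A) - h * E| <= h ^+ 2 * D.
  move=> h01; have /andP[h0 h1] := h01.
  have s0 : 0 < 1 + h by rewrite addr_gt0.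
  rewrite -(scal _ s0) -(poslinB pI)//; last exact: C2 (exprn_gt0 2 s0).
  rewrite -(poslinZ pI)// /D mulrA.
  apply: (poslin_dist pI) => //.
  - by apply: CcB => //; exact: C2 (exprn_gt0 2 s0).
  - exact: CcZ.
  move=> x.
  have -> : H x * theta 2 ((1 + h) ^+ 2 * nrm2 x) - H x * theta 2 (nrm2 x) -
     h * (H x * (2 * nrm2 x * dtheta (nrm2 x))) =
     H x * ((theta 2 ((1 + h) ^+ 2 * nrm2 x) - theta 2 (nrm2 x)) - h * (2 * nrm2 x * dtheta (nrm2 x))).
    by ring.
  rewrite normrM ger0_norm// [leRHS]mulrCA mulrA mulrC ler_wpM2r//.
  apply: (le_trans (CP _ _ h01 (nrm2_ge0 x))).
  rewrite mulrA [leLHS]mulrC ler_wpM2r ?(mulr_ge0 (sqr_ge0 h) C0)//.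
  have [x1|x1] := ltP (nrm2 x) 1; last exact: cutoff_ge0.
  rewrite cutoff1// -(@ler_pXn2r _ 2) ?nnegrE//.
  by rewrite expr1n (le_trans (norm_le_nrm2 x))// ltW.
(* g is the difference quotient of z^-N at 1, extended there by the derivative -N. *)
have [g [gE cg g1]] : exists g : R -> R, [/\ forall z, z^-1 ^+ N - 1 = g z * (z - 1),
   {for 1, continuous g} & g 1 = - N%:R].
  have dV : is_derive (1 : R) (1 : R) (fun z : R => z^-1) (-1).
    have dI := @is_derive_id R R 1 1.
    apply: DeriveDef; first by apply: derivableV.
    by rewrite deriveV// derive_val expr1n invr1 scaleN1r.
  have dX := @is_deriveX _ _ _ N (1 : R) (1 : R) _ dV.
  have /is_derive1_caratheodory[g [gE cg g1]] := dX.
  exists g; split => //.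
    by move=> z; rewrite -gE !exprfctE invr1 expr1n.
  by rewrite g1 /GRing.scale /= invr1 expr1n mulr1 mulrN1.
have cvg1 : (fun m : nat => A * g (1 + m.+1%:R^-1)) @ \oo --> A * g 1.
  apply: cvgM; first exact: cvg_cst.
  apply: (@cvg_comp _ _ _ (fun m : nat => 1 + m.+1%:R^-1) g _ (nbhs (1 : R))); last exact: cg.
  have c1 : 1 + m.+1%:R^-1 @[m --> \oo] --> (1 + 0 : R).
    by apply: cvgD; [exact: cvg_cst|exact: cvg_harmonic].
  by rewrite addr0 in c1.
(* By [key], A g(1 + h) is within h D of E, while continuity of g gives the limit -N A for the same
   sequence. *)
have cvg2 : (fun m : nat => A * g (1 + m.+1%:R^-1)) @ \oo --> E.
  apply/cvgrPdist_le => e e0.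
  have h1 : (fun m : nat => m.+1%:R^-1 * D) @ \oo --> (0 * D).
    by apply: cvgM; [exact: cvg_harmonic|exact: cvg_cst].
  rewrite mul0r in h1; move/cvgrPdist_le : h1 => /(_ e e0).
  apply: filterS => m; rewrite sub0r normrN => /(le_trans (ler_norm _)); apply: le_trans.
  set h := m.+1%:R^-1.
  have h0 : 0 < h by rewrite invr_gt0.
  have hh : 0 < h <= 1 by rewrite h0 /= invf_le1// ler1n.
  have := key h hh.
  have -> : (1 + h)^-1 ^+ N * A - A - h * E = h * (A * g (1 + h) - E).
    have -> : (1 + h)^-1 ^+ N * A - A = ((1 + h)^-1 ^+ N - 1) * A by ring.
    by rewrite gE; ring.
  by rewrite normrM gtr0_norm// expr2 -mulrA ler_pM2l// distrC.
by rewrite -(cvg_unique _ cvg1 cvg2)// g1 mulrC.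
Qed.

(** [bump_lap] is -2 times Euler's integrand minus 2 n [theta 2]. Euler's identity turns this into 2
    (n + j) - 2 n = 2 j: the dimension cancels and a positive degree gives a positive factor. *)
Lemma homogeneous_bump_lap j H : continuous H -> homogeneous j H -> (forall x, 0 <= H x) ->
  \int[lambda]_x (H x * @bump_lap R n (nrm2 x)) =
  2 * j%:R * \int[lambda]_x (H x * theta 2 (nrm2 x)).
Proof.
move=> cH hH H0.
have pI := poslin_Rintegral (@radon_lebesgue_rV R n).
have C21 : Cc (fun x => H x * theta 2 (nrm2 x)).
  have := Cc_bumpM (H := H) 2 (@ltr01 R) cH; congr Cc.
  by apply/funext => x; rewrite /bump mul1r.
have CE := Cc_Euler cH.
transitivity (\int[lambda]_x (- 2 * (H x * (2 * nrm2 x * dtheta (nrm2 x))) +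
    - 2 * n%:R * (H x * theta 2 (nrm2 x)))).
  by congr Rintegral; apply/funext => x; rewrite /bump_lap; ring.
rewrite (poslinD pI); [|exact: CcZ|exact: CcZ].
rewrite (poslinZ pI)// (poslinZ pI)// (homogeneous_Euler cH hH H0) natrD; ring.
Qed.

End homogeneous_functions.

(** * Growth of polynomial harmonic measures *)

Section polynomial_growth.
Context {R : realType} {n : nat}.
Local Notation point := 'rV[R]_n.
Local Notation lambda := (lebesgue_measure_rV (R := R) n).
Local Notation measureRV := {measure set (borelRV R n) -> \bar R}.
Implicit Types (p : mpoly.mpoly n R) (nu : measureRV).

Lemma poly_funE p (x : point) : poly_fun p x =
  \sum_(m <- mpoly.msupp p) mpoly.mcoeff m p * \prod_i x 0 i ^+ m i.
Proof. exact: mpoly.mevalE. Qed.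

Lemma continuous_poly_fun p : continuous (poly_fun p).
Proof.
have : Ck 0 setT (poly_fun p).
  rewrite (_ : poly_fun p = fun x => \sum_(m <- mpoly.msupp p)
    mpoly.mcoeff m p * \prod_(i <- index_enum 'I_n) x 0 i ^+ m i); last first.
    by apply/funext => x; exact: poly_funE.
  elim: (mpoly.msupp p : seq _) => [|m s IH].
    rewrite (_ : (fun _ => _) = fun=> 0); first exact: Ck_cst.
    by apply/funext => x; rewrite big_nil.
  rewrite (_ : (fun _ => _) = fun x : point =>
     mpoly.mcoeff m p * \prod_(i <- index_enum 'I_n) x 0 i ^+ m i +
     \sum_(m <- s) mpoly.mcoeff m p * \prod_(i <- index_enum 'I_n) x 0 i ^+ m i); last first.
    by apply/funext => x; rewrite big_cons.
  apply: (Ck_add _ IH); apply: (Ck_mul (Ck_cst 0 _)).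
  elim: (index_enum _) => [|i r IHr].
    rewrite (_ : (fun _ => _) = fun=> 1); first exact: Ck_cst.
    by apply/funext => x; rewrite big_nil.
  rewrite (_ : (fun _ => _) = fun x : point => x 0 i ^+ m i * \prod_(i <- r) x 0 i ^+ m i);
    last by apply/funext => x; rewrite big_cons.
  apply: (Ck_mul _ IHr).
  elim: (m i) => [|k IHk].
    rewrite (_ : (fun _ => _) = fun=> 1); first exact: Ck_cst.
    by apply/funext => x; rewrite expr0.
  rewrite (_ : (fun _ => _) = fun x : point => x 0 i * x 0 i ^+ k); last first.
    by apply/funext => x; rewrite exprS.
  exact: (Ck_mul (Ck_coord 0 i) IHk).
exact: Ck_continuous.
Qed.

Definition hcomp p (i : nat) : point -> R := poly_fun (mpoly.pihomog mpoly.mdeg i p).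

Lemma hcompZ p i s x : hcomp p i (s *: x) = s ^+ i * hcomp p i x.
Proof.
rewrite /hcomp !poly_funE mulr_sumr; apply: eq_big_seq => m mp.
have mi : mpoly.mdeg m = i.
  by have /mpoly.dhomogP /(_ m mp) := mpoly.pihomogP mpoly.mdeg i p.
rewrite mulrCA; congr (_ * _); rewrite -mi mpoly.mdegE expr_sum -big_split /=.
by apply: eq_bigr => k _; rewrite mxE exprMn.
Qed.

Lemma poly_fun_hcomp p k x : (mpoly.msize p <= k)%N ->
  poly_fun p x = \sum_(i < k) hcomp p i x.
Proof.
move=> pk; rewrite {1}(mpoly.pihomog_partitionE pk) /poly_fun.
exact: raddf_sum.
Qed.

(** Homogeneity of degree 0 forces a constant, and evaluation at 0 identifies it with p(0). *)
Lemma hcomp0 p x : poly_fun p 0 = 0 -> hcomp p 0 x = 0.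
Proof.
move=> p0; have h0 y : hcomp p 0 y = hcomp p 0 0.
  by rewrite -(scale0r y) hcompZ expr0 mul1r.
rewrite h0 -p0 (@poly_fun_hcomp _ (mpoly.msize p).+1)// big_ord_recl /= big1 ?addr0// => i _.
by rewrite -[X in hcomp _ _ X](scale0r (0 : point)) hcompZ /= exprS !mul0r.
Qed.

Lemma continuous_hcomp p i : continuous (hcomp p i).
Proof. exact: continuous_poly_fun. Qed.

Definition bump_integral nu (s : R) : R := \int[nu]_x bump 0 (s^-1 ^+ 2) x.

Let B (y : point) : R := @bump_lap R n (nrm2 y).

Lemma Cc_bump_lap (H : point -> R) : continuous H -> Cc (fun x => H x * B x).
Proof.
move=> cH.
have C1 := CcZ (- 2) (Cc_Euler cH).
have C2 := CcZ (- 2 * n%:R) (Cc_bumpM 2 (@ltr01 R) cH).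
have := CcD C1 C2; congr Cc; apply/funext => x.
by rewrite /B /bump_lap /bump mul1r; ring.
Qed.

Lemma continuous_max0 (H : point -> R) : continuous H -> continuous (fun x => Num.max (H x) 0).
Proof. by move=> cH; apply: continuous_maxr => //; exact: cst_continuous. Qed.

(** Stated for a single sign, so that it serves h and -h alike. Substituting x = s y produces s^n
    from the volume and s^-2 from the Laplacian. *)
Lemma bump_integralE (h : point -> R) nu s : radon nu -> continuous h -> 0 < s ->
  (forall phi, Cc_infty phi ->
     (\int[nu]_x (phi x)%:E =
       \int[lambda]_(x in [set x | (0 < Num.max (h x) 0)%R])
         (Num.max (h x) 0 * laplacian phi x)%:E)%E) ->
  s ^+ 2 * bump_integral nu s =
    s ^+ n * \int[lambda]_x (Num.max (h (s *: (x : point))) 0 * B x).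
Proof.
move=> rnu ch s0 H; set a := s^-1 ^+ 2.
have a0 : 0 < a by rewrite exprn_gt0// invr_gt0.
have chs : continuous (fun x : point => h (s *: x)).
  by move=> x; exact: (continuous_comp (@scaler_continuous _ _ s x) (ch _)).
pose F (y : point) := Num.max (h (s *: y)) 0 * B y.
have CF : Cc F by exact: Cc_bump_lap (continuous_max0 chs).
have rl := @radon_lebesgue_rV R n.
have lapE x : Num.max (h x) 0 * laplacian (bump 0 a) x = a * F (s^-1 *: x).
  rewrite laplacian_bump mulrCA /F scalerA divff ?gt_eqF// scale1r.
  by rewrite /B nrm2Z.
have CFs : Cc (fun x : point => a * F (s^-1 *: x)).
  apply: CcZ; have [L L0 F0] := Cc_bounded_supp CF.
  apply: (@Cc_of_bounded_supp _ _ _ (L * s)) => [x|x xL].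
    exact: (continuous_comp (@scaler_continuous _ _ s^-1 x) (proj1 CF _)).
  by apply: F0; rewrite normrZ gtr0_norm ?invr_gt0// mulrC ltr_pdivlMr.
have : bump_integral nu s = \int[lambda]_x (a * F (s^-1 *: (x : point))).
  apply: EFin_inj; rewrite /bump_integral -!Rintegral_EFin//; last exact: bump_Cc.
  rewrite H; last exact: bump_Cc_infty.
  rewrite integral_mkcond; apply: eq_integral => x _.
  rewrite patchE; case: ifPn => [_|]; first by rewrite lapE.
  rewrite notin_setE /= => /negP; rewrite -leNgt => hx; rewrite -lapE.
  suff -> : Num.max (h x) 0 = 0 by rewrite mul0r.
  by apply/le_anti; rewrite hx le_max lexx orbT.
move=> ->.
rewrite (poslinZ (poslin_Rintegral rl) a (f := fun x => F (s^-1 *: x))); last first.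
  have := CcZ a^-1 CFs; congr Cc; apply/funext => x.
  by rewrite mulrA mulVf ?gt_eqF// mul1r.
rewrite Rintegral_lebesgue_rV_scale ?invr_gt0// invrK !mulrA; congr (_ * _).
by rewrite -[RHS]mul1r; congr (_ * _); rewrite expr2 mulfK ?gt_eqF// divff ?gt_eqF.
Qed.

(* normalized so that it is constant in s when nu comes from a homogeneous
   polynomial of degree j *)
Definition growth nu (j : nat) (s : R) : R := s ^+ 2 * bump_integral nu s / s ^+ (n + j).

Lemma max0_dist (u v : R) : `|Num.max u 0 - Num.max v 0| <= `|u - v|.
Proof.
case: (leP u 0) => u0; case: (leP v 0) => v0.
- by rewrite subrr normr0.
- by rewrite sub0r normrN gtr0_norm// ler_normr; apply/orP; right; lra.
- by rewrite subr0 gtr0_norm// ler_normr; apply/orP; left; lra.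
- by [].
Qed.

(** Since u -> max(u, 0) is 1-Lipschitz, replacing the rescaled polynomial by its degree j part
    costs at most the other parts, weighted by s^(i-j). The sign c selects h^+ or h^-. *)
Lemma growth_dist1 p nu k j (h : point -> R) (c : R) s : radon nu ->
  (mpoly.msize p <= k)%N -> (j < k)%N -> h = (fun x => c * poly_fun p x) -> `|c| = 1 -> 0 < s ->
  (forall phi, Cc_infty phi ->
     (\int[nu]_x (phi x)%:E =
       \int[lambda]_(x in [set x | (0 < Num.max (h x) 0)%R])
         (Num.max (h x) 0 * laplacian phi x)%:E)%E) ->
  `|growth nu j s - \int[lambda]_x (Num.max (c * hcomp p j x) 0 * B x)| <=
  \sum_(i < k) ((i != j :> nat)%:R * (s ^+ i / s ^+ j)) * \int[lambda]_x (`|hcomp p i x| * `|B x|).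
Proof.
move=> rnu pk jk hE c1 s0 H.
have pI := poslin_Rintegral (@radon_lebesgue_rV R n).
have ch : continuous h.
  by rewrite hE => x; exact: (cvgM (cvg_cst _) (@continuous_poly_fun p x)).
have chs : continuous (fun x : point => h (s *: x)).
  by move=> x; exact: (continuous_comp (@scaler_continuous _ _ s x) (ch _)).
have cj : continuous (fun x => c * hcomp p j x).
  by move=> x; exact: (cvgM (cvg_cst _) (@continuous_hcomp p j x)).
have CF := Cc_bump_lap (continuous_max0 chs).
have CJ := Cc_bump_lap (continuous_max0 cj).
have Ci i : Cc (fun x => `|hcomp p i x| * `|B x|).
  have := Cc_comp (k := Num.norm) (Cc_bump_lap (@continuous_hcomp p i))
    (@norm_continuous _ _) (@normr0 _ _).
  by congr Cc; apply/funext => x; rewrite normrM.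
have sn (m : nat) : s ^+ m != 0 by rewrite expf_neq0// gt_eqF.
have -> : growth nu j s = \int[lambda]_x ((s ^+ j)^-1 *
    (Num.max (h (s *: (x : point))) 0 * B x)).
  rewrite (poslinZ pI)// /growth (bump_integralE rnu ch s0 H) exprD.
  by field; rewrite !sn.
have : forall x, `|(s ^+ j)^-1 * (Num.max (h (s *: x)) 0 * B x) -
     Num.max (c * hcomp p j x) 0 * B x| <=
   1 * (\sum_(i < k) ((i != j :> nat)%:R * (s ^+ i / s ^+ j)) * (`|hcomp p i x| * `|B x|)).
  move=> x; rewrite mul1r mulrA -mulrBl normrM.
  have -> : \sum_(i < k) ((i != j :> nat)%:R * (s ^+ i / s ^+ j)) * (`|hcomp p i x| * `|B x|) =
      (\sum_(i < k) ((i != j :> nat)%:R * (s ^+ i / s ^+ j)) * `|hcomp p i x|) * `|B x|.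
    by rewrite mulr_suml; apply: eq_bigr => i _; rewrite !mulrA.
  rewrite ler_wpM2r//.
  have -> : (s ^+ j)^-1 * Num.max (h (s *: x)) 0 = Num.max ((s ^+ j)^-1 * h (s *: x)) 0.
    by rewrite maxr_pMr ?mulr0// invr_ge0 exprn_ge0// ltW.
  apply: (@le_trans _ _ `|(s ^+ j)^-1 * h (s *: x) - c * hcomp p j x|).
    exact: max0_dist.
  have -> : (s ^+ j)^-1 * h (s *: x) - c * hcomp p j x =
     c * \sum_(i < k) ((i != j :> nat)%:R * (s ^+ i / s ^+ j)) * hcomp p i x.
    rewrite hE (poly_fun_hcomp _ pk) mulrCA -mulrBr; congr (_ * _).
    rewrite (bigD1 (Ordinal jk))//= [in RHS](bigD1 (Ordinal jk))//= eqxx !mul0r add0r.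
    rewrite hcompZ mulrDr mulrA mulVf// mul1r addrAC subrr add0r mulr_sumr.
    apply: eq_bigr => i ij; rewrite hcompZ.
    have -> : (i != j :> nat) by apply: contraNneq ij => ij; apply/eqP/val_inj.
    by rewrite mul1r; ring.
  rewrite normrM c1 mul1r; apply: (le_trans (ler_norm_sum _ _ _)).
  apply: ler_sum => i _; rewrite normrM ger0_norm//.
  by rewrite mulr_ge0// divr_ge0// exprn_ge0// ltW.
move=> /(poslin_dist pI) h1; apply: (le_trans (h1 _ _ _)) => //.
- exact: CcZ.
- by apply: Cc_sum => i; exact: CcZ.
rewrite mul1r (poslin_sum pI); last by move=> i; exact: CcZ.
by apply: ler_sum => i _; rewrite (poslinZ pI).
Qed.

Lemma homogeneous_max0 p j c : homogeneous j (fun x => Num.max (c * hcomp p j x) 0).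
Proof.
move=> s x s0; rewrite hcompZ mulrCA -[in LHS](mulr0 (s ^+ j)) -maxr_pMr//.
by rewrite exprn_ge0// ltW.
Qed.

Lemma homogeneous_part_gt0 p j c x0 : (0 < j)%N -> 0 < c * hcomp p j x0 ->
  0 < \int[lambda]_x (Num.max (c * hcomp p j x) 0 * B x).
Proof.
move=> j0 hx0; set H := fun x => Num.max (c * hcomp p j x) 0.
have cH : continuous H.
  by apply: continuous_max0 => x; exact: (cvgM (cvg_cst _) (@continuous_hcomp p j x)).
have H0 x : 0 <= H x by rewrite /H le_max lexx orbT.
have hH : homogeneous j H by exact: homogeneous_max0.
rewrite (homogeneous_bump_lap cH hH H0) !mulr_gt0 ?ltr0n//.
(* Moves x0 into the open unit ball, where [theta 2] is positive, keeping H positive there by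
   homogeneity. *)
pose t := (nrm2 x0 + 1)^-1.
have n0 := nrm2_ge0 x0.
have t0 : 0 < t by rewrite invr_gt0 ltr_wpDl.
apply: (@Rintegral_gt0 _ _ _ _ (t *: x0)).
- exact: radon_lebesgue_rV.
- exact: spt_lebesgue_rV.
- have := Cc_bumpM (H := H) 2 (@ltr01 R) cH; congr Cc.
  by apply/funext => x; rewrite /bump mul1r.
- by move=> y; rewrite mulr_ge0// theta_ge0.
rewrite mulr_gt0//; first by rewrite hH// mulr_gt0 ?exprn_gt0// /H lt_max hx0.
apply: theta_gt0; rewrite nrm2Z /t exprVn mulrC ltr_pdivrMr ?exprn_gt0 ?ltr_wpDl// mul1r.
by rewrite expr2; nra.
Qed.

(** The polynomial is a parameter because degrees are read off p rather than off nu. *)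
Definition pharmonic d p nu :=
  [/\ radon nu, (mpoly.msize p <= d.+1)%N, poly_fun p 0 = 0 &
      is_polynomial_harmonic_measure (poly_fun p) nu].

(** Cp and Cm come from h^+ and h^-; the sign of the degree j part at a point where it is nonzero
    tells which of them is positive. The tolerance e only has to absorb components that really
    occur. *)
Lemma growth_dist d p nu j : pharmonic d p nu -> (0 < j <= d)%N ->
  (exists x, hcomp p j x != 0) ->
  exists Cp Cm M : R, [/\ 0 < Cp \/ 0 < Cm, 0 <= M &
    forall s e : R, 0 < s -> 0 <= e ->
      (forall i : nat, i != j -> (exists x, hcomp p i x != 0) -> s ^+ i / s ^+ j <= e) ->
      `|growth nu j s - Cp| <= e * M /\ `|growth nu j s - Cm| <= e * M].
Proof.
move=> [rnu pd p0 [_ _ H]] /andP[j0 jd] [x0 hx0].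
have rl := @radon_lebesgue_rV R n.
pose Mi i := \int[lambda]_x (`|hcomp p i x| * `|B x|).
have Mi0 i : 0 <= Mi i by apply: Rintegral_ge0 => x _; exact: mulr_ge0.
exists (\int[lambda]_x (Num.max (1 * hcomp p j x) 0 * B x)),
  (\int[lambda]_x (Num.max (- 1 * hcomp p j x) 0 * B x)), (\sum_(i < d.+1) Mi i).
split.
- have [h|h|h] := ltgtP (hcomp p j x0) 0.
  + by right; apply: (homogeneous_part_gt0 (x0 := x0)) => //; rewrite mulN1r oppr_gt0.
  + by left; apply: (homogeneous_part_gt0 (x0 := x0)) => //; rewrite mul1r.
  + by rewrite h eqxx in hx0.
- by apply: sumr_ge0.
move=> s e s0 e0 He.
have bound : \sum_(i < d.+1) ((i != j :> nat)%:R * (s ^+ i / s ^+ j)) * Mi i <=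
    e * \sum_(i < d.+1) Mi i.
  rewrite mulr_sumr; apply: ler_sum => i _.
  have [ij|ij] := eqVneq (i : nat) j; first by rewrite mul0r mul0r mulr_ge0.
  rewrite mul1r; have [hi|nhi] := pselect (exists x, hcomp p i x != 0).
    by rewrite ler_wpM2r// He.
  suff -> : Mi i = 0 by rewrite !mulr0.
  rewrite -(poslin0 (poslin_Rintegral rl)); congr Rintegral; apply/funext => x.
  suff -> : hcomp p i x = 0 by rewrite normr0 mul0r.
  by apply: contrapT => /eqP hi; apply: nhi; exists x.
split; apply: le_trans bound.
  apply: (growth_dist1 (h := poly_fun p) rnu pd) => //; last by move=> phi /H[].
    by apply/funext => x; rewrite mul1r.
  exact: normr1.
apply: (growth_dist1 (h := fun x => - poly_fun p x) rnu pd) => //; last by move=> phi /H[].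
  by apply/funext => x; rewrite mulN1r.
exact: normrN1.
Qed.

Lemma growth_cvg d p nu j (s e : nat -> R) : pharmonic d p nu -> (0 < j <= d)%N ->
  (exists x, hcomp p j x != 0) ->
  (forall l, 0 < s l) -> (forall l, 0 <= e l) -> e @ \oo --> (0 : R) ->
  (forall l (i : nat), i != j -> (exists x, hcomp p i x != 0) -> s l ^+ i / s l ^+ j <= e l) ->
  exists2 C : R, 0 < C & growth nu j (s l) @[l --> \oo] --> C.
Proof.
move=> ph j0 hj s0 e0 e_cvg He.
have [Cp [Cm [M [Cpm M0 H]]]] := growth_dist ph j0 hj.
have eM : e l * M @[l --> \oo] --> 0 * M by apply: cvgM => //; exact: cvg_cst.
rewrite mul0r in eM.
have cvg C : (forall l, `|growth nu j (s l) - C| <= e l * M) ->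
    growth nu j (s l) @[l --> \oo] --> C.
  move=> HC; apply/cvgrPdist_le => eps eps0.
  move/cvgrPdist_le : eM => /(_ _ eps0); apply: filterS => l.
  rewrite sub0r normrN => /(le_trans (ler_norm _)); apply: le_trans.
  by rewrite distrC.
have cp : growth nu j (s l) @[l --> \oo] --> Cp.
  by apply: cvg => l; have [] := H (s l) (e l) (s0 l) (e0 l) (He l).
have cm : growth nu j (s l) @[l --> \oo] --> Cm.
  by apply: cvg => l; have [] := H (s l) (e l) (s0 l) (e0 l) (He l).
by case: Cpm => [C0|C0]; [exists Cp|exists Cm].
Qed.

Lemma cvg_half_pow : (2^-1 : R) ^+ l @[l --> \oo] --> (0 : R).
Proof. by apply: cvg_expr; rewrite ger0_norm ?invr_ge0// invf_lt1// ltr1n. Qed.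

Lemma growth_at0 d p nu j : pharmonic d p nu -> (0 < j <= d)%N ->
  (exists x, hcomp p j x != 0) -> (forall i x, (i < j)%N -> hcomp p i x = 0) ->
  exists2 C : R, 0 < C & growth nu j (2^-1 ^+ l) @[l --> \oo] --> C.
Proof.
move=> ph j0 hj hi; apply: (growth_cvg (e := fun l => 2^-1 ^+ l) ph j0 hj).
- by move=> l; rewrite exprn_gt0.
- by move=> l; rewrite exprn_ge0.
- exact: cvg_half_pow.
move=> l i ij [x hx]; have ji : (j < i)%N.
  by rewrite ltnNge leq_eqVlt (negbTE ij) /=; apply/negP => /(hi i x) h; rewrite h eqxx in hx.
have s0 : 0 < (2^-1 : R) ^+ l by rewrite exprn_gt0.
rewrite -(subnK ji) addnS exprS exprD mulrA mulrK; last by rewrite unitfE expf_neq0// gt_eqF.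
apply: ler_piMr; first exact: ltW.
by rewrite !exprn_ile1 ?exprn_ge0 ?invr_ge0 ?invf_le1 ?ler1n.
Qed.

Lemma growth_at_infty d p nu j : pharmonic d p nu -> (0 < j <= d)%N ->
  (exists x, hcomp p j x != 0) -> (forall i x, (j < i)%N -> hcomp p i x = 0) ->
  exists2 C : R, 0 < C & growth nu j (2 ^+ l) @[l --> \oo] --> C.
Proof.
move=> ph j0 hj hi; apply: (growth_cvg (e := fun l => 2^-1 ^+ l) ph j0 hj).
- by move=> l; rewrite exprn_gt0.
- by move=> l; rewrite exprn_ge0.
- exact: cvg_half_pow.
move=> l i ij [x hx]; have ji : (i < j)%N.
  by rewrite ltnNge leq_eqVlt eq_sym (negbTE ij) /=; apply/negP => /(hi i x) h; rewrite h eqxx in hx.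
have s0 : 0 < (2 : R) ^+ l by rewrite exprn_gt0.
have s1 : 1 <= (2 : R) ^+ l by rewrite exprn_ege1 ?ler1n.
move: s0 s1; rewrite exprVn; set s := 2 ^+ l => s0 s1.
rewrite -(subnK ji) addnS -addSn exprD invfM mulrCA divff ?expf_neq0 ?gt_eqF// mulr1.
rewrite lef_pV2 ?posrE ?exprn_gt0// exprS; apply: ler_peMr; first exact: ltW.
exact: exprn_ege1.
Qed.

(** With no other component present, the tolerance e = 0 is allowed. *)
Lemma growth_homogeneous d p nu j : pharmonic d p nu -> (0 < j <= d)%N ->
  (exists x, hcomp p j x != 0) -> (forall (i : nat) x, i != j -> hcomp p i x = 0) ->
  exists C : R, forall s, 0 < s -> growth nu j s = C.
Proof.
move=> ph j0 hj hi; have [Cp [Cm [M [Cpm M0 H]]]] := growth_dist ph j0 hj.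
exists Cp => s s0; have [] := H s 0 s0 (lexx 0).
  by move=> i ij [x]; rewrite hi// eqxx.
by rewrite mul0r normr_le0 subr_eq0 => /eqP.
Qed.

End polynomial_growth.

(** * Blow-ups *)

Section dyadic.
Context {R : realType}.
Implicit Types (g : R -> R) (b rho : R).

Lemma le_cvgn (u v : nat -> R) (x y : R) : u @ \oo --> x -> v @ \oo --> y ->
  (\forall m \near \oo, u m <= v m) -> x <= y.
Proof.
move=> ux vy uv; rewrite -(cvg_lim _ ux)// -(cvg_lim _ vy)//.
by apply: ler_lim => //; apply/cvg_ex; [exists x|exists y].
Qed.

(** The least failing l exceeds k, so r = 2^-l rho has at least k + 1 good steps above it and a
    failure just below. *)
Lemma dyadic_first_failure g b :
  (forall k : nat, exists2 rho, 0 < rho <= k.+1%:R^-1 &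
    forall l, (l <= k)%N -> g (2^-1 ^+ l * rho) <= b * g (2^-1 ^+ l.+1 * rho)) ->
  (forall rho, 0 < rho -> exists l, b * g (2^-1 ^+ l.+1 * rho) < g (2^-1 ^+ l * rho)) ->
  forall k : nat, exists r, [/\ 0 < r <= k.+1%:R^-1,
    (forall a, (a <= k)%N -> g (2 ^+ a.+1 * r) <= b * g (2 ^+ a * r)) &
    b * g (2^-1 * r) < g r].
Proof.
move=> H1 H2 k; have [rho /andP[rho0 rhok] Hrho] := H1 k.
have [l lP lmin] := ex_minnP (H2 _ rho0).
have kl : (k < l)%N.
  by rewrite ltnNge; apply/negP => /Hrho; rewrite leNgt lP.
have E (a : nat) : (a <= l)%N -> 2 ^+ a * (2^-1 ^+ l * rho) = 2^-1 ^+ (l - a) * rho.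
  move=> al; rewrite -[in LHS](subnKC al) exprD mulrA mulrA -exprMn.
  by rewrite divff// expr1n mul1r.
exists (2^-1 ^+ l * rho); split.
- rewrite mulr_gt0 ?exprn_gt0//=; apply: le_trans rhok.
  apply: ler_piMl; first exact: ltW.
  by rewrite exprn_ile1 ?invr_ge0 ?invf_le1 ?ler1n.
- move=> a ak; have al := leq_ltn_trans ak kl.
  rewrite (E _ al) (E _ (ltnW al)).
  have -> : (l - a = (l - a.+1).+1)%N by rewrite subnSK.
  rewrite leNgt; apply/negP => /lmin; rewrite leqNgt => /negP; apply.
  by rewrite -[X in (_ < X)%N](subnK al) addnS ltnS leq_addr.
- by rewrite mulrA -exprS.
Qed.

(** Monotonicity carries the inequality from the grid 2^-l rho to arbitrary radii; rounding to the
    grid costs one extra factor b, hence the exponent [a.+1]. *)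
Lemma dyadic_doubling g b rho : 0 < rho -> 0 <= b ->
  (forall r s, 0 < r -> r <= s -> g r <= g s) ->
  (forall l : nat, g (2^-1 ^+ l * rho) <= b * g (2^-1 ^+ l.+1 * rho)) ->
  forall (a : nat) r, 0 < r -> 2 ^+ a.+1 * r < rho -> g (2 ^+ a * r) <= b ^+ a.+1 * g r.
Proof.
move=> rho0 b0 gm H a r r0 ar.
have iter (l k : nat) : g (2^-1 ^+ l * rho) <= b ^+ k * g (2^-1 ^+ (l + k) * rho).
  elim: k => [|k IH]; first by rewrite expr0 mul1r addn0.
  apply: (le_trans IH); rewrite exprSr -mulrA addnS ler_wpM2l ?exprn_ge0//.
have [l0 l0P] : exists l, 2^-1 ^+ l * rho <= r.
  have : 2^-1 ^+ l * rho @[l --> \oo] --> 0 * rho.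
    by apply: cvgM; [exact: cvg_half_pow|exact: cvg_cst].
  rewrite mul0r => /cvgr_le /(_ _ r0) [N _ /(_ N (leqnn N)) /= ?]; by exists N.
have [l lP lmin] := ex_minnP (ex_intro (fun l => 2^-1 ^+ l * rho <= r) l0 l0P).
have al : (a < l)%N.
  rewrite ltnNge; apply/negP => la; have : 2^-1 ^+ a * rho <= r.
    apply: le_trans lP; rewrite ler_wpM2r ?(ltW rho0)//.
    by apply: ler_wiXn2l => //; rewrite ?invr_ge0 ?invf_le1 ?ler1n.
  rewrite leNgt => /negP; apply.
  rewrite exprVn mulrC ltr_pdivlMr ?exprn_gt0//; apply: le_lt_trans ar.
  rewrite mulrC ler_wpM2r ?(ltW r0)//.
  by rewrite exprS ler_peMl ?exprn_ge0 ?ler1n.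
have rl : r < 2^-1 ^+ l.-1 * rho.
  rewrite ltNge; apply/negP => /lmin; rewrite leqNgt prednK ?leqnn//.
  exact: leq_ltn_trans al.
(* As 2^-l rho <= r < 2^-(l-1) rho, round 2^a r up to a grid point, then descend [a.+1] steps to a
   grid point below r. *)
apply: (@le_trans _ _ (g (2^-1 ^+ (l - a.+1) * rho))).
  apply: gm; first by rewrite mulr_gt0 ?exprn_gt0.
  apply: (@le_trans _ _ (2 ^+ a * (2^-1 ^+ l.-1 * rho))).
    by rewrite ler_pM2l ?exprn_gt0// ltW.
  have -> : l.-1 = (a + (l - a.+1))%N by rewrite -[in LHS](subnKC al) addSn.
  by rewrite exprD !mulrA -exprMn divff// expr1n mul1r.
apply: (le_trans (iter _ a.+1)); rewrite subnK//.
rewrite ler_wpM2l ?exprn_ge0//; apply: gm => //.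
by rewrite mulr_gt0 ?exprn_gt0.
Qed.

End dyadic.

(** * Degrees detected by the growth of bump integrals *)

Section degrees.
Context {R : realType} {n : nat}.
Local Notation point := 'rV[R]_n.
Local Notation measureRV := {measure set (borelRV R n) -> \bar R}.
Implicit Types (p : mpoly.mpoly n R) (nu : measureRV).

Lemma hcomp_msize p i x : (mpoly.msize p <= i)%N -> hcomp p i x = 0.
Proof.
move=> pi; have := poly_fun_hcomp x (leqW pi).
by rewrite (poly_fun_hcomp x pi) big_ord_recr /= -[LHS]addr0 => /addrI.
Qed.

(** Cross-multiplied so as to make sense for vanishing integrals; 2^(n+j)/4 is 2^(n-2+j) without
    truncated subtraction. *)
Lemma bump_integral_double nu j s : 0 < s ->
  bump_integral nu (2 * s) * growth nu j s =
  2 ^+ (n + j) / 4 * (bump_integral nu s * growth nu j (2 * s)).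
Proof.
move=> s0; rewrite /growth !exprMn.
have sn : s ^+ (n + j) != 0 by rewrite expf_neq0// gt_eqF.
have tn : (2 : R) ^+ (n + j) != 0 by rewrite expf_neq0// gt_eqF.
move: (2 ^+ (n + j)) (s ^+ (n + j)) (bump_integral nu s) (bump_integral nu (2 * s)) tn sn.
by move=> u v G G2 u0 v0; field; rewrite u0 v0.
Qed.

(** If the top degree k exceeded j, the growth normalized for k would tend to a positive limit along
    2^a, yet the hypothesis makes it decay geometrically. *)
Lemma growth_bound d p nu j (K : R) : pharmonic d p nu -> (0 < j)%N ->
  (forall a : nat, bump_integral nu (2 ^+ a) <= K * (3 / 2 * (2 ^+ (n + j) / 4)) ^+ a) ->
  forall i x, (j < i)%N -> hcomp p i x = 0.
Proof.
move=> ph j0 HK i x ji; apply/eqP/negPn/negP => hx.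
have hd m : (exists x, hcomp p m x != 0) -> (m <= d)%N.
  move=> [y hy]; rewrite leqNgt; apply/negP => dm.
  have [_ pd _ _] := ph.
  by rewrite (hcomp_msize _ (leq_trans pd dm)) eqxx in hy.
have ex : exists m, `[< exists x, hcomp p m x != 0 >] by exists i; apply/asboolP; exists x.
have [k /asboolP hk kmax] := ex_maxnP ex (fun m hm => hd m (asboolW hm)).
have jk : (j < k)%N.
  by apply: (leq_trans ji); apply: kmax; apply/asboolP; exists x.
have ktop m y : (k < m)%N -> hcomp p m y = 0.
  move=> km; apply/eqP/negPn/negP => hy.
  by move: km; rewrite ltnNge => /negP; apply; apply: kmax; apply/asboolP; exists y.
have [|C C0 Ccvg] := growth_at_infty ph _ hk ktop.
  by rewrite (ltn_trans j0 jk) hd.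
(* The ratio is (3/2) 2^(j-k), at most 3/4 as k > j; the absolute value covers a K of either
   sign. *)
have bnd a : growth nu k (2 ^+ a) <= `|K| * (3 / 4) ^+ a.
  have -> : growth nu k (2 ^+ a) = bump_integral nu (2 ^+ a) * (4 / 2 ^+ (n + k)) ^+ a.
    rewrite /growth exprMn exprVn -exprAC.
    have -> : (4 : R) = 2 ^+ 2 by rewrite expr2 -natrM.
    by rewrite (exprAC 2 a (n + k)) mulrA; congr (_ / _); exact: mulrC.
  have w0 : 0 <= (4 / 2 ^+ (n + k) : R) by rewrite divr_ge0// exprn_ge0.
  apply: (@le_trans _ _ (`|K| * (3 / 2 * (2 ^+ (n + j) / 4)) ^+ a * (4 / 2 ^+ (n + k)) ^+ a)).
    rewrite ler_wpM2r ?exprn_ge0//; apply: (le_trans (HK a)).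
    by rewrite ler_wpM2r ?ler_norm// exprn_ge0// !mulr_ge0 ?exprn_ge0 ?invr_ge0.
  rewrite -mulrA -exprMn ler_wpM2l// lerXn2r ?nnegrE//.
  rewrite -(subnKC jk) addnS addnA exprS !exprD.
  have t0 (m : nat) : (2 : R) ^+ m != 0 by rewrite expf_neq0// gt_eqF.
  have t1 : 1 <= (2 : R) ^+ (k - j.+1) by rewrite exprn_ege1 ?ler1n.
  have -> : 3 / 2 * (2 ^+ n * 2 ^+ j / 4) * (4 / (2 * (2 ^+ n * 2 ^+ j * 2 ^+ (k - j.+1)))) =
     3 / 4 / 2 ^+ (k - j.+1) :> R by field; rewrite !t0.
  by rewrite ler_pdivrMr ?(lt_le_trans _ t1)// ler_peMr.
have b0 : `|K| * (3 / 4) ^+ a @[a --> \oo] --> `|K| * (0 : R).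
  apply: cvgM; first exact: cvg_cst.
  by apply: cvg_expr; rewrite ger0_norm// ltr_pdivrMr// mul1r ltr_nat.
have : C <= `|K| * 0 by apply: (le_cvgn Ccvg b0); exact: nearW.
by rewrite mulr0 leNgt C0.
Qed.

Lemma bump_integral_small d p nu j : pharmonic d p nu -> (0 < j <= d)%N ->
  (exists x, hcomp p j x != 0) -> (forall i x, (i < j)%N -> hcomp p i x = 0) ->
  exists l0 : nat, forall l, (l0 <= l)%N ->
   bump_integral nu (2^-1 ^+ l) <
     3 / 2 * (2 ^+ (n + j) / 4) * bump_integral nu (2^-1 ^+ l.+1).
Proof.
move=> ph j0 hj hi; have [C C0 Ccvg] := growth_at0 ph j0 hj hi.
(* Two values within C/10 of C have a ratio below 11/9, hence below 3/2. *)
have C10 : 0 < C / 10 by rewrite divr_gt0.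
have [l0 _ Hl0] : \forall l \near \oo, `|C - growth nu j (2^-1 ^+ l)| < C / 10.
  by move/cvgrPdist_lt : Ccvg => /(_ _ C10).
exists l0 => l ll0.
have := Hl0 l ll0; have := Hl0 l.+1 (leqW ll0) => /=.
rewrite !ltr_distlC => /andP[a1 a2] /andP[b1 b2].
set s : R := 2^-1 ^+ l.+1 in a1 a2 *.
have s0 : 0 < s by rewrite exprn_gt0.
have s2 : 2^-1 ^+ l = 2 * s by rewrite /s exprS mulrA divff// mul1r.
rewrite s2 in b1 b2 *; have := bump_integral_double nu j s0.
set G1 := bump_integral _ _; set g1 := growth nu j s; set g2 := growth _ _ _ in b1 b2 *.
have gs : g1 = s ^+ 2 * bump_integral nu s / s ^+ (n + j) by [].
set G := bump_integral nu s in gs *.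
have g10 : 0 < g1 by rewrite -/g1 in a1 a2; lra.
have G0 : 0 < G.
  move: g10; rewrite gs pmulr_lgt0 ?invr_gt0 ?exprn_gt0//.
  by rewrite pmulr_rgt0 ?exprn_gt0.
set be := _ / 4 => E.
have be0 : 0 < be by rewrite divr_gt0// exprn_gt0.
rewrite -(ltr_pM2r g10) E -mulrA.
rewrite -/g1 in a1 a2; have beG : 0 < be * G by rewrite mulr_gt0.
have -> : be * (G * g2) = (be * G) * g2 by rewrite mulrA.
have -> : 3 / 2 * (be * G) * g1 = (be * G) * (3 / 2 * g1) by ring.
by rewrite ltr_pM2l//; lra.
Qed.

End degrees.

(** * Tangent measures as limits of rescaled integrals *)

Section tangent_measures.
Context {R : realType} {n : nat}.
Local Notation point := 'rV[R]_n.
Local Notation measureRV := {measure set (borelRV R n) -> \bar R}.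
Variables (omega : measureRV) (Q : point).
Hypotheses (romega : radon omega).

(** The integral against T_{Q,r}[omega], with the dilation moved onto the test function. *)
Definition blowup (r : R) (f : point -> R) : R :=
  \int[omega]_y f (r^-1 *: ((y : point) - Q)).

Lemma continuous_dilation a : continuous (fun y : point => a *: (y - Q)).
Proof.
have cQ : continuous (fun _ : point => Q) by exact: cst_continuous.
have cB : continuous (fun y : point => y - Q) by move=> y; exact: (cvgB cvg_id (cQ y)).
by move=> y; exact: (continuous_comp (cB y) (@scaler_continuous _ _ a (y - Q))).
Qed.

Lemma Cc_blowup r f : 0 < r -> Cc f -> Cc (fun y => f (r^-1 *: (y - Q))).
Proof.
move=> r0 Cf; have [L L0 f0] := Cc_bounded_supp Cf.
have cT := @continuous_dilation r^-1.
apply: (@Cc_of_bounded_supp _ _ _ (L * r + `|Q|)) => [y|y yL].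
  exact: (continuous_comp (cT y) (proj1 Cf _)).
apply: f0; rewrite normrZ gtr0_norm ?invr_gt0// mulrC ltr_pdivlMr//.
by have := lerB_dist y Q; lra.
Qed.

Lemma poslin_blowup r : 0 < r -> poslin (blowup r).
Proof.
move=> r0; have pI := poslin_Rintegral romega; split.
- by move=> f g Cf Cg; rewrite /blowup (poslinD pI)//; exact: Cc_blowup.
- by move=> a f Cf; rewrite /blowup (poslinZ pI)//; exact: Cc_blowup.
- by move=> f Cf f0; apply: (poslin_ge0 pI); first exact: Cc_blowup.
Qed.

(** [rescale] is a bare set function; it is recognized as the pushforward of omega under y -> (y -
    Q)/r. *)
Lemma integral_rescale r f : 0 < r -> Cc f ->
  (\int[rescale omega Q r]_y (f y)%:E = (blowup r f)%:E)%E.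
Proof.
move=> r0 Cf; pose T (y : borelRV R n) : borelRV R n := r^-1 *: ((y : point) - Q).
have cT : continuous (T : point -> point) by exact: continuous_dilation.
have mT : measurable_fun setT T.
  apply: (@measurability _ _ _ (borelRV R n) _ _ (@open 'rV[R]_n)) => // _ [U oU <-].
  by rewrite setTI; apply: sub_sigma_algebra; apply: open_comp => // y _; exact: cT.
have -> : rescale omega Q r = pushforward omega T.
  apply/funext => E; rewrite /rescale /pushforward; congr (omega _).
  apply/seteqP; split => [_ [y Ey <-]|y Ey] /=.
    by rewrite /T addrAC subrr add0r scalerA mulVf ?gt_eqF// scale1r.
  exists (T y) => //; rewrite /T scalerA divff ?gt_eqF// scale1r.
  by rewrite addrC subrK.
have C := Cc_blowup r0 Cf.
rewrite integral_pushforward//.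
- exact: Rintegral_EFin.
- by apply/measurable_EFinP; exact: continuous_measurable_rV (proj1 Cf).
- exact: Cc_integrable.
Qed.

Lemma Tan_blowup nu : Tan omega Q nu -> exists r c : nat -> R,
  [/\ (forall i, 0 < r i), r @ \oo --> (0 : R), (forall i, 0 < c i) &
      forall f, Cc f -> c i * blowup (r i) f @[i --> \oo] --> \int[nu]_x f x].
Proof.
move=> [_ rnu _ [r [c [r0 _ rc c0 H]]]]; exists r, c; split => // f Cf.
have := H f Cf; rewrite (Rintegral_EFin rnu Cf) => /fine_cvg.
apply: cvg_trans; apply: near_eq_cvg; apply: nearW => i /=.
by rewrite (integral_rescale _ Cf)// -EFinM.
Qed.

Lemma blowup_Tan nu (r c : nat -> R) : spt omega Q -> radon nu ->
  (exists f, Cc f /\ \int[nu]_x f x != 0) ->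
  (forall i, 0 < r i) -> nonincreasing_seq r -> r @ \oo --> (0 : R) ->
  (forall i, 0 < c i) ->
  (forall f, Cc f -> c i * blowup (r i) f @[i --> \oo] --> \int[nu]_x f x) ->
  Tan omega Q nu.
Proof.
move=> sQ rnu [f [Cf nuf]] r0 rn rc c0 H; split => //.
  apply: contra_neq nuf => nu0; rewrite /Rintegral null_set_integral//.
  by apply/measurable_EFinP; exact: continuous_measurable_rV (proj1 Cf).
exists r, c; split => // g Cg.
rewrite (Rintegral_EFin rnu Cg).
under eq_fun do rewrite (integral_rescale _ Cg)// -EFinM.
by apply: cvg_EFin; [exact: nearW|exact: H].
Qed.

(** The mass g(r) of omega at Q, smoothed by the bump of scale r. *)
Definition bump_mass (r : R) : R := blowup r (bump 0 1).

Lemma blowup_bump r s : blowup r (bump 0 (s^-1 ^+ 2)) = bump_mass (s * r).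
Proof.
rewrite /bump_mass /blowup; congr Rintegral; apply/funext => y.
by rewrite /bump !nrm2Z mul1r mulrA invfM exprMn.
Qed.

Lemma bump_mass_le r s : 0 < r -> r <= s -> bump_mass r <= bump_mass s.
Proof.
move=> r0 rs; have s0 := lt_le_trans r0 rs.
have C t : 0 < t -> Cc (fun y : point => bump 0 1 (t^-1 *: (y - Q))).
  by move=> t0; apply: (Cc_blowup t0); exact: bump_Cc.
apply: (poslin_le (poslin_Rintegral romega) (C _ r0) (C _ s0)) => y.
apply: theta0_le; rewrite !mul1r !nrm2Z ler_wpM2r ?nrm2_ge0//.
by rewrite lerXn2r ?nnegrE ?invr_ge0 ?(ltW r0) ?(ltW s0)// lef_pV2.
Qed.

Lemma bump_mass_gt0 r : spt omega Q -> 0 < r -> 0 < bump_mass r.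
Proof.
move=> sQ r0; apply: (Rintegral_gt0 romega sQ).
- by apply: (Cc_blowup r0); exact: bump_Cc.
- by move=> y; exact: theta_ge0.
- by apply: theta_gt0; rewrite subrr nrm2Z /nrm2 big1 ?mulr0 ?mul1r// => i _; rewrite mxE expr0n.
Qed.

Lemma Tan_bump nu : Tan omega Q nu -> exists r c : nat -> R,
  [/\ (forall i, 0 < r i), r @ \oo --> (0 : R), (forall i, 0 < c i) &
      forall s, 0 < s -> c i * bump_mass (s * r i) @[i --> \oo] --> bump_integral nu s].
Proof.
move=> /Tan_blowup[r [c [r0 rc c0 H]]]; exists r, c; split => // s s0.
under eq_fun do rewrite -blowup_bump.
by apply: H; apply: bump_Cc; rewrite exprn_gt0// invr_gt0.
Qed.

End tangent_measures.

(** * Tangent measures extracted at well-chosen scales *)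

Section compactness.
Context {R : realType} {n : nat}.
Local Notation point := 'rV[R]_n.
Local Notation measureRV := {measure set (borelRV R n) -> \bar R}.
Variables (omega : measureRV) (Q : point).
Hypotheses (romega : radon omega) (sQ : spt omega Q).

Local Notation mass := (bump_mass omega Q).

(** Bumps of scale 2^a dominate all of [Cc] up to constants, so bounds at dyadic scales suffice for
    weak compactness. *)
Lemma le_bump M f : Cc f -> (forall x : point, `|f x| <= M) ->
  exists a : nat, forall x, `|f x| <= M / theta 0 2^-1 * bump 0 ((2 ^+ a)^-1 ^+ 2) x.
Proof.
move=> Cf fM; have [L L0 f0] := Cc_bounded_supp Cf.
have M0 : 0 <= M by apply: le_trans (fM 0).
have t0 : 0 < theta 0 (2^-1 : R) by apply: theta_gt0; rewrite invf_lt1// ltr1n.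
(* On the support of f this makes |x|^2 / 4^a at most 1/2; the factor n passes from the sup norm to
   the Euclidean one. *)
have [a aP] : exists a : nat, n%:R * L ^+ 2 * 2 <= 2 ^+ a.
  set x := n%:R * L ^+ 2 * 2; have x0 : 0 <= x by rewrite mulr_ge0// mulr_ge0// sqr_ge0.
  have x1 : 0 < (x + 1)^-1 by rewrite invr_gt0 ltr_wpDl.
  have [a _ /(_ a (leqnn a)) /= ha] := cvgr_le _ (@cvg_half_pow R) _ x1.
  exists a; move: ha; rewrite exprVn lef_pV2 ?posrE ?exprn_gt0 ?ltr_wpDl//.
  by apply: le_trans; rewrite lerDl.
exists a => x; have [xL|Lx] := leP `|x| L; last first.
  by rewrite f0// normr0 mulr_ge0 ?theta_ge0// divr_ge0 ?theta_ge0.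
apply: (le_trans (fM x)); rewrite -mulrA ler_peMr// mulrC ler_pdivlMr// mul1r.
apply: theta0_le; rewrite exprVn mulrC ler_pdivrMr ?exprn_gt0//.
apply: (le_trans (nrm2_le_norm x)).
apply: (@le_trans _ _ (n%:R * L ^+ 2)).
  by rewrite ler_wpM2l// lerXn2r ?nnegrE ?(ltW L0).
have a1 : 1 <= (2 : R) ^+ a by rewrite exprn_ege1 ?ler1n.
by rewrite [leRHS]mulrC ler_pdivlMr// (le_trans aP)// expr2 ler_peMr// (le_trans _ a1).
Qed.

(** Dividing by the mass at r_k makes the good steps bound the bump of scale 2^a by b^a for all
    large k. All three conclusions on bump integrals are limits of relations between masses. *)
Lemma blowup_limit (b : R) (r : nat -> R) : 0 <= b ->
  (forall k, 0 < r k <= k.+1%:R^-1) ->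
  (forall k a, (a <= k)%N -> mass (2 ^+ a.+1 * r k) <= b * mass (2 ^+ a * r k)) ->
  (forall k, b * mass (2^-1 * r k) < mass (r k)) ->
  exists nu, [/\ Tan omega Q nu,
    (forall a, bump_integral nu (2 ^+ a) <= b ^+ a) &
    bump_integral nu 1 = 1 /\ b * bump_integral nu 2^-1 <= 1].
Proof.
move=> b0 rk up down; have r0 k : 0 < r k by have /andP[] := rk k.
have m0 k : 0 < mass (r k) by exact: bump_mass_gt0.
pose Lam k f := (mass (r k))^-1 * blowup omega Q (r k) f.
have pLam k : poslin (Lam k).
  have pb := poslin_blowup Q romega (r0 k); split.
  - by move=> f g Cf Cg; rewrite /Lam (poslinD pb)// mulrDr.
  - by move=> a f Cf; rewrite /Lam (poslinZ pb)// mulrCA.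
  - by move=> f Cf f0; rewrite mulr_ge0 ?invr_ge0 ?(ltW (m0 k))// (poslin_ge0 pb).
have LamE k s : Lam k (bump 0 (s^-1 ^+ 2)) = mass (s * r k) / mass (r k).
  by rewrite /Lam blowup_bump mulrC.
have upk k a : (a <= k.+1)%N -> mass (2 ^+ a * r k) / mass (r k) <= b ^+ a.
  rewrite ler_pdivrMr//; elim: a => [|a IH]; first by rewrite !expr0 !mul1r.
  move=> ak; apply: (le_trans (up k a ak)); rewrite exprS -mulrA ler_wpM2l//.
  exact: IH (ltnW ak).
have rcvg : r @ \oo --> (0 : R).
  apply/cvgrPdist_lt => e e0; near=> k; rewrite sub0r normrN gtr0_norm//.
  have /andP[_ /le_lt_trans] := rk k; apply.
  by near: k; exact: (near_infty_natSinv_lt (PosNum e0)).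
have bnd f : Cc f -> exists C, \forall k \near \oo, `|Lam k f| <= C.
  move=> Cf; have [M M0 fM] := Cc_bounded Cf.
  have [a ha] := le_bump Cf fM.
  set C := M / _ in ha; have C0 : 0 <= C by rewrite divr_ge0 ?theta_ge0// ltW.
  exists (C * b ^+ a); near=> k.
  have Ca : Cc (bump 0 ((2 ^+ a)^-1 ^+ 2) : point -> R).
    by apply: bump_Cc; rewrite exprn_gt0// invr_gt0 exprn_gt0.
  have := poslin_dist (pLam k) (f := f) (g := fun=> 0) (e := C) Cf (@Cc0 _ _) Ca.
  rewrite (poslin0 (pLam k)) subr0 => /(_ _)/le_trans; apply.
    by move=> x; rewrite subr0.
  rewrite ler_wpM2l// LamE; apply: upk.
  by apply: leqW; near: k; exact: nbhs_infty_ge.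
have [e [nu [rnu noninc ecvg em H]]] := weak_compactness pLam bnd r0 rcvg.
have HG s : 0 < s ->
    mass (s * r (e m)) / mass (r (e m)) @[m --> \oo] --> bump_integral nu s.
  move=> s0; under eq_fun do rewrite -LamE.
  by apply: H; apply: bump_Cc; rewrite exprn_gt0// invr_gt0.
(* The normalization survives in the limit, which also shows that nu is non-zero. *)
have G1 : bump_integral nu 1 = 1.
  have h : mass (1 * r (e m)) / mass (r (e m)) @[m --> \oo] --> (1 : R).
    under eq_fun => m do rewrite mul1r divff ?gt_eqF//.
    exact: cvg_cst.
  exact: (cvg_unique _ (HG _ ltr01) h).
exists nu; split.
- apply: (@blowup_Tan _ _ omega Q romega nu (r \o e) (fun m => (mass (r (e m)))^-1)) => //.
  + exists (bump 0 (1^-1 ^+ 2)); split; last by rewrite [X in X != _]G1 oner_eq0.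
    by apply: bump_Cc; rewrite exprn_gt0// invr_gt0.
  + by move=> i; exact: r0.
  + by move=> i; rewrite invr_gt0.
- move=> a; apply: (le_cvgn (HG _ (exprn_gt0 a (ltr0n R 2))) (cvg_cst (b ^+ a))).
  near=> m; apply: upk; apply: leqW; apply: (leq_trans _ (em m)).
  by near: m; exact: nbhs_infty_ge.
split => //.
have key (x y : R) : 0 < x -> b * y < x -> b * (y / x) <= 1.
  by move=> x0 /ltW; rewrite mulrA ler_pdivrMr// mul1r.
have h2 : b * (mass (2^-1 * r (e m)) / mass (r (e m))) @[m --> \oo] -->
    b * bump_integral nu 2^-1.
  by apply: cvgM; [exact: cvg_cst|exact: HG].
apply: (le_cvgn h2 (cvg_cst (1 : R))); apply: nearW => m.
exact: key (m0 _) (down _).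
Unshelve. all: by end_near. Qed.

End compactness.

(** * Homogeneity of all tangent measures *)

Section homogeneity.
Context {R : realType} {n : nat}.
Local Notation point := 'rV[R]_n.
Local Notation measureRV := {measure set (borelRV R n) -> \bar R}.
Variables (omega : measureRV) (Q : point) (d : nat).
Hypotheses (romega : radon omega) (hTan : Tan omega Q `<=` Pset n d).

Local Notation mass := (bump_mass omega Q).

Definition tangent_degree (j : nat) : Prop :=
  exists nu p, [/\ Tan omega Q nu, pharmonic d p nu & exists x, hcomp p j x != 0].

Lemma Tan_pharmonic nu : Tan omega Q nu -> exists p j,
  [/\ pharmonic d p nu, Defs.harmonic setT (poly_fun p), (0 < j <= d)%N &
      exists x, hcomp p j x != 0].
Proof.
move=> /hTan[p [[x px] hp pd p0 H]].
have ph : pharmonic d p nu by split => //; case: H.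
have [j hj] : exists j : 'I_d.+1, hcomp p j x != 0.
  apply: contrapT => /forallNP h; move: px; rewrite (poly_fun_hcomp x pd) big1 ?eqxx// => i _.
  by have /negP/negPn/eqP := h i.
exists p, j; split => //; last by exists x.
have := ltn_ord j; rewrite ltnS => ->; rewrite andbT lt0n; apply: contra_neq hj => ->.
exact: hcomp0.
Qed.

Lemma tangent_degree_bounds j : tangent_degree j -> (0 < j <= d)%N.
Proof.
move=> [nu [p [Tnu [_ pd p0 _] [x hx]]]].
rewrite lt0n; apply/andP; split; first by apply: contra_neq hx => ->; exact: hcomp0.
by rewrite leqNgt; apply: contraNN hx => dj; rewrite (hcomp_msize _ (leq_trans pd dj)).
Qed.

Variable j : nat.
Hypotheses (hj : tangent_degree j) (jmin : forall i, tangent_degree i -> (j <= i)%N).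

Let b : R := 3 / 2 * (2 ^+ (n + j) / 4).

Let b_gt0 : 0 < b.
Proof. by rewrite !mulr_gt0 ?invr_gt0 ?exprn_gt0. Qed.

Lemma hcomp_lt_min nu p i x : Tan omega Q nu -> pharmonic d p nu -> (i < j)%N ->
  hcomp p i x = 0.
Proof.
move=> Tnu ph ij; apply/eqP/negPn/negP => hx.
by move: ij; rewrite ltnNge jmin//; exists nu, p; split => //; exists x.
Qed.

(** Minimality of j removes the lower degrees, the growth bound the higher ones. *)
Lemma hcomp_ne_min nu p (K : R) : Tan omega Q nu -> pharmonic d p nu ->
  (forall a : nat, bump_integral nu (2 ^+ a) <= K * b ^+ a) ->
  forall (i : nat) x, i != j -> hcomp p i x = 0.
Proof.
move=> Tnu ph HK i x; rewrite neq_ltn => /orP[|]; first exact: hcomp_lt_min Tnu ph.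
have /andP[j0 _] := tangent_degree_bounds hj.
exact: (growth_bound ph j0 HK).
Qed.

Lemma doubling_scale : exists2 rho, 0 < rho &
  forall l : nat, mass (2^-1 ^+ l * rho) <= b * mass (2^-1 ^+ l.+1 * rho).
Proof.
apply: contrapT => nA.
have /andP[j0 jd] := tangent_degree_bounds hj.
have [nu0 [p0 [T0 ph0 hp0]]] := hj.
have sQ : spt omega Q by case: T0.
have [l0 Hl0] := bump_integral_small ph0 (introT andP (conj j0 jd)) hp0
  (fun i x => hcomp_lt_min x T0 ph0).
have [r0 [c0 [r0_gt0 r0_cvg c0_gt0 H0]]] := Tan_bump romega T0.
(* nu0 satisfies the inequality strictly at every scale 2^-l with l >= l0, so omega satisfies it at
   the first k + 1 of these scales, multiplied by r0_i, once i is large. *)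
have good (k : nat) : exists2 rho, 0 < rho <= k.+1%:R^-1 &
    forall l, (l <= k)%N -> mass (2^-1 ^+ l * rho) <= b * mass (2^-1 ^+ l.+1 * rho).
  suff [i [i1 i2]] : exists i, r0 i <= k.+1%:R^-1 /\ forall l, (l <= k)%N ->
      mass (2^-1 ^+ (l + l0) * r0 i) <= b * mass (2^-1 ^+ (l + l0).+1 * r0 i).
    exists (2^-1 ^+ l0 * r0 i) => [|l lk].
      rewrite mulr_gt0 ?exprn_gt0//=; apply: le_trans i1; apply: ler_piMl; first exact: ltW.
      by rewrite exprn_ile1 ?invr_ge0 ?invf_le1 ?ler1n.
    by rewrite !mulrA -!exprD addSn; exact: i2.
  have e1 : \forall i \near \oo, r0 i <= k.+1%:R^-1.
    by move/cvgr_le : r0_cvg; apply; rewrite invr_gt0.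
  have e2 (l : nat) : \forall i \near \oo,
      mass (2^-1 ^+ (l + l0) * r0 i) <= b * mass (2^-1 ^+ (l + l0).+1 * r0 i).
    have s0 (m : nat) : 0 < (2^-1 : R) ^+ m by rewrite exprn_gt0.
    have h1 : b * (c0 i * mass (2^-1 ^+ (l + l0).+1 * r0 i)) -
        c0 i * mass (2^-1 ^+ (l + l0) * r0 i) @[i --> \oo] -->
        b * bump_integral nu0 (2^-1 ^+ (l + l0).+1) - bump_integral nu0 (2^-1 ^+ (l + l0)).
      apply: cvgB; last exact: H0.
      by apply: cvgM; [exact: cvg_cst|exact: H0].
    have h2 : 0 < b * bump_integral nu0 (2^-1 ^+ (l + l0).+1) - bump_integral nu0 (2^-1 ^+ (l + l0)).
      by rewrite subr_gt0; apply: Hl0; exact: leq_addl.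
    move/cvgr_gt : h1 => /(_ _ h2); apply: filterS => i /=.
    by rewrite subr_gt0 mulrCA ltr_pM2l// => /ltW.
  have e3 m : \forall i \near \oo, forall l, (l < m)%N ->
      mass (2^-1 ^+ (l + l0) * r0 i) <= b * mass (2^-1 ^+ (l + l0).+1 * r0 i).
    elim: m => [|m IH]; first by apply: nearW => i l.
    apply: filterS (filterI IH (e2 m)) => i [h1 h2] l.
    by rewrite ltnS leq_eqVlt => /predU1P[->//|/h1].
  by have [N _ /(_ N (leqnn N))[/= ? ?]] := filterI e1 (e3 k.+1); exists N.
have bad rho : 0 < rho -> exists l : nat, b * mass (2^-1 ^+ l.+1 * rho) < mass (2^-1 ^+ l * rho).
  move=> rho0; apply: contrapT => /forallNP h; apply: nA; exists rho => // l.
  by rewrite leNgt; apply/negP; exact: h.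
have /choice[r Hr] := dyadic_first_failure good bad.
have [|||nu [Tnu Gup [G1 G2]]] := @blowup_limit _ _ omega Q romega sQ b r (ltW b_gt0).
- by move=> k; have [] := Hr k.
- by move=> k; have [] := Hr k.
- by move=> k; have [] := Hr k.
have [p [i [ph _ id hi]]] := Tan_pharmonic Tnu.
have hne := hcomp_ne_min (K := 1) Tnu ph.
have {}hne : forall (i : nat) x, i != j -> hcomp p i x = 0.
  by apply: hne => a; rewrite mul1r.
have ij : i = j.
  by apply/eqP; apply: contrapT => /negP /hne h; have [x] := hi; rewrite h eqxx.
have [C HC] := growth_homogeneous ph id hi (fun k x => ltac:(rewrite ij; exact: hne)).
have half0 : 0 < (2^-1 : R) by rewrite invr_gt0.
(* Homogeneity gives 1 = G(1) = 2^(n+j)/4 G(1/2), hence b G(1/2) = 3/2, against the bound 1 left by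
   the failure below the chosen radii. *)
have C1 : C = 1 by rewrite -(HC 1 ltr01) /growth G1 !expr1n !mul1r invr1.
have := bump_integral_double nu i half0.
rewrite divff// !HC// C1 !mulr1 G1 ij => E.
by move: G2; rewrite /b -[_ * _ * bump_integral _ _]mulrA -E mulr1 ler_pdivrMr// mul1r ler_nat.
Qed.

Lemma Tan_homogeneous : Tan omega Q `<=` Fset n j.
Proof.
move=> nu Tnu; have [p [i [ph hp id hi]]] := Tan_pharmonic Tnu.
have [rho rho0 Hrho] := doubling_scale.
have [r [c [r0 r_cvg c0 H]]] := Tan_bump romega Tnu.
(* The extra factor b is the rounding loss of [dyadic_doubling]; for fixed a the radii r_m are
   eventually small enough to apply it. *)
have Gup a : bump_integral nu (2 ^+ a) <= b * bump_integral nu 1 * b ^+ a.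
  have h1 := H _ (exprn_gt0 a (ltr0n R 2)).
  have h2 : b ^+ a.+1 * (c m * mass (1 * r m)) @[m --> \oo] --> b ^+ a.+1 * bump_integral nu 1.
    by apply: cvgM; [exact: cvg_cst|exact: H].
  rewrite mulrAC -exprS; apply: (le_cvgn h1 h2).
  have e1 : \forall m \near \oo, r m < rho / 2 ^+ a.+1.
    by move/cvgr_lt : r_cvg; apply; rewrite divr_gt0// exprn_gt0.
  apply: filterS e1 => m rm; rewrite mul1r mulrCA ler_pM2l//.
  apply: (dyadic_doubling rho0 (ltW b_gt0) _ Hrho (r0 m)).
    by move=> *; exact: bump_mass_le.
  by rewrite mulrC -ltr_pdivlMr// exprn_gt0.
have hne := hcomp_ne_min Tnu ph Gup.
have ij : i = j.
  by apply/eqP; apply: contrapT => /negP /hne h; have [x] := hi; rewrite h eqxx.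
have [rnu pd p0 H4] := ph.
have E : poly_fun p = hcomp p j.
  apply/funext => x; rewrite (poly_fun_hcomp x pd).
  have jd : (j < d.+1)%N by rewrite -ij; case/andP : id.
  rewrite (bigD1 (Ordinal jd))//= big1 ?addr0// => k kj; apply: hne.
  by apply: contraNneq kj => kj; apply/eqP/val_inj.
(* [Fset] asks for a formally homogeneous polynomial, so the witness is the degree j projection of
   p, which defines the same function. *)
exists (mpoly.pihomog mpoly.mdeg j p); rewrite -/(hcomp p j) -E; split => //.
  by have [x hx] := hi; exists x; rewrite E -ij.
exact: mpoly.pihomogP.
Qed.

End homogeneity.

Theorem theorem1p1 (R : realType) (n : nat) (hn : (3 <= n)%N)
    (Omega : set 'rV[R]_n) (hOmega : NTA Omega)
    (omega : {measure set (borelRV R n) -> \bar R})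
    (homega : harmonic_measure Omega omega)
    (d : nat) (hd : (1 <= d)%N)
    (Q : 'rV[R]_n) (hQ : boundary Omega Q)
    (hTan : Tan omega Q `<=` Pset n d) :
  exists k : nat, (1 <= k <= d)%N /\ Tan omega Q `<=` Fset n k.
Proof.
have romega : radon omega by case: homega => [[X _]|[_]] [].
have [[nu Tnu]|noTan] := pselect (exists nu, Tan omega Q nu); last first.
  (* With no tangent measure the inclusion is vacuous, and k = 1 lies in the range since d >= 1. *)
  by exists 1%N; split => // nu Tnu; case: noTan; exists nu.
have ex : exists j, `[< tangent_degree omega Q d j >].
  have [p [j [ph _ _ hj]]] := Tan_pharmonic hTan Tnu.
  by exists j; apply/asboolP; exists nu, p.
have [j /asboolP hj jmin] := ex_minnP ex.
exists j; split; first exact: tangent_degree_bounds hj.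
by apply: (Tan_homogeneous romega hTan hj) => i /asboolP; exact: jmin.
Qed.
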